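(* Let $X=(X_t)_{t\ge 0}$ be a killed subordinator which is not identically zero, with Laplace exponent $\Phi$, Lévy measure $\Pi$ and potential measure $U$. Assume that there exist constants $n\in\mathbb{N}\cup\{0\}$, $c_0\in(0,+\infty)$, $c_1,\dots,c_n\in\mathbb{R}\setminus\{0\}$ and $\beta_0<\beta_1<\dots<\beta_n<+\infty$ with $\beta_0=\beta\in(0,1]$, and a locally integrable function $R:(0,+\infty)\to(0,+\infty)$ such that $R(t)$ is non-increasing on $(r,+\infty)$ for some $r>0$, $R(t)=o(t^{-1-\beta_n})$ as $t\to+\infty$, and $$\frac{d}{dz}\Big(\frac{1}{\Phi(z)}-\sum_{k=0}^n\frac{1}{c_kz^{\beta_k}}\Big)=O(R(|z|)),\quad\text{as } z\to\infty \text{ in } \{z\in\mathbb{C}\mid\mathrm{Re}\,z>0\}.$$ Let $u(x)$ $(0<x<+\infty)$ be the continuous density of $U|_{(0,+\infty)}$ (which exists under these assumptions), and put $$\varepsilon_1(x)=x^{-2}R(x^{-1})+x^{-1}\int_{x^{-1}}^{+\infty}R(t)\,dt.$$ Define $\varepsilon_2:(0,+\infty)\to\mathbb{R}$ by $$\Pi((x,+\infty))=\frac{c_0x^{-\beta}}{\Gamma(1-\beta)}+\varepsilon_2(x),\quad 0<x<+\infty,$$ and set $\varepsilon_3(s,x)=s\,\Pi((s-sx,+\infty))\,\varepsilon_1(sx)$. Then, for $s\in(0,+\infty)$, the finite measure $$\mathbb{P}\Big(\frac{X_{T(s)-}}{s}\in dx,\;0<\frac{X_{T(s)-}}{s}<1\Big),\quad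 0<x<1,$$ admits the density $s\,\Pi((s-sx,+\infty))\,u(sx)$, and $$\begin{aligned} s\,\Pi((s-sx,+\infty))\,u(sx) ={}&\frac{\sin(\pi\beta)}{\pi}x^{-1+\beta}(1-x)^{-\beta}\\ &+\sum_{k=1}^n\frac{c_0s^{\beta_k-\beta}}{c_k\Gamma(\beta_k)\Gamma(1-\beta)}x^{-1+\beta_k}(1-x)^{-\beta}\\ &+\sum_{k=0}^n\frac{s^{\beta_k}}{c_k\Gamma(\beta_k)}x^{-1+\beta_k}\varepsilon_2(s-sx)+O(\varepsilon_3(s,x)),\quad\text{as } s\to0+, \end{aligned}$$ uniformly in $x\in I$ for any closed interval $I\subset(0,1)$. Therefore, for any closed interval $I\subset(0,1)$, $$\begin{aligned} \mathbb{P}\Big(\frac{X_{T(s)-}}{s}\in I\Big) ={}&\frac{\sin(\pi\beta)}{\pi}\int_I x^{-1+\beta}(1-x)^{-\beta}\,dx\\ &+\sum_{k=1}^n\frac{c_0s^{\beta_k-\beta}}{c_k\Gamma(\beta_k)\Gamma(1-\beta)}\int_I x^{-1+\beta_k}(1-x)^{-\beta}\,dx\\ &+\sum_{k=0}^n\frac{s^{\beta_k}}{c_k\Gamma(\beta_k)}\int_I x^{-1+\beta_k}\varepsilon_2(s-sx)\,dx+O\Big(\sup_{x\in I}\varepsilon_3(s,x)\Big),\quad\text{as } s\to0+. \end{aligned}$$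
   Context: $\mathbb{N}=\{1,2,\dots\}$. A killed subordinator is a process $X$ for which there are a one-dimensional non-decreasing Lévy process $Y$ with $Y_0=0$ and an independent $(0,+\infty]$-valued exponentially distributed random variable $\zeta$ (with $\zeta=+\infty$ a.s. allowed, i.e. killing rate $0$) such that $X_t=Y_t$ for $t<\zeta$ and $X_t=\partial$ (a cemetery point) for $t\ge\zeta$. Its Laplace exponent $\Phi$ is determined by $\mathbb{E}[\exp(-zX_t)]=\exp(-\Phi(z)t)$ for $t\ge0$, $z\in\mathbb{C}$ with $\mathrm{Re}\,z\ge0$ (with $e^{-z\partial}=0$), and has the form $$\Phi(z)=a+bz+\int_{(0,+\infty)}(1-e^{-zx})\,\Pi(dx),\quad \mathrm{Re}\,z\ge 0,$$ with killing rate $a\ge0$, drift coefficient $b\ge0$ and Lévy measure $\Pi$, a $\sigma$-finite measure on $(0,+\infty)$ with $\int_{(0,+\infty)}(1\wedge x)\,\Pi(dx)<+\infty$. ''$X$ is not identically zero'' means $a>0$ or $b>0$ or $\Pi((0,+\infty))>0$; then $\mathrm{Re}\,\Phi(z)>0$ for $\mathrm{Re}\,z>0$. The potential measure $U$ is the locally finite measure on $[0,+\infty)$ defined by $U(A)=\mathbb{E}\big[\int_0^{+\infty}\mathbf{1}_{\{X_t\in A\}}\,dt\big]$ for Borel $A\subset[0,+\infty)$. For $s>0$, $T(s)=\inf\{t\ge0\mid X_t>s\}$ is the first passage time strictly above $s$; $X_{t-}=\lim_{u\to t-}X_u$ is the left limit, with $X_{0-}=X_0=0$. Events involving $X_{T(s)-}$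 are understood on $\{T(s)<\zeta\}$, i.e. $\mathbb{P}(X_{T(s)-}\in dx)=\mathbb{P}(X_{T(s)-}\in dx,\,T(s)<\zeta)$. Complex powers are principal values: $z^w=\exp(w\log z)$ with $\mathrm{Im}\log z\in(-\pi,\pi)$ for $z\in\mathbb{C}\setminus(-\infty,0]$. $1/\Gamma$ denotes the (entire) reciprocal gamma function, so $1/\Gamma(-m)=0$ for $m\in\mathbb{N}\cup\{0\}$ (in particular $1/\Gamma(1-\beta)=0$ when $\beta=1$). $f=g+O(h)$ as $x\to a$ means $|f(x)-g(x)|\le C h(x)$ on some neighborhood of $a$ for some constant $C\in(0,+\infty)$; ''uniformly in $x\in I$'' means the constant and the neighborhood (of $s=0+$) do not depend on $x\in I$ (they may depend on $I$). $f=g+o(h)$ means $|f-g|/h\to0$. *)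

(* Defs.v *)
From HB Require Import structures.
From mathcomp Require Import all_boot all_order all_algebra.
From mathcomp Require Import complex.
From mathcomp Require Import all_classical all_reals all_analysis measurable_realfun.

Set Implicit Arguments.
Unset Strict Implicit.
Unset Printing Implicit Defensive.

Import Order.TTheory GRing.Theory Num.Theory.
Import numFieldNormedType.Exports.

Local Open Scope classical_set_scope.
Local Open Scope complex_scope.
Local Open Scope ring_scope.

Definition cexp (R : realType) (z : R[i]) : R[i] :=
  (expR (complex.Re z) * cos (complex.Im z))
    +i* (expR (complex.Re z) * sin (complex.Im z)).

(* Principal argument; it lies in ]-pi, pi[ off the half-line ]-oo, 0]. *)
Definition carg (R : realType) (z : R[i]) : R :=
  let theta := acos (complex.Re z / ComplexField.Normc.normc z) in
  if 0 <= complex.Im z then theta else - theta.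

Definition clog (R : realType) (z : R[i]) : R[i] :=
  ln (ComplexField.Normc.normc z) +i* carg z.

Definition cpow (R : realType) (z w : R[i]) : R[i] := cexp (w * clog z).

(* The codomain [R[i]^o] is the complex field seen as a normed module over
   itself, so [derive1] is the complex derivative. *)
Definition cderiv (R : realType) (f : R[i] -> R[i]) (z : R[i]) : R[i] :=
  derive1 (f : R[i] -> R[i]^o) z.

Definition cintegral d (T : measurableType d) (R : realType)
    (mu : {measure set T -> \bar R}) (D : set T) (f : T -> R[i]) : R[i] :=
  (\int[mu]_(x in D) complex.Re (f x)) +i* (\int[mu]_(x in D) complex.Im (f x)).

(* Euler's integral, meaningful for [0 < x]. *)
Definition gamma_fun (R : realType) (x : R) : R :=
  \int[lebesgue_measure]_(t in `]0, +oo[) (t `^ (x - 1) * expR (- t)).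

(* The entire function 1/Gamma on the real line, by the functional equation
   1/Gamma(x) = x (x+1) ... (x+m-1) / Gamma(x+m) where [x + m > 0]; it vanishes
   at the nonpositive integers. *)
Definition rgamma (R : realType) (x : R) : R :=
  let m := (Num.truncn `|x|).+1 in
  (\prod_(0 <= i < m) (x + i%:R)) / gamma_fun (x + m%:R).

Section subordinators.
Context d (T : measurableType d) (R : realType) (P : probability T R).

Definition sigma_process (I : set R) (Y : R -> T -> R) : set (set T) :=
  <<s \bigcup_(t in I) preimage_set_system setT (Y t) measurable >>.

Definition independent_systems (F G : set (set T)) :=
  forall A B, F A -> G B -> P (A `&` B) = (P A * P B)%E.

(* Processes are indexed by the whole real line; only times [0 <= t] matter. *)
Definition is_levy_process (Y : R -> T -> R) :=
  [/\ forall t, 0 <= t -> measurable_fun setT (Y t),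
      forall w t, 0 <= t -> Y u w @[u --> t^'+] --> Y t w,
      forall w t, 0 < t -> cvg (Y u w @[u --> t^'-]),
      forall t h, 0 <= t -> 0 <= h ->
        independent_systems (sigma_process `[0, t] Y)
          (preimage_set_system setT (fun w => Y (t + h) w - Y t w) measurable) &
      forall t h, 0 <= t -> 0 <= h -> forall B : set R, measurable B ->
        P ((fun w => Y (t + h) w - Y t w) @^-1` B) =
        P ((fun w => Y h w - Y 0 w) @^-1` B)].

(* [None] is the cemetery point. For [q = 0] the tail formula says that [zeta]
   is almost surely infinite. *)
Definition is_killed_subordinator (X : R -> T -> option R) :=
  exists (Y : R -> T -> R) (zeta : T -> \bar R) (q : R),
    [/\ is_levy_process Y,
        (forall w, Y 0 w = 0) /\
        (forall w t t', 0 <= t -> t <= t' -> Y t w <= Y t' w),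
        [/\ measurable_fun setT zeta, (forall w, (0 < zeta w)%E), 0 <= q &
            forall t, 0 <= t ->
              P [set w | (t%:E < zeta w)%E] = (expR (- (q * t)))%:E],
        independent_systems (sigma_process `[0, +oo[ Y)
          (preimage_set_system setT zeta measurable) &
        forall t w, 0 <= t ->
          X t w = if (t%:E < zeta w)%E then Some (Y t w) else None].

Definition is_laplace_exponent (X : R -> T -> option R) (Phi : R[i] -> R[i]) :=
  forall (t : R) (z : R[i]), 0 <= t -> 0 <= complex.Re z ->
    cintegral P setT
      (fun w => if X t w is Some y then cexp (- (z * y%:C)) else 0) =
    cexp (- (Phi z * t%:C)).

(* [Pi] is a measure on the line carried by ]0, +oo[. *)
Definition has_levy_triplet (Phi : R[i] -> R[i]) (a b : R)
    (Pi : {measure set R -> \bar R}) :=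
  [/\ 0 <= a /\ 0 <= b,
      Pi `]-oo, 0]%classic = 0%E,
      sigma_finite setT Pi,
      (\int[Pi]_(x in `]0%R, +oo[) (Num.min 1%R x)%:E < +oo)%E &
      forall z : R[i], 0 <= complex.Re z ->
        Phi z = a%:C + b%:C * z +
          cintegral Pi `]0, +oo[ (fun x => 1 - cexp (- (z * x%:C)))].

Definition potential_measure (X : R -> T -> option R) (A : set R) : \bar R :=
  (\int[P]_w \int[lebesgue_measure]_(t in `[0%R, +oo[)
     (\1_(Some @` A) (X t w))%:E)%E.

Definition is_continuous_potential_density
    (X : R -> T -> option R) (u : R -> R) :=
  [/\ forall x, 0 < x -> 0 <= u x,
      forall x, 0 < x -> {for x, continuous u} &
      forall A : set R, measurable A -> A `<=` `]0, +oo[ ->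
        potential_measure X A = (\int[lebesgue_measure]_(x in A) (u x)%:E)%E].

Definition lifetime (X : R -> T -> option R) (w : T) : \bar R :=
  ereal_inf [set t%:E | t in [set t | 0 <= t /\ X t w = None]].

Definition passage_time (X : R -> T -> option R) (s : R) (w : T) : \bar R :=
  ereal_inf [set t%:E | t in
    [set t | 0 <= t /\ exists2 y, X t w = Some y & s < y]].

(* Only used for [t < lifetime X w]: the value given to the cemetery is
   irrelevant. *)
Definition left_limit (X : R -> T -> option R) (t : R) (w : T) : R :=
  if t == 0 then 0 else lim (odflt 0 (X u w) @[u --> t^'-]).

Definition undershoot (X : R -> T -> option R) (s : R) (w : T) : R :=
  left_limit X (fine (passage_time X s w)) w.

(* P(X_{T(s)-} / s \in A), restricted to the event T(s) < zeta. *)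
Definition undershoot_law (X : R -> T -> option R) (s : R) (A : set R) :
    \bar R :=
  P [set w | (passage_time X s w < lifetime X w)%E /\ A (undershoot X s w / s)].

End subordinators.

Section error_terms.
Context (R : realType).

Definition levy_tail (Pi : {measure set R -> \bar R})
  (x : R) : R := fine (Pi `]x, +oo[%classic).

Definition eps1 (rho : R -> R) (x : R) : R :=
  x `^ (- 2) * rho x^-1 +
  x^-1 * \int[lebesgue_measure]_(t in `[x^-1, +oo[) rho t.

Definition eps2 (Pi : {measure set R -> \bar R})
    (c0 beta x : R) : R :=
  levy_tail Pi x - c0 * x `^ (- beta) * rgamma (1 - beta).

Definition eps3 (Pi : {measure set R -> \bar R})
    (rho : R -> R) (s x : R) : R :=
  s * levy_tail Pi (s - s * x) * eps1 rho (s * x).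

End error_terms.

(* Main.v *)
Require Import Defs.
From HB Require Import structures.
From mathcomp Require Import all_boot all_order all_algebra.
From mathcomp Require Import complex.
From mathcomp Require Import all_classical all_reals all_analysis measurable_realfun.
From mathcomp Require Import ring lra.

(** Write $\bar\Pi(x)=\Pi((x,\infty))$, $W(x)=\sum_{k\le n}x^{\beta_k-1}/(c_k\Gamma(\beta_k))$
   and $D=X_{T(s)-}$ for the undershoot; $\rho$ is the function that bounds the derivative. Since $\varepsilon_2$ is defined as
   $\bar\Pi(x)-c_0x^{-\beta}/\Gamma(1-\beta)$ and $1/(\Gamma(\beta)\Gamma(1-\beta))=\sin(\pi\beta)/\pi$,
   the long expansion is nothing but $s\,\bar\Pi(s-sx)\,W(sx)$ ([expansionE]). The theorem is
   therefore the conjunction of an asymptotic statement, $u=W+O(\varepsilon_1)$ at $0+$, and of an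
   exact formula for the law of the undershoot, $P(D\in dy)=\bar\Pi(s-y)u(y)\,dy$ on $(0,s)$.

   The asymptotic statement is a Fourier inversion. The potential measure satisfies
   $\int e^{-zx}U(dx)=1/\Phi(z)$ for $\Re z>0$ ([lap_occupation]), and $W$ has transform
   $\sum_k 1/(c_kz^{\beta_k})$ ([lap_gpowE], [lap_power_density]). Differentiating in $z$ multiplies
   a measure by $-x$, so on each line $\Re z=s$ the hypothesis bounds the Fourier transform of
   $xe^{-sx}(U(dx)-W(x)dx)$ by $C\rho(|z|)$, which is integrable along the line. Inversion
   ([inverse_fourierE]) gives a continuous density and, after multiplication by $e^{sx}/x$, the bound
   $|u(x)-W(x)|\le \frac{2Ce^{sx}}{\pi x}\big(s\rho(s)+\int_s^\infty\rho\big)$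
   ([density_at_abscissa]). The choice $s=1/x$ turns the right-hand side into a multiple of
   $\varepsilon_1(x)$ ([potential_density_asymptotics]). The transforms of $xU(dx)$ and
   $xW(x)dx$ need not be integrable along the lines, only their difference is; hence the inversion
   is done by Abel summation of both measures separately.

   The law of the undershoot is obtained from the path sampled at the times $k/N$, without
   compensation formula for the jump measure. On the event that $s$ is crossed before the killing with
   $\alpha<D<\beta$, for large $N$ some step starts in $(\alpha,\beta]$ and increases the path by at
   least $s-\beta$; a step that starts there and increases the path by more than $s-\alpha$
   forces the crossing, and such steps are mutually exclusive. By the Markov property the
   probability of such steps factors into the expected number of visits to $(\alpha,\beta]$ and the
   probability of one large increment ([cells_le], [cells_eq]). Divided and multiplied by $N$, the
   first factor tends to $U((\alpha,\beta])$ ([visits_occupation]) and the second one is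
   asymptotically between values of $\bar\Pi$ near $s-\beta$ and $s-\alpha$ ([killed_tail_le],
   [killed_tail_ge]). So the law of $D$ is squeezed, on every interval, between
   products of $U$ with values of $\bar\Pi$ ([crossing_law_le], [crossing_law_ge]); the measure
   $\bar\Pi(s-y)U(dy)$ is squeezed in the same way, and two such measures coincide because the
   errors telescope over a fine subdivision ([sandwiched_eq]). *)

Set Implicit Arguments.
Unset Strict Implicit.
Unset Printing Implicit Defensive.

Import Order.TTheory GRing.Theory Num.Theory.
Import numFieldNormedType.Exports.

Local Open Scope classical_set_scope.
Local Open Scope complex_scope.
Local Open Scope ring_scope.

(** * Pushforward laws with a density *)

Lemma measurable_preimage d d' (T : measurableType d) (Y : measurableType d')
    (f : T -> Y) (A : set Y) :
  measurable_fun setT f -> measurable A -> measurable (f @^-1` A).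
Proof. by move=> mf mA; rewrite -[X in measurable X]setTI; exact: mf. Qed.

Section weighted_law.
Local Open Scope ereal_scope.
Context d (T : measurableType d) d' (Y : measurableType d') (R : realType).

(** The image under $\xi$ of the measure $g\,d\nu$. Occupation measures, measures with a
   density and laws restricted to an event are all of this form. *)
Definition weighted_law (nu : {measure set T -> \bar R}) (g : T -> R)
    (xi : T -> Y) (mg : measurable_fun setT g) (g0 : forall x, (0 <= g x)%R)
    (mxi : measurable_fun setT xi) (A : set Y) : \bar R :=
  \int[nu]_(x in xi @^-1` A) (g x)%:E.

Variables (nu : {measure set T -> \bar R}) (g : T -> R) (xi : T -> Y).
Variables (mg : measurable_fun setT g) (g0 : forall x, (0 <= g x)%R).
Variables (mxi : measurable_fun setT xi).

Local Notation law := (@weighted_law nu g xi mg g0 mxi).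

Let law0 : law set0 = 0.
Proof. by rewrite /weighted_law preimage_set0 integral_set0. Qed.

Let law_ge0 A : 0 <= law A.
Proof. by apply: integral_ge0 => x _; rewrite lee_fin. Qed.

Let law_sigma_additive : semi_sigma_additive law.
Proof.
move=> /= F mF tF mUF; rewrite /weighted_law; apply: cvg_toP.
  apply: ereal_nondecreasing_is_cvgn => m n mn.
  apply: lee_sum_nneg_natr => // k _ _; exact: law_ge0.
rewrite preimage_bigcup ge0_integral_bigcup//=.
- by move=> n; exact: measurable_preimage.
- exact/measurable_funTS/measurable_EFinP.
- by move=> x _; rewrite lee_fin.
- apply/trivIsetP => i j _ _ ij; rewrite -preimage_setI.
  by move/trivIsetP : tF => /(_ i j I I ij) ->; rewrite preimage_set0.
Qed.

HB.instance Definition _ := isMeasure.Build _ _ _ law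
  law0 law_ge0 law_sigma_additive.

Import HBNNSimple.

Lemma ge0_integral_weighted_law (D : set Y) (f : Y -> \bar R) :
  measurable D -> measurable_fun D f -> (forall x, D x -> 0 <= f x) ->
  \int[law]_(x in D) f x = \int[nu]_(x in xi @^-1` D) (f (xi x) * (g x)%:E).
Proof.
move=> mD mf f0.
have mpre A : measurable A -> measurable (xi @^-1` A).
  exact: measurable_preimage.
have mgE A : measurable_fun A (EFin \o g).
  exact/measurable_funTS/measurable_EFinP.
pose f_ := nnsfun_approx mD mf.
transitivity (limn (fun n => \int[law]_(x in D) (f_ n x)%:E)).
  rewrite -monotone_convergence//.
  - by apply: eq_integral => y /[!inE] yD; apply/esym/cvg_lim => //; exact: cvg_nnsfun_approx.
  - by move=> n; exact/measurable_EFinP/measurable_funTS.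
  - by move=> n y _; rewrite lee_fin.
  - by move=> y _ m n mn; rewrite lee_fin; exact/lefP/nd_nnsfun_approx.
transitivity (limn (fun n => \int[nu]_(x in xi @^-1` D) ((f_ n (xi x))%:E * (g x)%:E))); last first.
  rewrite -monotone_convergence//.
  - apply: eq_integral => x /[!inE] xD; apply/cvg_lim => //.
    apply: cvgeZr => //; exact: cvg_nnsfun_approx.
  - exact: mpre.
  - move=> n; apply: emeasurable_funM => //.
    by apply/measurable_funTS/measurable_EFinP; apply: measurableT_comp.
  - by move=> n y _; rewrite mule_ge0// lee_fin.
  - move=> y _ m n mn; apply: lee_wpmul2r; first by rewrite lee_fin.
    by rewrite lee_fin; exact/lefP/nd_nnsfun_approx.
congr (limn _); apply/funext => n.
under [LHS]eq_integral do rewrite fimfunE -fsumEFin//.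
rewrite ge0_integral_fsum//; last 2 first.
- move=> r; apply/measurable_EFinP/measurable_funTS.
  exact: measurable_funM.
- by move=> r y _; rewrite EFinM nnfun_muleindic_ge0.
under [RHS]eq_integral.
  move=> x _; rewrite fimfunE -fsumEFin// ge0_mule_fsuml; last first.
    by move=> r; rewrite EFinM nnfun_muleindic_ge0.
  over.
rewrite ge0_integral_fsum//; last 3 first.
- exact: mpre.
- move=> r; apply: emeasurable_funM => //; apply/measurable_EFinP/measurable_funTS.
  by apply: measurable_funM => //; apply: measurableT_comp.
- move=> r y _; apply: mule_ge0; last by rewrite lee_fin.
  by rewrite EFinM nnfun_muleindic_ge0.
apply: eq_fsbigr => r _; rewrite integralZl_indic_nnsfun//.
rewrite integral_indic//=.
have [r0|r0] := ltP r 0%R.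
  rewrite preimage_nnfun0// set0I measure0 mule0.
  rewrite integral0_eq// => x _.
  by rewrite indic0 mulr0 mul0e.
under [RHS]eq_integral do rewrite EFinM -muleA.
rewrite ge0_integralZl//.
- congr (_ * _); rewrite /weighted_law setIC preimage_setI.
  rewrite [LHS]integral_mkcondr; apply: eq_integral => x _.
  rewrite patchE indicE.
  have -> : (x \in xi @^-1` (f_ n @^-1` [set r])) = (xi x \in f_ n @^-1` [set r]).
    by [].
  by case: (_ \in _); rewrite ?mul1e ?mul0e.
- exact: mpre.
- apply: emeasurable_funM => //; apply/measurable_EFinP/measurable_funTS.
  by apply: measurableT_comp.
- by move=> x _; rewrite mule_ge0// lee_fin.
Qed.

End weighted_law.

(** * Integrals over segments and half-lines *)

Section ftc_line.
Context {R : realType}.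
Notation mu := (@lebesgue_measure R).

(** The primitive is differentiable everywhere, so its continuity at the end points is free. *)
Lemma FTC_segment (f F : R -> R) a b : a <= b ->
  (forall x, is_derive x (1:R) F (f x)) -> continuous f ->
  (\int[mu]_(x in `[a, b]) (f x)%:E = (F b - F a)%:E)%E.
Proof.
rewrite le_eqVlt => /predU1P[->|ab] dF cf.
  by rewrite set_itv1 integral_set1 subrr.
have cF x : {for x, continuous F}.
  apply/differentiable_continuous/derivable1_diffP.
  by have [] := dF x.
rewrite (continuous_FTC2 (F:=F) ab) ?EFinB//.
- exact: continuous_subspaceT.
- split.
  + by move=> x _; have [] := dF x.
  + exact/cvg_at_right_filter/cF.
  + exact/cvg_at_left_filter/cF.
- by move=> x _; rewrite derive1E; apply: derive_val.
Qed.

Lemma Rintegral_halfline_cvg (f : R -> R) :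
  mu.-integrable `[0, +oo[ (EFin \o f) ->
  (\int[mu]_(x in `[0, n%:R]) f x) @[n --> \oo] --> \int[mu]_(x in `[0, +oo[) f x.
Proof.
move=> intf.
have mf := measurable_int _ intf.
apply: fine_cvg; rewrite fineK; last exact: integrable_fin_num.
have sub (n : nat) : (`[0, n%:R] `<=` (`[0, +oo[ : set R)).
  by move=> x; rewrite /= !in_itv/= andbT => /andP[].
have E (n : nat) : (\int[mu]_(x in `[0%R, (n%:R)%R]) (f x)%:E =
    \int[mu]_(x in `[0%R, +oo[) ((EFin \o f) \_ `[0%R, (n%:R)%R]) x)%E.
  by rewrite -integral_mkcondr (setIidr (sub n)).
under eq_cvg do rewrite E.
apply: (@dominated_cvg _ _ _ mu _ _ _ _ (fun x => `|(f x)%:E|%E)) => //=.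
- move=> n; apply/(measurable_restrict _ _ _) => //.
  by apply: measurable_funS mf => //; exact: subIsetl.
- move=> x; rewrite in_itv/= andbT => x0.
  apply: cvg_near_cst; near=> n.
  rewrite patchE mem_set//= in_itv/= x0/=.
  by near: n; exact: nbhs_infty_ger.
- exact: (integrable_abse intf).
- move=> n x _; rewrite patchE; case: ifP => //= _.
  by rewrite normr0 lee_fin.
Unshelve. all: by end_near. Qed.

Lemma Rintegral_halfline_FTC (f F : R -> R) l :
  (forall x, is_derive x (1:R) F (f x)) -> continuous f ->
  mu.-integrable `[0, +oo[ (EFin \o f) -> F n%:R @[n --> \oo] --> l ->
  \int[mu]_(x in `[0, +oo[) f x = l - F 0.
Proof.
move=> dF cf intf Fl.
have /cvg_lim <- // := Rintegral_halfline_cvg intf.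
apply/cvg_lim => //.
under eq_cvg do rewrite /Rintegral (FTC_segment (ler0n _ _) dF cf)/=.
by apply: cvgB => //; exact: cvg_cst.
Qed.

Lemma cvg_expRN (c : R) : 0 < c -> expR (- (c * n%:R)) @[n --> \oo] --> (0 : R).
Proof.
move=> c0; have e1 : `|expR (- c)| < 1.
  by rewrite ger0_norm ?expR_ge0// expR_lt1 oppr_lt0.
under eq_cvg do rewrite -mulNr expRM_natr.
exact: cvg_expr.
Qed.

Lemma continuous_is_derive (F : R -> R) (f : R -> R) :
  (forall x, is_derive x (1:R) F (f x)) -> continuous F.
Proof.
move=> dF x; apply/differentiable_continuous/derivable1_diffP.
by have [] := dF x.
Qed.

Lemma integrable_expRN (c : R) : 0 < c ->
  mu.-integrable `[0, +oo[ (EFin \o (fun x => expR (- (c * x)))).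
Proof.
move=> c0.
have dE x : is_derive x (1:R) (fun x => - c^-1 * expR (- (c * x))) (expR (- (c * x))).
  apply: is_derive_eq; rewrite /GRing.scale/=; field; exact: lt0r_neq0.
have cE := continuous_is_derive dE.
have ce : continuous (fun x : R => expR (- (c * x))).
  apply: (@continuous_is_derive _ (fun x => - c * expR (- (c * x)))) => x.
  by apply: is_derive_eq; rewrite /GRing.scale/=; ring.
apply/integrableP; split.
  apply/measurable_EFinP/measurable_funTS; exact: continuous_measurable_fun.
under eq_integral do rewrite /= ger0_norm ?expR_ge0//.
rewrite (@ge0_continuous_FTC2y _ _ (fun x => - c^-1 * expR (- (c * x))) 0 0)//.
- by rewrite -EFinB ltry.
- exact: continuous_subspaceT.
- rewrite -[X in _ --> X](mulr0 (- c^-1)); apply: cvgM; first exact: cvg_cst.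
  exact: (@cvg_comp _ _ _ (fun x => c * x) (fun x => expR (- x)) _ _ _
    (gt0_cvgMry c0 cvg_id) (@cvgr_expR R)).
- exact/cvg_at_right_filter/cE.
- by move=> x _; rewrite derive1E; apply: derive_val.
Qed.

Lemma expR_halfline_integrable (c : R) (f : R -> R) : 0 < c -> continuous f ->
  (forall x, `|f x| <= 1) ->
  mu.-integrable `[0, +oo[ (EFin \o (fun x => expR (- (c * x)) * f x)).
Proof.
move=> c0 cf f1.
have ie := integrable_expRN c0.
have [me _] := integrableP _ _ _ ie.
apply: le_integrable ie => //.
  apply/measurable_EFinP/measurable_funM; first exact/measurable_EFinP.
  by apply: measurable_funTS; exact: continuous_measurable_fun.
move=> x _; rewrite /= lee_fin normrM ger_pMr ?normr_gt0 ?gt_eqF ?expR_gt0//.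
Qed.

Lemma cvg_expRN_dominated (c K : R) (f : R -> R) : 0 < c ->
  (forall x, `|f x| <= K) ->
  expR (- (c * n%:R)) * f n%:R @[n --> \oo] --> (0 : R).
Proof.
move=> c0 fK; apply: norm_cvg0.
apply: (@squeeze_cvgr _ _ _ _ (cst 0) (fun n => expR (- (c * n%:R)) * K)).
- apply: nearW => n; rewrite normr_ge0/= normrM ger0_norm ?expR_ge0//.
  by rewrite ler_wpM2l ?expR_ge0.
- exact: cvg_cst.
- rewrite -[X in _ --> X](mul0r K); apply: cvgM; last exact: cvg_cst.
  exact: cvg_expRN.
Qed.

Lemma laplace_cos (c x : R) : 0 < c ->
  \int[mu]_(y in `[0, +oo[) (expR (- (c * y)) * cos (x * y)) =
  c / (c ^+ 2 + x ^+ 2).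
Proof.
move=> c0; have q0 : c ^+ 2 + x ^+ 2 != 0.
  by rewrite gt_eqF// ltr_wpDr ?sqr_ge0// exprn_gt0.
have cc : continuous (fun y : R => cos (x * y)).
  apply: (@continuous_is_derive _ (fun y => - x * sin (x * y))) => y.
  by apply: is_derive_eq; rewrite /GRing.scale/=; ring.
pose F (y : R) := (c ^+ 2 + x ^+ 2)^-1 * (expR (- (c * y)) * (x * sin (x * y) - c * cos (x * y))).
have dF (y : R) : is_derive y (1:R) F (expR (- (c * y)) * cos (x * y)).
  by apply: is_derive_eq; rewrite /GRing.scale/=; field.
transitivity (0 - F 0); last first.
  by rewrite /F mulr0 oppr0 expR0 mulr0 sin0 cos0; field.
apply: (Rintegral_halfline_FTC dF).
- apply: (@continuous_is_derive _ (fun y => expR (- (c * y)) * (- c * cos (x * y) - x * sin (x * y)))) => y.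
  by apply: is_derive_eq; rewrite /GRing.scale/=; ring.
- by apply: expR_halfline_integrable => // y; rewrite ler_norml cos_geN1 cos_le1.
- rewrite -[X in _ --> X](mulr0 ((c ^+ 2 + x ^+ 2)^-1)); apply: cvgM; first exact: cvg_cst.
  apply: (@cvg_expRN_dominated c (`|x| + `|c|) (fun y => x * sin (x * y) - c * cos (x * y)) c0) => y.
  rewrite (le_trans (ler_normB _ _))// lerD// normrM ler_piMr ?ler_norml ?cos_geN1 ?cos_le1//.
  by rewrite sin_geN1 sin_le1.
Qed.

Lemma laplace_sin (c x : R) : 0 < c ->
  \int[mu]_(y in `[0, +oo[) (expR (- (c * y)) * sin (x * y)) =
  x / (c ^+ 2 + x ^+ 2).
Proof.
move=> c0; have q0 : c ^+ 2 + x ^+ 2 != 0.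
  by rewrite gt_eqF// ltr_wpDr ?sqr_ge0// exprn_gt0.
have cc : continuous (fun y : R => sin (x * y)).
  apply: (@continuous_is_derive _ (fun y => x * cos (x * y))) => y.
  by apply: is_derive_eq; rewrite /GRing.scale/=; ring.
pose F (y : R) := (c ^+ 2 + x ^+ 2)^-1 * (expR (- (c * y)) * (- c * sin (x * y) - x * cos (x * y))).
have dF (y : R) : is_derive y (1:R) F (expR (- (c * y)) * sin (x * y)).
  by apply: is_derive_eq; rewrite /GRing.scale/=; field.
transitivity (0 - F 0); last first.
  by rewrite /F mulr0 oppr0 expR0 mulr0 sin0 cos0; field.
apply: (Rintegral_halfline_FTC dF).
- apply: (@continuous_is_derive _ (fun y => expR (- (c * y)) * (- c * sin (x * y) + x * cos (x * y)))) => y.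
  by apply: is_derive_eq; rewrite /GRing.scale/=; ring.
- by apply: expR_halfline_integrable => // y; rewrite ler_norml sin_geN1 sin_le1.
- rewrite -[X in _ --> X](mulr0 ((c ^+ 2 + x ^+ 2)^-1)); apply: cvgM; first exact: cvg_cst.
  apply: (@cvg_expRN_dominated c (`|- c| + `|x|) (fun y => - c * sin (x * y) - x * cos (x * y)) c0) => y.
  rewrite (le_trans (ler_normB _ _))// lerD// normrM ler_piMr ?ler_norml ?cos_geN1 ?cos_le1//.
  by rewrite sin_geN1 sin_le1.
Qed.

Lemma integral_cauchy_kernel (e xi a b : R) : 0 < e -> a <= b ->
  (\int[mu]_(x in `[a, b]) (e / (e ^+ 2 + (x - xi) ^+ 2))%:E =
   (atan ((b - xi) / e) - atan ((a - xi) / e))%:E)%E.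
Proof.
move=> e0 ab.
have q0 x : e ^+ 2 + (x - xi) ^+ 2 != 0.
  by rewrite gt_eqF// ltr_wpDr ?sqr_ge0// exprn_gt0.
have dq (x : R) : is_derive x (1:R) (fun x => (x - xi) / e) (e^-1).
  by apply: is_derive_eq; rewrite /GRing.scale/=; ring.
have dF (x : R) : is_derive x (1:R) (fun x => atan ((x - xi) / e)) (e / (e ^+ 2 + (x - xi) ^+ 2)).
  apply: (is_derive_eq (is_derive1_comp (is_derive1_atan _) (dq x))).
  by field; rewrite q0 gt_eqF.
rewrite (FTC_segment ab dF)//.
move=> x; apply: cvgM; first exact: cvg_cst.
apply: cvgV => //; apply: cvgD; first exact: cvg_cst.
have cx : {for x, continuous (fun x => x - xi)}.
  by apply: cvgB; [exact: cvg_id|exact: cvg_cst].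
by rewrite /= expr2; apply: cvgM; exact: cx.
Qed.

(** The image of Lebesgue measure under $x\mapsto cx$, multiplied by $c$, gives intervals
   their length, hence is Lebesgue measure. *)
Lemma ge0_integral_dilation (c : R) (D : set R) (f : R -> \bar R) : 0 < c ->
  measurable D -> measurable_fun D f -> (forall x, D x -> (0 <= f x)%E) ->
  (\int[mu]_(x in (fun x => (c * x)%R) @^-1` D) f (c * x)%R =
   (c^-1)%:E * \int[mu]_(x in D) f x)%E.
Proof.
move=> c0 mD mf f0.
have mc : measurable_fun setT (fun x : measurableTypeR R => c * x : measurableTypeR R).
  exact: mulrl_measurable.
pose law : {measure set (measurableTypeR R) -> \bar R} := weighted_law mu (@measurable_cst _ _ (measurableTypeR R) R setT c)
  (fun=> ltW c0) mc.
have E A : measurable A -> mu A = law A.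
  move=> mA; apply: lebesgue_measure_unique => // _ [[a b] _ <-] /=.
  have mpre : measurable ((fun x => c * x) @^-1` `]a, b]).
    exact: (measurable_preimage mc (measurable_itv _)).
  have -> : weighted_law mu (@measurable_cst _ _ (measurableTypeR R) R setT c)
      (fun=> ltW c0) mc `]a, b] = (c%:E * mu ((fun x => (c * x)%R) @^-1` `]a, b]))%E.
    by rewrite -(integral_cst mu mpre c%:E).
  have -> : (fun x => c * x) @^-1` `]a, b] = `]a / c, b / c]%classic.
    by apply/seteqP; split=> x; rewrite /= !in_itv/= ltr_pdivrMr// ler_pdivlMr// mulrC.
  rewrite !lebesgue_measure_itv/= !lte_fin ltr_pM2r ?invr_gt0//.
  case: ifPn => _; last by rewrite mule0.
  by rewrite -!EFinD -EFinM; congr EFin; field; exact: lt0r_neq0.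
have -> : (\int[mu]_(x in D) f x = \int[law]_(x in D) f x)%E.
  by apply: eq_measure_integral => A mA _; exact: E.
rewrite ge0_integral_weighted_law//.
rewrite -ge0_integralZl//.
- by apply: eq_integral => x _; rewrite [RHS]muleC -muleA -EFinM divff ?mule1// gt_eqF.
- exact: (measurable_preimage mc).
- apply: emeasurable_funM; last exact/measurable_EFinP/measurable_cst.
  apply: (measurable_comp mD) => //; first by move=> _ [x Dx <-].
- by move=> x Dx; rewrite mule_ge0 ?lee_fin ?(ltW c0)//; exact: f0.
- by rewrite lee_fin invr_ge0 ltW.
Qed.

End ftc_line.

(** * Laplace transforms on the right half-plane *)

Section elementary.
Context {R : realType}.

Lemma MVT_from0 (f df : R -> R) (x : R) : (forall y, is_derive y (1:R) f (df y)) ->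
  exists2 c, `|c| <= `|x| & f x - f 0 = df c * x.
Proof.
move=> dF.
have cf a b : {within `[a, b], continuous f}.
  exact/continuous_subspaceT/(continuous_is_derive dF).
have [x0|x0|->] := ltgtP x 0.
- have [c /itvP cx E] := MVT x0 (fun y _ => dF y) (cf _ _).
  exists c; first by rewrite !ler0_norm ?lerN2 ?(ltW x0) ?cx// ltW// cx.
  by rewrite -opprB E sub0r mulrN opprK.
- have [c /itvP cx E] := MVT x0 (fun y _ => dF y) (cf _ _).
  exists c; first by rewrite !ger0_norm ?(ltW x0) ?cx.
  by rewrite E subr0.
- by exists 0; rewrite // subrr mulr0.
Qed.

Lemma normr_sin_le (v : R) : `|sin v| <= `|v|.
Proof.
have [c _] := @MVT_from0 sin cos v (@is_derive_sin R).
rewrite sin0 subr0 => ->; rewrite normrM ler_piMl//.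
by rewrite ler_norml cos_geN1 cos_le1.
Qed.

Lemma normr_cosB1_le (v : R) : `|cos v - 1| <= v ^+ 2.
Proof.
have [c cv] := @MVT_from0 cos (fun x => - sin x) v (@is_derive_cos R).
rewrite cos0 => ->; rewrite normrM normrN -[leRHS]real_normK ?num_real// expr2.
by rewrite ler_wpM2r// (le_trans (normr_sin_le _)).
Qed.

Lemma normr_sinB_le (v : R) : `|sin v - v| <= v ^+ 2.
Proof.
have dF (y : R) : is_derive y (1:R) (fun x => sin x - x) (cos y - 1).
  by apply: is_derive_eq.
have [c cv] := MVT_from0 v dF.
rewrite sin0 subr0 subr0 => ->.
have [c' cv'] := @MVT_from0 cos (fun x => - sin x) c (@is_derive_cos R).
rewrite cos0 => ->; rewrite !normrM normrN -[leRHS]real_normK ?num_real// expr2.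
rewrite ler_wpM2r// (le_trans _ cv)// ler_piMl//.
by rewrite ler_norml sin_geN1 sin_le1.
Qed.

Lemma normr_expRB1_le (u : R) : `|expR u - 1| <= `|u| * expR `|u|.
Proof.
have [c cu] := @MVT_from0 expR expR u (@is_derive_expR R).
rewrite expR0 => ->; rewrite normrM mulrC ler_wpM2l//.
by rewrite ger0_norm ?expR_ge0// ler_expR (le_trans (ler_norm _)).
Qed.

Lemma normr_expRB1B_le (u : R) : `|expR u - 1 - u| <= u ^+ 2 * expR `|u|.
Proof.
have dF (y : R) : is_derive y (1:R) (fun x => expR x - 1 - x) (expR y - 1).
  by apply: is_derive_eq; rewrite subr0.
have [c cu] := MVT_from0 u dF.
rewrite expR0 !subrr subr0 => ->.
rewrite normrM -[in leRHS]real_normK ?num_real// expr2 mulrAC ler_wpM2r//.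
by rewrite (le_trans (normr_expRB1_le _))// ler_pM// ?expR_ge0// ler_expR.
Qed.

(** The two real components of $e^{w}-1-w=O(w^2)$. *)
Lemma cexp_taylor_Re (u v : R) :
  `|expR u * cos v - 1 - u| <= (u ^+ 2 + v ^+ 2) * expR `|u|.
Proof.
have -> : expR u * cos v - 1 - u = (expR u - 1 - u) + expR u * (cos v - 1) by ring.
rewrite (le_trans (ler_normD _ _))// mulrDl lerD ?normr_expRB1B_le//.
rewrite normrM mulrC ler_pM ?normr_cosB1_le//.
by rewrite ger0_norm ?expR_ge0// ler_expR ler_norm.
Qed.

Lemma cexp_taylor_Im (u v : R) :
  `|expR u * sin v - v| <= 2 * (u ^+ 2 + v ^+ 2) * expR `|u|.
Proof.
have -> : expR u * sin v - v = (expR u - 1) * sin v + (sin v - v) by ring.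
rewrite (le_trans (ler_normD _ _))//.
have e1 : 1 <= expR `|u| by rewrite (le_trans _ (expR_ge1Dx _))// lerDl.
have := normr_expRB1_le u; have := normr_sinB_le v; have := normr_sin_le v.
rewrite normrM; set E := expR `|u|; rewrite -/E in e1 *.
set a := `|expR u - 1|; set b := `|sin v|; set c := `|sin v - v|.
rewrite -[u ^+ 2]real_normK ?num_real// -[v ^+ 2]real_normK ?num_real//.
have : 0 <= a by rewrite /a. have : 0 <= b by rewrite /b.
have : 0 <= `|u| by []. have : 0 <= `|v| by [].
move: a b c `|u| `|v| => a b c p q q0 p0 b0 a0 bq cq ap.
have : a * b <= p * E * q by apply: ler_pM.
have : c <= q ^+ 2 * E by apply: (le_trans cq); rewrite ler_peMr// exprn_ge0.
have : 0 <= (p - q) ^+ 2 * E by rewrite mulr_ge0 ?sqr_ge0// (le_trans _ e1).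
have : 0 <= p ^+ 2 * E by rewrite mulr_ge0 ?sqr_ge0// (le_trans _ e1).
have : 0 <= q ^+ 2 * E by rewrite mulr_ge0 ?sqr_ge0// (le_trans _ e1).
nra.
Qed.

End elementary.

(** Stated over an arbitrary field with a norm, so that one Taylor bound yields both
   real derivatives and the complex derivative. *)
Lemma cvg_quotient_quadratic (K : numFieldType) (f : K -> K^o) (z l k d : K) :
  0 < d -> 0 <= k ->
  (forall h, `|h| < d -> `|f (h + z) - f z - h * l| <= k * `|h| ^+ 2) ->
  h^-1 *: (f (h + z) - f z) @[h --> 0^'] --> (l : K^o).
Proof.
move=> d0 k0 H; apply/cvgrPdist_le => e e0.
near=> h.
have h0 : h != 0 by near: h; exact: nbhs_dnbhs_neq.
have hd : `|h| < d.
  by near: h; apply: dnbhs0_lt.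
have hk : `|h| * (k + 1) <= e.
  rewrite -ler_pdivlMr ?ltr_wpDl//.
  by near: h; apply: dnbhs0_le; rewrite divr_gt0// ltr_wpDl.
rewrite distrC /GRing.scale/=.
have -> : h^-1 * (f (h + z) - f z) - l = h^-1 * (f (h + z) - f z - h * l).
  by rewrite [RHS]mulrBr mulKf.
rewrite normrM normfV ler_pdivrMl ?normr_gt0//.
apply: (le_trans (H _ hd)); rewrite mulrC expr2 -mulrA ler_wpM2l//.
by apply: le_trans hk; rewrite ler_wpM2l// lerDl.
Unshelve. all: by end_near. Qed.

Lemma is_derive_quadratic (K : numFieldType) (f : K -> K^o) (z l k d : K) :
  0 < d -> 0 <= k ->
  (forall h, `|h| < d -> `|f (h + z) - f z - h * l| <= k * `|h| ^+ 2) ->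
  is_derive z 1 f l.
Proof.
move=> d0 k0 H.
have := cvg_quotient_quadratic d0 k0 H.
have -> : (fun h => h^-1 *: (f (h + z) - f z)) = (fun h => h^-1 *: ((f \o shift z) (h *: 1) - f z)).
  by apply/funext => h; rewrite /= /GRing.scale/= mulr1.
move=> cv; apply: DeriveDef; first by apply/cvg_ex; exists l.
exact/cvg_lim.
Qed.

Section laplace.
Context d (T : measurableType d) (R : realType).
Variables (mu : {measure set T -> \bar R}) (D : set T) (xi : T -> R).
Hypotheses (mD : measurable D) (mxi : measurable_fun D xi).
Hypothesis xi_ge0 : forall x, D x -> 0 <= xi x.
Implicit Types w : T -> R.

(** Absolute convergence of $z\mapsto\int_D we^{-z\xi}d\mu$ on the whole half-plane $\Re z>0$.
   The function $\xi$ is a parameter so that $\mu$ may live on any space. *)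
Definition laplaceable w := forall s, 0 < s ->
  mu.-integrable D (EFin \o (fun x => w x * expR (- (s * xi x)))).

(** [lapC w s y] and [- lapS w s y] are the real and imaginary parts of the transform at $s+iy$. *)
Definition lapC w (s y : R) : R :=
  \int[mu]_(x in D) (w x * (expR (- (s * xi x)) * cos (y * xi x))).

Definition lapS w (s y : R) : R :=
  \int[mu]_(x in D) (w x * (expR (- (s * xi x)) * sin (y * xi x))).

Lemma measurable_expR_xi s : measurable_fun D (fun x => expR (- (s * xi x))).
Proof.
apply: measurableT_comp; first exact: measurable_expR.
by apply: measurableT_comp => //; exact: measurable_funM.
Qed.

Lemma measurable_laplaceable w : laplaceable w -> measurable_fun D w.
Proof.
move=> /(_ _ ltr01)/integrableP[/measurable_EFinP mw _].
have -> : w = fun x => (w x * expR (- (1 * xi x))) * expR (- (- 1 * xi x)).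
  apply/funext => x; rewrite -mulrA -expRD (_ : _ + _ = 0) ?expR0 ?mulr1//.
  ring.
by apply: measurable_funM => //; exact: measurable_expR_xi.
Qed.

Lemma laplaceable_dominated w (s : R) (f : T -> R) : 0 < s -> laplaceable w ->
  measurable_fun D f -> (forall x, D x -> `|f x| <= 1) ->
  mu.-integrable D (EFin \o (fun x => w x * (expR (- (s * xi x)) * f x))).
Proof.
move=> s0 lw mf f1; have := lw _ s0; apply: le_integrable => //.
  apply/measurable_EFinP; apply: measurable_funM; first exact: measurable_laplaceable.
  by apply: measurable_funM => //; exact: measurable_expR_xi.
move=> x Dx; rewrite lee_fin !normrM ler_wpM2l//.
by rewrite ler_piMr// f1.
Qed.

Lemma integrable_lapC w s y : 0 < s -> laplaceable w ->
  mu.-integrable D (EFin \o (fun x => w x * (expR (- (s * xi x)) * cos (y * xi x)))).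
Proof.
move=> s0 lw; apply: laplaceable_dominated => //.
  apply: measurableT_comp; first exact: continuous_measurable_fun (@continuous_cos R).
  exact: measurable_funM.
by move=> x _; rewrite ler_norml cos_geN1 cos_le1.
Qed.

Lemma integrable_lapS w s y : 0 < s -> laplaceable w ->
  mu.-integrable D (EFin \o (fun x => w x * (expR (- (s * xi x)) * sin (y * xi x)))).
Proof.
move=> s0 lw; apply: laplaceable_dominated => //.
  apply: measurableT_comp; first exact: continuous_measurable_fun (@continuous_sin R).
  exact: measurable_funM.
by move=> x _; rewrite ler_norml sin_geN1 sin_le1.
Qed.

(** As $\xi\le\frac2se^{s\xi/2}$, half of the exponential absorbs the factor $\xi$. *)
Lemma laplaceable_xi w : laplaceable w -> laplaceable (fun x => xi x * w x).
Proof.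
move=> lw s s0; have s20 : 0 < s / 2 by rewrite divr_gt0.
pose c := 2 / s; have c0 : 0 < c by rewrite divr_gt0.
have := lw _ s20 => /(@integrableZl _ _ _ mu _ mD c); apply: le_integrable => //.
  apply/measurable_EFinP; apply: measurable_funM; last exact: measurable_expR_xi.
  by apply: measurable_funM => //; exact: measurable_laplaceable.
move=> x Dx; rewrite /= lee_fin.
have -> : - (s * xi x) = - (s / 2 * xi x) + - (s / 2 * xi x) by field.
rewrite expRD (_ : xi x * w x * _ = (xi x * expR (- (s / 2 * xi x))) * (w x * expR (- (s / 2 * xi x)))); last by ring.
rewrite normrM [leRHS]normrM ler_wpM2r// [leRHS]ger0_norm ?(ltW c0)//.
rewrite ger0_norm ?mulr_ge0 ?xi_ge0 ?expR_ge0//.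
rewrite expRN ler_pdivrMr ?expR_gt0//.
have {1}-> : xi x = c * (s / 2 * xi x) by rewrite /c; field; rewrite gt_eqF.
by rewrite ler_wpM2l ?(ltW c0)// (le_trans _ (expR_ge1Dx _))// lerDr.
Qed.

Lemma laplaceable_abs w : laplaceable w -> laplaceable (fun x => `|w x|).
Proof.
move=> lw s s0; have := lw _ s0 => /integrable_norm; congr (integrable _ _ _).
by apply/funext => x /=; rewrite normrM (ger0_norm (expR_ge0 _)).
Qed.

(** Second-order error in the Taylor expansion of $z\mapsto\int w e^{-z\xi}d\mu$. *)
Definition lap_rem w (s : R) : R :=
  3 * \int[mu]_(x in D) (`|xi x * (xi x * w x)| * expR (- (s / 2 * xi x))).

Lemma lap_rem_ge0 w s : 0 <= lap_rem w s.
Proof. by rewrite mulr_ge0// Rintegral_ge0// => x _; rewrite mulr_ge0 ?expR_ge0. Qed.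

Let lap_taylor_pt w (s y p q : R) x : D x -> `|p| <= s / 2 ->
  let Ex := expR (- (s * xi x)) in
  `|w x * (expR (- ((s + p) * xi x)) * cos ((y + q) * xi x)) - w x * (Ex * cos (y * xi x))
    + (p * ((xi x * w x) * (Ex * cos (y * xi x))) + q * ((xi x * w x) * (Ex * sin (y * xi x))))|
  <= 3 * (p ^+ 2 + q ^+ 2) * (`|xi x * (xi x * w x)| * expR (- (s / 2 * xi x)))
  /\
  `|w x * (expR (- ((s + p) * xi x)) * sin ((y + q) * xi x)) - w x * (Ex * sin (y * xi x))
    + (p * ((xi x * w x) * (Ex * sin (y * xi x))) - q * ((xi x * w x) * (Ex * cos (y * xi x))))|
  <= 3 * (p ^+ 2 + q ^+ 2) * (`|xi x * (xi x * w x)| * expR (- (s / 2 * xi x))).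
Proof.
move=> Dx ps Ex.
set X := xi x. have X0 : 0 <= X := xi_ge0 Dx.
pose u := - p * X; pose v := q * X.
pose A := expR u * cos v - 1 - u; pose B := expR u * sin v - v.
have Eu : expR (- ((s + p) * X)) = Ex * expR u.
  by rewrite /Ex -expRD; congr expR; rewrite /u /X; ring.
have AB : `|A| + `|B| <= 3 * (p ^+ 2 + q ^+ 2) * (X * X) * expR `|u|.
  have := cexp_taylor_Re u v; have := cexp_taylor_Im u v; rewrite -/A -/B => hB hA.
  apply: (le_trans (lerD hA hB)); rewrite -mulrDl ler_wpM2r ?expR_ge0//.
  by rewrite /u /v le_eqVlt; apply/orP; left; apply/eqP; ring.
have eE : Ex * expR `|u| <= expR (- (s / 2 * X)).
  rewrite /Ex -expRD ler_expR /u normrM normrN (ger0_norm X0) -mulNr -mulNr -mulrDl.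
  by rewrite ler_wpM2r//; lra.
have key (a b : R) : `|a| <= 1 -> `|b| <= 1 ->
    `|w x * Ex * (A * a + B * b)| <= 3 * (p ^+ 2 + q ^+ 2) * (`|X * (X * w x)| * expR (- (s / 2 * X))).
  move=> a1 b1; rewrite mulrA normrM (normrM (w x)) (ger0_norm (expR_ge0 _)).
  have h1 : `|A * a + B * b| <= `|A| + `|B|.
    by rewrite (le_trans (ler_normD _ _))// lerD// normrM ler_piMr.
  have h2 := le_trans h1 AB.
  apply: (@le_trans _ _ (`|w x| * Ex * (3 * (p ^+ 2 + q ^+ 2) * (X * X) * expR `|u|))).
    by rewrite ler_wpM2l// mulr_ge0// expR_ge0.
  have -> : `|w x| * Ex * (3 * (p ^+ 2 + q ^+ 2) * (X * X) * expR `|u|) =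
     3 * (p ^+ 2 + q ^+ 2) * ((X * X) * `|w x|) * (Ex * expR `|u|) by ring.
  have -> : `|X * X * w x| = X * X * `|w x|.
    by rewrite normrM ger0_norm ?mulr_ge0.
  rewrite [leRHS]mulrA; apply: (ler_wpM2l _ eE).
  by rewrite !mulr_ge0// addr_ge0// sqr_ge0.
have c1 : `|cos (y * X)| <= 1 by rewrite ler_norml cos_geN1 cos_le1.
have s1 : `|sin (y * X)| <= 1 by rewrite ler_norml sin_geN1 sin_le1.
split.
- have := key (cos (y * X)) (- sin (y * X)) c1; rewrite normrN => /(_ s1).
  congr (`|_| <= _); rewrite Eu [(y + q) * X]mulrDl cosD /A /B /u /v; ring.
- have := key (sin (y * X)) (cos (y * X)) s1 c1.
  congr (`|_| <= _); rewrite Eu [(y + q) * X]mulrDl sinD /A /B /u /v; ring.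
Qed.

Let Rintegral_lin_le (f1 f2 f3 f4 g : T -> R) (p q k : R) :
  mu.-integrable D (EFin \o f1) -> mu.-integrable D (EFin \o f2) ->
  mu.-integrable D (EFin \o f3) -> mu.-integrable D (EFin \o f4) ->
  mu.-integrable D (EFin \o g) ->
  (forall x, D x -> `|f1 x - f2 x + (p * f3 x + q * f4 x)| <= k * g x) ->
  `|\int[mu]_(x in D) f1 x - \int[mu]_(x in D) f2 x +
    (p * \int[mu]_(x in D) f3 x + q * \int[mu]_(x in D) f4 x)| <= k * \int[mu]_(x in D) g x.
Proof.
move=> i1 i2 i3 i4 ig H.
have iZ (r : R) (f : T -> R) : mu.-integrable D (EFin \o f) -> mu.-integrable D (EFin \o (fun x => r * f x)).
  by move=> /(@integrableZl _ _ _ mu _ mD r).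
have iD (f f' : T -> R) : mu.-integrable D (EFin \o f) -> mu.-integrable D (EFin \o f') ->
    mu.-integrable D (EFin \o (fun x => f x + f' x)).
  by move=> h h'; apply: (integrableD mD h h').
have iB (f f' : T -> R) : mu.-integrable D (EFin \o f) -> mu.-integrable D (EFin \o f') ->
    mu.-integrable D (EFin \o (fun x => f x - f' x)).
  by move=> h h'; apply: (integrableB mD h h').
rewrite -!RintegralZl// -RintegralB// -RintegralD//; [|exact: iZ|exact: iZ].
rewrite -RintegralD//; [|exact: iB|exact: (iD _ _ (iZ _ _ i3) (iZ _ _ i4))].
have it : mu.-integrable D (EFin \o (fun x => f1 x - f2 x + (p * f3 x + q * f4 x))).
  exact: (iD _ _ (iB _ _ i1 i2) (iD _ _ (iZ _ _ i3) (iZ _ _ i4))).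
apply: (le_trans (le_normr_Rintegral mD it)).
apply: le_Rintegral => //; [exact: integrable_norm|exact: iZ].
Qed.

(** The pointwise remainder is at most $3(p^2+q^2)\xi^2e^{-s\xi/2}$: since $|p|\le s/2$, half of the
   exponential survives the perturbation. *)
Lemma lapC_taylor w (s y p q : R) : 0 < s -> laplaceable w -> `|p| <= s / 2 ->
  `|lapC w (s + p) (y + q) - lapC w s y +
    (p * lapC (fun x => xi x * w x) s y + q * lapS (fun x => xi x * w x) s y)|
  <= lap_rem w s * (p ^+ 2 + q ^+ 2).
Proof.
move=> s0 lw ps.
have sp : 0 < s + p by have := ler_norm (- p); rewrite normrN; lra.
have lx := laplaceable_xi lw; have lxx := laplaceable_xi lx.
have s20 : 0 < s / 2 by rewrite divr_gt0.
rewrite /lap_rem mulrAC.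
apply: Rintegral_lin_le; [exact: integrable_lapC|exact: integrable_lapC|
  exact: integrable_lapC|exact: integrable_lapS|exact: laplaceable_abs lxx _ s20|].
by move=> x Dx; have [] := lap_taylor_pt w y q Dx ps.
Qed.

Lemma lapS_taylor w (s y p q : R) : 0 < s -> laplaceable w -> `|p| <= s / 2 ->
  `|lapS w (s + p) (y + q) - lapS w s y +
    (p * lapS (fun x => xi x * w x) s y - q * lapC (fun x => xi x * w x) s y)|
  <= lap_rem w s * (p ^+ 2 + q ^+ 2).
Proof.
move=> s0 lw ps.
have sp : 0 < s + p by have := ler_norm (- p); rewrite normrN; lra.
have lx := laplaceable_xi lw; have lxx := laplaceable_xi lx.
have s20 : 0 < s / 2 by rewrite divr_gt0.
rewrite /lap_rem mulrAC -mulNr.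
apply: Rintegral_lin_le; [exact: integrable_lapS|exact: integrable_lapS|
  exact: integrable_lapS|exact: integrable_lapC|exact: laplaceable_abs lxx _ s20|].
by move=> x Dx; have [_] := lap_taylor_pt w y q Dx ps; rewrite mulNr.
Qed.

Lemma is_derive_lapC w (s y : R) : 0 < s -> laplaceable w ->
  is_derive y (1:R) (fun y => lapC w s y) (- lapS (fun x => xi x * w x) s y).
Proof.
move=> s0 lw; apply: (@is_derive_quadratic _ _ _ _ (lap_rem w s) 1) => //.
  exact: lap_rem_ge0.
move=> h _; have p0 : `|0 : R| <= s / 2 by rewrite normr0 divr_ge0// ltW.
have := lapC_taylor y h s0 lw p0.
by rewrite addr0 mul0r add0r expr0n/= add0r real_normK ?num_real// mulrN opprK [y + h]addrC.
Qed.

Lemma is_derive_lapS w (s y : R) : 0 < s -> laplaceable w ->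
  is_derive y (1:R) (fun y => lapS w s y) (lapC (fun x => xi x * w x) s y).
Proof.
move=> s0 lw; apply: (@is_derive_quadratic _ _ _ _ (lap_rem w s) 1) => //.
  exact: lap_rem_ge0.
move=> h _; have p0 : `|0 : R| <= s / 2 by rewrite normr0 divr_ge0// ltW.
have := lapS_taylor y h s0 lw p0.
by rewrite addr0 mul0r sub0r expr0n/= add0r real_normK ?num_real// [y + h]addrC.
Qed.

Definition lap w (z : R[i]) : R[i] :=
  lapC w (complex.Re z) (complex.Im z) +i* (- lapS w (complex.Re z) (complex.Im z)).

(** The transform is only known on the open half-plane, so the function that is
   differentiated is allowed to be arbitrary outside. *)
Lemma is_derive_lap w (F : R[i] -> R[i]) (z : R[i]) :
  laplaceable w -> 0 < complex.Re z ->
  (forall z', 0 < complex.Re z' -> F z' = lap w z') ->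
  is_derive (z : R[i]^o) 1 (F : R[i]^o -> R[i]^o) (- lap (fun x => xi x * w x) z).
Proof.
move=> lw z0 FE.
pose dlt := (complex.Re z / 2)%:C.
pose k := (2 * lap_rem w (complex.Re z))%:C.
have dlt0 : 0 < dlt by rewrite ltcR divr_gt0.
have k0 : 0 <= k by rewrite lecR mulr_ge0// lap_rem_ge0.
apply: (@is_derive_quadratic _ (F : R[i] -> R[i]^o) z _ k dlt) => // h.
rewrite normc_def ltcR => hd.
case: z @dlt @k dlt0 k0 z0 hd => s y dlt k dlt0 k0 /= s0.
case: h => p q /= hd.
have hp : `|p| <= s / 2.
  apply/ltW/le_lt_trans/hd.
  by rewrite -sqrtr_sqr ler_sqrt ?addr_ge0 ?sqr_ge0// lerDl sqr_ge0.
have sp : 0 < p + s by have := ler_norm (- p); rewrite normrN; lra.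
have hC := lapC_taylor y q s0 lw hp; have hS := lapS_taylor y q s0 lw hp.
rewrite !FE//= /lap/=.
set A := (X in `|X| <= _) in hC; set B := (X in `|X| <= _) in hS.
have -> : (lapC w (p + s) (q + y) -i* lapS w (p + s) (q + y)) - (lapC w s y -i* lapS w s y) -
    (p +i* q) * - (lapC (fun x : T => xi x * w x) s y -i* lapS (fun x : T => xi x * w x) s y) =
    A +i* (- B).
  by apply/eqP; rewrite eq_complex /= /A /B [p + s]addrC [q + y]addrC; apply/andP; split; apply/eqP; ring.
rewrite normc_def /k /= -rmorphXn sqr_sqrtr ?addr_ge0 ?sqr_ge0// -rmorphM lecR sqrrN.
have AB : Num.sqrt (A ^+ 2 + B ^+ 2) <= `|A| + `|B|.
  rewrite -[leRHS]ger0_norm ?addr_ge0// -sqrtr_sqr ler_sqrt ?sqr_ge0// [leRHS]sqrrD.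
  by rewrite !real_normK ?num_real// addrAC lerDl mulrn_wge0// mulr_ge0.
by apply: (le_trans AB); lra.
Qed.

End laplace.

(** * Abel summation of Fourier integrals *)

Lemma integrable_scale d (T : measurableType d) (R : realType)
    (mu : {measure set T -> \bar R}) (D : set T) (k : R) (f : T -> R) :
  measurable D -> mu.-integrable D (EFin \o f) ->
  mu.-integrable D (EFin \o (fun x => k * f x)).
Proof. by move=> mD; exact: integrableZl. Qed.

Section fubini_bounded.
Context d1 d2 (T1 : measurableType d1) (T2 : measurableType d2) (R : realType).
Variables (m1 : {sigma_finite_measure set T1 -> \bar R})
          (m2 : {sigma_finite_measure set T2 -> \bar R}).
Variables (D1 : set T1) (D2 : set T2) (f : T1 * T2 -> R) (g1 : T1 -> R) (g2 : T2 -> R).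
Hypotheses (mD1 : measurable D1) (mD2 : measurable D2).
Hypothesis mf : measurable_fun setT f.
Hypothesis ig1 : m1.-integrable D1 (EFin \o g1).
Hypothesis ig2 : m2.-integrable D2 (EFin \o g2).
Hypothesis fg : forall x y, D1 x -> D2 y -> `|f (x, y)| <= g1 x * g2 y.

Let F : T1 * T2 -> R := f \_ (D1 `*` D2).

Let mF : measurable_fun setT F.
Proof.
apply/(measurable_restrict _ _ _) => //; first exact: measurableX.
by rewrite setTI; exact: measurable_funS mf.
Qed.

Let FE x y : F (x, y) = if (x \in D1) && (y \in D2) then f (x, y) else 0.
Proof.
rewrite /F patchE; congr (if _ then _ else _).
by apply/idP/andP; rewrite !inE /= => -[].
Qed.

Let int2 x : D1 x -> m2.-integrable D2 (EFin \o (fun y => f (x, y))).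
Proof.
move=> Dx; have := @integrableZl _ _ _ m2 _ mD2 (g1 x) _ ig2.
apply: le_integrable => //.
  apply/measurable_EFinP; apply: measurable_funTS.
  exact: measurableT_comp mf (measurable_pair1 x).
move=> y Dy; rewrite /= lee_fin.
by rewrite (le_trans (fg Dx Dy))// ler_norm.
Qed.

Let int1 y : D2 y -> m1.-integrable D1 (EFin \o (fun x => f (x, y))).
Proof.
move=> Dy; have := @integrableZl _ _ _ m1 _ mD1 (g2 y) _ ig1.
apply: le_integrable => //.
  apply/measurable_EFinP; apply: measurable_funTS.
  exact: measurableT_comp mf (measurable_pair2 y).
move=> x Dx; rewrite /= lee_fin.
by rewrite (le_trans (fg Dx Dy))// mulrC ler_norm.
Qed.

Let iF : (m1 \x m2)%E.-integrable setT (EFin \o F).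
Proof.
apply/integrable12ltyP; first exact/measurable_EFinP.
have g10 : (0 <= \int[m1]_(x in D1) `|(g1 x)%:E|)%E by apply: integral_ge0.
apply: (@le_lt_trans _ _ (\int[m1]_(x in D1) (`|(g1 x)%:E| * \int[m2]_(y in D2) `|(g2 y)%:E|))%E); last first.
  rewrite ge0_integralZr//; last 2 first.
  - by apply: measurableT_comp => //; exact: measurable_int ig1.
  - by apply: integral_ge0.
  apply: lte_mul_pinfty => //; last by case/integrableP : ig2.
  by rewrite ge0_fin_numE//; case/integrableP : ig1.
rewrite [leRHS]integral_mkcond; apply: ge0_le_integral => //.
- by move=> x _; apply: integral_ge0.
- apply: (@measurable_fun_fubini_tonelli_F _ _ _ _ _ m2 (fun z => `|(F z)%:E|%E)) => //.
  by apply: measurableT_comp => //; exact/measurable_EFinP.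
- apply/(measurable_restrict _ _ _) => //; rewrite setTI.
  apply: emeasurable_funM; last exact: measurable_cst.
  by apply: measurableT_comp => //; exact: measurable_int ig1.
- move=> x _; rewrite patchE; case: ifPn => [/set_mem Dx|nDx]; last first.
    rewrite integral0_eq// => y _; rewrite /= FE (negbTE nDx)/=.
    by rewrite normr0.
  rewrite -ge0_integralZl//; last first.
    by apply: measurableT_comp => //; exact: measurable_int ig2.
  rewrite [leRHS]integral_mkcond; apply: ge0_le_integral => //.
  + apply: measurableT_comp => //; apply/measurable_EFinP.
    exact: measurableT_comp mF (measurable_pair1 x).
  + apply/(measurable_restrict _ _ _) => //; rewrite setTI.
    apply: emeasurable_funM; first exact: measurable_cst.
    by apply: measurableT_comp => //; exact: measurable_int ig2.
  + move=> y _; rewrite patchE /= FE mem_set//=; case: ifPn => [/set_mem Dy|_]; last by rewrite normr0.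
    by rewrite lee_fin -normrM (le_trans (fg Dx Dy))// ler_norm.
Qed.

Let I2 x : (\int[m2]_y (F (x, y))%:E)%E = ((fun x => \int[m2]_(y in D2) f (x, y)) \_ D1 x)%:E.
Proof.
rewrite patchE; case: ifPn => [/set_mem Dx|nDx]; last first.
  by rewrite integral0_eq// => y _; rewrite FE (negbTE nDx).
rewrite /Rintegral fineK; last exact: integrable_fin_num (int2 Dx).
rewrite [RHS]integral_mkcond; apply: eq_integral => y _.
by rewrite FE patchE mem_set//=; case: ifP.
Qed.

Let I1 y : (\int[m1]_x (F (x, y))%:E)%E = ((fun y => \int[m1]_(x in D1) f (x, y)) \_ D2 y)%:E.
Proof.
rewrite patchE; case: ifPn => [/set_mem Dy|nDy]; last first.
  by rewrite integral0_eq// => x _; rewrite FE (negbTE nDy) andbF.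
rewrite /Rintegral fineK; last exact: integrable_fin_num (int1 Dy).
rewrite [RHS]integral_mkcond; apply: eq_integral => x _.
by rewrite FE patchE [y \in D2]mem_set//= andbT; case: ifP.
Qed.

Lemma integrable_partial_Rintegral :
  m1.-integrable D1 (EFin \o (fun x => \int[m2]_(y in D2) f (x, y))).
Proof.
apply/(integrable_mkcond _ mD1); have := integrable_fubini_F iF.
by congr (integrable _ _ _); apply/funext => x; rewrite /fubini_F I2 restrict_EFin.
Qed.

(** Domination by a product of integrable functions makes $f$ integrable for the product measure. *)
Lemma Rintegral_exchange :
  \int[m1]_(x in D1) (\int[m2]_(y in D2) f (x, y)) =
  \int[m2]_(y in D2) (\int[m1]_(x in D1) f (x, y)).
Proof.
have := Fubini iF; under eq_integral do rewrite I2.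
under [RHS]eq_integral do rewrite I1.
by move=> E; rewrite Rintegral_mkcond [RHS]Rintegral_mkcond; congr fine.
Qed.

End fubini_bounded.

Section poisson.
Context {R : realType}.
Notation mu := (@lebesgue_measure R).

Lemma cvg_atan_pinfty (u : R^nat) : u @ \oo --> +oo ->
  atan (u n) @[n --> \oo] --> pi / 2.
Proof.
move=> uy; apply/cvgrPdist_le => e e0.
pose e' := Num.min e (pi / 2).
have p2 : 0 < pi / 2 :> R by rewrite divr_gt0// pi_gt0.
have e'0 : 0 < e' by rewrite lt_min e0.
have ee : e' <= e by rewrite ge_min lexx.
have e'p : e' <= pi / 2 by rewrite ge_min lexx orbT.
near=> n.
have h : tan (pi / 2 - e') <= u n by near: n; move/cvgryPge : uy; apply.
have : pi / 2 - e' <= atan (u n).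
  rewrite -[leLHS]tanK; last by rewrite in_itv/=; apply/andP; split; lra.
  by move: h; rewrite le_eqVlt => /predU1P[->//|/lt_atan/ltW].
have := atan_ltpi2 (u n) => h1 h2.
by rewrite ger0_norm; lra.
Unshelve. all: by end_near. Qed.

Lemma cvg_atan_ninfty (u : R^nat) : u @ \oo --> -oo ->
  atan (u n) @[n --> \oo] --> - (pi / 2).
Proof.
move=> uy; have -> : (fun n => atan (u n)) = (fun n => - atan (- u n)).
  by apply/funext => n; rewrite atanN opprK.
by apply: cvgN; apply: cvg_atan_pinfty; exact/cvgNry.
Qed.

Variable nu : {sigma_finite_measure set (measurableTypeR R) -> \bar R}.
Variable w : R -> R.
Hypothesis iw : nu.-integrable setT (EFin \o w).

(** Fourier transform of the signed measure $w\,d\nu$. *)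
Definition fourC (y : R) : R := \int[nu]_x (w x * cos (y * x)).
Definition fourS (y : R) : R := \int[nu]_x (w x * sin (y * x)).

Definition abel_eps (n : nat) : R := (n.+1%:R)^-1 ^+ 2.
Definition abel_del (n : nat) : R := (n.+1%:R)^-1.

Lemma abel_eps_gt0 n : 0 < abel_eps n.
Proof. by rewrite /abel_eps exprn_gt0// invr_gt0 ltr0n. Qed.

Let mw : measurable_fun [set: measurableTypeR R] w.
Proof. by apply/measurable_EFinP; exact: measurable_int iw. Qed.

Let iwb (f : R -> R) : measurable_fun [set: measurableTypeR R] f -> (forall x, `|f x| <= 1) ->
  nu.-integrable setT (EFin \o (fun x => w x * f x)).
Proof.
move=> mf f1; apply: le_integrable iw => //.
  by apply/measurable_EFinP; exact: measurable_funM.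
by move=> x _; rewrite /= lee_fin normrM ler_piMr.
Qed.

Let mcos (c d : R) : measurable_fun [set: measurableTypeR R] (fun x => cos (c * x + d)).
Proof.
apply: measurableT_comp; first exact: continuous_measurable_fun (@continuous_cos R).
by apply: measurable_funD => //; exact: mulrl_measurable.
Qed.

Let msin (c d : R) : measurable_fun [set: measurableTypeR R] (fun x => sin (c * x + d)).
Proof.
apply: measurableT_comp; first exact: continuous_measurable_fun (@continuous_sin R).
by apply: measurable_funD => //; exact: mulrl_measurable.
Qed.

Let normcos (x : R) : `|cos x| <= 1. Proof. by rewrite ler_norml cos_geN1 cos_le1. Qed.
Let normsin (x : R) : `|sin x| <= 1. Proof. by rewrite ler_norml sin_geN1 sin_le1. Qed.

Lemma fourC_add_fourS (x y : R) :
  cos (y * x) * fourC y + sin (y * x) * fourS y = \int[nu]_xi (w xi * cos (y * (x - xi))).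
Proof.
have iC : nu.-integrable setT (EFin \o (fun xi => w xi * cos (y * xi))).
  by apply: iwb => //; have := mcos y 0; under eq_fun do rewrite addr0.
have iS : nu.-integrable setT (EFin \o (fun xi => w xi * sin (y * xi))).
  by apply: iwb => //; have := msin y 0; under eq_fun do rewrite addr0.
rewrite /fourC /fourS -!RintegralZl// -RintegralD//.
- by apply: eq_Rintegral => xi _; rewrite mulrBr cosB; ring.
- exact: (@integrableZl _ _ _ _ _ measurableT (cos (y * x)) _ iC).
- exact: (@integrableZl _ _ _ _ _ measurableT (sin (y * x)) _ iS).
Qed.

(** Abel regularisation of the inverse Fourier integral; the shift [abel_del n]
   is much larger than the width [abel_eps n] of the Poisson kernel, so that an
   interval is counted as half-open in the limit. *)
Definition abel_inverse (n : nat) (x : R) : R :=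
  \int[mu]_(y in `[0, +oo[) (expR (- (abel_eps n * y)) *
    (cos (y * (x + abel_del n)) * fourC y + sin (y * (x + abel_del n)) * fourS y)).

Let f1 n x (z : R * R) := expR (- (abel_eps n * z.1)) * (w z.2 * cos (z.1 * (x + abel_del n - z.2))).

Let mf1 n x : measurable_fun [set: measurableTypeR R * measurableTypeR R] (f1 n x).
Proof.
apply: measurable_funM.
  apply: measurableT_comp; first exact: measurable_expR.
  by apply: measurableT_comp => //; apply: measurable_funM => //; exact: measurable_fst.
apply: measurable_funM; first exact: (measurableT_comp mw measurable_snd).
apply: measurableT_comp; first exact: continuous_measurable_fun (@continuous_cos R).
apply: measurable_funM; first exact: measurable_fst.
by apply: measurable_funB => //; exact: measurable_snd.
Qed.

Let f1E n x y : \int[nu]_xi f1 n x (y, xi) = expR (- (abel_eps n * y)) *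
    (cos (y * (x + abel_del n)) * fourC y + sin (y * (x + abel_del n)) * fourS y).
Proof.
rewrite fourC_add_fourS -RintegralZl//; apply: iwb => //.
have -> : (fun xi => cos (y * (x + abel_del n - xi))) =
          (fun xi => cos (- y * xi + y * (x + abel_del n))).
  by apply/funext => xi; congr cos; ring.
exact: mcos.
Qed.

Let f1le n x y xi : `[0, +oo[%classic y -> setT xi ->
  `|f1 n x (y, xi)| <= expR (- (abel_eps n * y)) * `|w xi|.
Proof.
move=> _ _; rewrite normrM (ger0_norm (expR_ge0 _)) ler_wpM2l ?expR_ge0//.
by rewrite normrM ler_piMr.
Qed.

Lemma integrable_abel_inverse n x : mu.-integrable `[0, +oo[
  (EFin \o (fun y => expR (- (abel_eps n * y)) *
    (cos (y * (x + abel_del n)) * fourC y + sin (y * (x + abel_del n)) * fourS y))).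
Proof.
have := @integrable_partial_Rintegral _ _ _ _ _ mu nu _ _ (f1 n x) _ _ (measurable_itv _)
  measurableT (mf1 n x) (integrable_expRN (abel_eps_gt0 n)) (integrable_norm iw) (f1le n x).
by congr (integrable _ _ _); apply/funext => y; rewrite /= f1E.
Qed.

(** Exchanging the two integrals leaves the transform of a cosine against an
   exponential, which is the Poisson kernel of the half-plane. *)
Lemma abel_inverseE n x : abel_inverse n x =
  \int[nu]_xi (w xi * (abel_eps n / (abel_eps n ^+ 2 + (x - (xi - abel_del n)) ^+ 2))).
Proof.
rewrite /abel_inverse; under eq_Rintegral do rewrite -f1E.
rewrite (@Rintegral_exchange _ _ _ _ _ mu nu _ _ (f1 n x) _ _ (measurable_itv _)
  measurableT (mf1 n x) (integrable_expRN (abel_eps_gt0 n)) (integrable_norm iw) (f1le n x)).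
apply: eq_Rintegral => xi _; rewrite /f1/=.
under eq_Rintegral do rewrite mulrCA [_ * (x + _ - _)]mulrC.
have e0 := abel_eps_gt0 n.
rewrite RintegralZl//.
  by rewrite laplace_cos// opprB addrA.
apply: expR_halfline_integrable => //.
apply: (@continuous_is_derive _ _ (fun y => - (x + abel_del n - xi) * sin ((x + abel_del n - xi) * y))) => y.
by apply: is_derive_eq; rewrite /GRing.scale/=; ring.
Qed.

Let f2 n (z : R * R) := w z.2 * (abel_eps n / (abel_eps n ^+ 2 + (z.1 - (z.2 - abel_del n)) ^+ 2)).

Let den_gt0 n t : 0 < abel_eps n ^+ 2 + t ^+ 2.
Proof. by rewrite ltr_wpDr ?sqr_ge0// exprn_gt0// abel_eps_gt0. Qed.

Let ccauchy n : continuous (fun t : R => abel_eps n / (abel_eps n ^+ 2 + t ^+ 2)).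
Proof.
move=> t; apply: cvgM; first exact: cvg_cst.
apply: cvgV; first by rewrite gt_eqF.
by apply: cvgD; [exact: cvg_cst|rewrite expr2; apply: cvgM; exact: cvg_id].
Qed.

Let mf2 n : measurable_fun [set: measurableTypeR R * measurableTypeR R] (f2 n).
Proof.
apply: measurable_funM; first exact: (measurableT_comp mw measurable_snd).
apply: (measurableT_comp (continuous_measurable_fun (@ccauchy n))).
apply: measurable_funB; first exact: measurable_fst.
by apply: measurable_funB; [exact: measurable_snd|exact: measurable_cst].
Qed.

Let f2le n a b x xi : `[a, b]%classic x -> setT xi ->
  `|f2 n (x, xi)| <= (abel_eps n)^-1 * `|w xi|.
Proof.
move=> _ _; rewrite /f2 normrM mulrC ler_wpM2r//=.
have e0 := abel_eps_gt0 n.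
rewrite ger0_norm ?divr_ge0 ?(ltW e0) ?(ltW (den_gt0 _ _))//.
rewrite ler_pdivrMr ?den_gt0// mulrDr expr2 mulrA mulVf ?gt_eqF// mul1r lerDl.
by rewrite mulr_ge0 ?invr_ge0 ?sqr_ge0// ltW.
Qed.

Lemma integral_abel_inverse n a b : a <= b ->
  mu.-integrable `[a, b] (EFin \o abel_inverse n) /\
  \int[mu]_(x in `[a, b]) abel_inverse n x =
  \int[nu]_xi (w xi * (atan ((b - (xi - abel_del n)) / abel_eps n) -
                       atan ((a - (xi - abel_del n)) / abel_eps n))).
Proof.
move=> ab.
have ic : mu.-integrable `[a, b] (EFin \o (fun=> (abel_eps n)^-1)).
  apply: (@continuous_compact_integrable R); first exact: segment_compact.
  by apply: continuous_subspaceT => x; exact: cvg_cst.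
have E : abel_inverse n = fun x => \int[nu]_xi f2 n (x, xi).
  by apply/funext => x; rewrite abel_inverseE.
rewrite E; split.
  exact: (@integrable_partial_Rintegral _ _ _ _ _ mu nu _ _ (f2 n) _ _ (measurable_itv _)
    measurableT (mf2 n) ic (integrable_norm iw) (@f2le n a b)).
rewrite (@Rintegral_exchange _ _ _ _ _ mu nu _ _ (f2 n) _ _ (measurable_itv _)
    measurableT (mf2 n) ic (integrable_norm iw) (@f2le n a b)).
apply: eq_Rintegral => xi _; rewrite /f2/= RintegralZl//.
  by rewrite [X in _ * X]/Rintegral integral_cauchy_kernel// abel_eps_gt0.
apply: (@continuous_compact_integrable R); first exact: segment_compact.
apply: continuous_subspaceT => x.
have h : {for x, continuous (fun x0 : R => x0 - (xi - abel_del n))}.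
  by apply: cvgB; [exact: cvg_id|exact: cvg_cst].
exact: (continuous_comp h (@ccauchy n _)).
Qed.

Let cvg_shifted_atan (c : R) : atan ((c + abel_del n) / abel_eps n) @[n --> \oo] -->
  (if 0 <= c then pi / 2 else - (pi / 2)).
Proof.
have E n : (c + abel_del n) / abel_eps n = n.+1%:R * (c * n.+1%:R + 1).
  have N0 : (n.+1%:R : R) != 0 by rewrite pnatr_eq0.
  by rewrite /abel_del /abel_eps; move: (n.+1%:R : R) N0 => N N0; field.
have ny : (n.+1%:R : R) @[n --> \oo] --> +oo by have := @cvgr_idn R; rewrite -cvg_shiftS.
under eq_cvg do rewrite E.
case: ifPn => [c0|]; last rewrite -ltNge => c0.
  apply: cvg_atan_pinfty; apply: ger_cvgy ny; apply: nearW => n.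
  by rewrite ler_peMr// lerDr mulr_ge0.
move/cvgryPge : (ny) => /(_ (2 / - c)) nyc.
apply: cvg_atan_ninfty; apply/cvgNry; apply: (ger_cvgy _ ny); near=> n.
change (n.+1%:R <= - (n.+1%:R * (c * n.+1%:R + 1))).
have h : 2 / - c <= n.+1%:R by near: n.
rewrite ler_pdivrMr ?oppr_gt0// in h.
by rewrite -mulrN ler_peMr//; lra.
Unshelve. all: by end_near. Qed.

(** The Poisson kernel integrates to a difference of arctangents, which tends to $\pi$
   on $(a,b]$ and to $0$ elsewhere; at the end points the shift, of larger order than the width,
   decides. *)
Lemma cvg_integral_abel_inverse a b : a <= b ->
  \int[mu]_(x in `[a, b]) abel_inverse n x @[n --> \oo] -->
  pi * \int[nu]_(x in `]a, b]) w x.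
Proof.
move=> ab.
have -> : pi * \int[nu]_(x in `]a, b]) w x = \int[nu]_x (w x * (pi * \1_`]a, b] x)).
  rewrite Rintegral_mkcond -RintegralZl//; last first.
    apply: le_integrable iw => //.
      apply/measurable_EFinP; apply/(measurable_restrict _ _ _) => //.
      by rewrite setTI; exact: measurable_funTS mw.
    by move=> x _; rewrite /= lee_fin patchE; case: ifP => // _; rewrite normr0.
  apply: eq_Rintegral => x _; rewrite patchE indicE mulrCA.
  by case: ifP => _; rewrite ?mulr1 ?mulr0.
under eq_cvg do rewrite (integral_abel_inverse _ ab).2.
have bnd n x : `|atan ((b - (x - abel_del n)) / abel_eps n) - atan ((a - (x - abel_del n)) / abel_eps n)| <= pi.
  have := atan_ltpi2 ((b - (x - abel_del n)) / abel_eps n).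
  have := atan_gtNpi2 ((b - (x - abel_del n)) / abel_eps n).
  have := atan_ltpi2 ((a - (x - abel_del n)) / abel_eps n).
  have := atan_gtNpi2 ((a - (x - abel_del n)) / abel_eps n).
  by rewrite ler_norml => ? ? ? ?; lra.
have mat n (c : R) : measurable_fun [set: measurableTypeR R] (fun x => atan ((c - (x - abel_del n)) / abel_eps n)).
  apply: measurableT_comp; first exact: continuous_measurable_fun (@continuous_atan R).
  apply: measurable_funM => //; apply: measurable_funB => //.
  by apply: measurable_funB.
have ipw : nu.-integrable setT (EFin \o (fun x => pi * `|w x|)).
  exact: (@integrableZl _ _ _ _ _ measurableT pi _ (integrable_norm iw)).
have mi : measurable_fun [set: measurableTypeR R] (fun x => w x * (pi * \1_`]a, b] x)).
  by apply: measurable_funM => //; apply: measurable_funM.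
apply: fine_cvg; rewrite fineK; last first.
  apply: integrable_fin_num => //; apply: le_integrable ipw => //.
    exact/measurable_EFinP.
  move=> x _; rewrite /= lee_fin mulrC !normrM normr_id ler_wpM2r// ler_piMr// indicE.
  by case: (_ \in _); rewrite ?normr1 ?normr0.
apply: (@dominated_cvg _ _ _ nu _ _ _ _ (EFin \o (fun x => pi * `|w x|))) => //=.
- move=> n; apply/measurable_EFinP; apply: measurable_funM => //.
  exact: measurable_funB.
- move=> x _; apply: cvg_EFin; first exact: nearW.
  apply: cvgM; first exact: cvg_cst.
  have E c n : (c - (x - abel_del n)) = (c - x) + abel_del n by ring.
  under eq_cvg do rewrite !E.
  have -> : pi * \1_`]a, b] x = (if 0 <= b - x then pi / 2 else - (pi / 2)) -
       (if 0 <= a - x then pi / 2 else - (pi / 2)) :> R.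
    rewrite indicE mem_setE in_itv/= !subr_ge0; case: (leP x b) => xb.
      by case: (leP x a) => xa /=; field.
    by rewrite andbF leNgt (le_lt_trans ab xb)/=; field.
  by apply: cvgB; exact: cvg_shifted_atan.
- by move=> n x _; rewrite lee_fin normrM mulrC ler_wpM2r.
Qed.

End poisson.

(** * Inversion of the Fourier transform *)
Section fourier_inversion.
Context {R : realType}.
Notation mu := (@lebesgue_measure R).
Variables (nu1 nu2 : {sigma_finite_measure set (measurableTypeR R) -> \bar R}).
Variables (w1 w2 : R -> R).
Hypothesis iw1 : nu1.-integrable setT (EFin \o w1).
Hypothesis iw2 : nu2.-integrable setT (EFin \o w2).
Variable H : R -> R.
Hypothesis iH : mu.-integrable `[0, +oo[ (EFin \o H).

Let Gc y := fourC nu1 w1 y - fourC nu2 w2 y.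
Let Gs y := fourS nu1 w1 y - fourS nu2 w2 y.
Hypothesis mGc : measurable_fun [set: measurableTypeR R] Gc.
Hypothesis mGs : measurable_fun [set: measurableTypeR R] Gs.
Hypothesis GcH : forall y, 0 <= y -> `|Gc y| <= H y.
Hypothesis GsH : forall y, 0 <= y -> `|Gs y| <= H y.

(** For a real measure the inverse transform is an integral over $y\ge0$ only. *)
Definition inverse_fourier x : R :=
  pi^-1 * \int[mu]_(y in `[0, +oo[) (cos (y * x) * Gc y + sin (y * x) * Gs y).

Let i2H : mu.-integrable `[0, +oo[ (EFin \o (fun y => 2 * H y)).
Proof. exact: integrable_scale. Qed.

Let normcos (x : R) : `|cos x| <= 1. Proof. by rewrite ler_norml cos_geN1 cos_le1. Qed.
Let normsin (x : R) : `|sin x| <= 1. Proof. by rewrite ler_norml sin_geN1 sin_le1. Qed.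

Let g x y := cos (y * x) * Gc y + sin (y * x) * Gs y.

Let mg x : measurable_fun [set: measurableTypeR R] (g x).
Proof.
apply: measurable_funD; apply: measurable_funM => //.
  apply: (measurableT_comp (continuous_measurable_fun (@continuous_cos R))).
  exact: mulrr_measurable.
apply: (measurableT_comp (continuous_measurable_fun (@continuous_sin R))).
exact: mulrr_measurable.
Qed.

Let gH x y : 0 <= y -> `|g x y| <= 2 * H y.
Proof.
move=> y0; rewrite (le_trans (ler_normD _ _))// !normrM.
rewrite [leRHS]mulrDl !mul1r lerD//.
  by rewrite (le_trans _ (GcH y0))// ler_piMl.
by rewrite (le_trans _ (GsH y0))// ler_piMl.
Qed.

Let ig x : mu.-integrable `[0, +oo[ (EFin \o g x).
Proof.
apply: le_integrable i2H => //.
  by apply/measurable_EFinP; apply: measurable_funTS; exact: mg.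
move=> y; rewrite /= in_itv/= andbT => y0; rewrite lee_fin.
by rewrite (le_trans (gH _ y0))// ler_norm.
Qed.

Lemma inverse_fourier_bound x :
  `|inverse_fourier x| <= 2 / pi * \int[mu]_(y in `[0, +oo[) H y.
Proof.
have p0 : 0 < pi :> R := pi_gt0 R.
rewrite /inverse_fourier normrM ger0_norm ?invr_ge0 ?(ltW p0)//.
rewrite [2 / pi]mulrC -mulrA ler_wpM2l ?invr_ge0 ?(ltW p0)// -RintegralZl//.
apply: (le_trans (le_normr_Rintegral _ (ig x))) => //.
apply: le_Rintegral => //; first exact: integrable_norm (ig x).
by move=> y; rewrite /= in_itv/= andbT; exact: gH.
Qed.

Lemma continuous_inverse_fourier : continuous inverse_fourier.
Proof.
move=> x; apply: cvgM; first exact: cvg_cst.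
have cg : {ae mu, forall y, `[0%R, +oo[%classic y -> {in `](x - 1), (x + 1)[%classic, continuous (g ^~ y)}}.
  apply: aeW => y _ z _.
  have cm : {for z, continuous (fun x => y * x)}.
    by apply: cvgM; [exact: cvg_cst|exact: cvg_id].
  apply: cvgD; apply: cvgM; try exact: cvg_cst.
    exact: (continuous_comp cm (@continuous_cos R _)).
  exact: (continuous_comp cm (@continuous_sin R _)).
have bg z : `](x - 1), (x + 1)[%classic z ->
    {ae mu, forall y, `[0%R, +oo[%classic y -> `|g z y| <= 2 * H y}.
  by move=> _; apply: aeW => y; rewrite /= in_itv/= andbT; exact: gH.
apply: (@continuity_under_integral R _ _ mu g `[0, +oo[ (measurable_itv _) (x - 1) (x + 1)
  (fun x _ => ig x) cg _ i2H bg).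
by rewrite inE/= in_itv/=; apply/andP; split; lra.
Qed.

Let abel_diff n x : abel_inverse nu1 w1 n x - abel_inverse nu2 w2 n x =
  \int[mu]_(y in `[0, +oo[) (expR (- (abel_eps n * y)) * g (x + abel_del n) y).
Proof.
rewrite -RintegralB//; [|exact: integrable_abel_inverse|exact: integrable_abel_inverse].
by apply: eq_Rintegral => y _; rewrite /g /Gc /Gs; ring.
Qed.

Let abel_diff_le n x y : 0 <= y ->
  `|expR (- (abel_eps n * y)) * g (x + abel_del n) y| <= 2 * H y.
Proof.
move=> y0; rewrite normrM (le_trans _ (gH (x + abel_del n) y0))// ler_piMl//.
by rewrite ger0_norm ?expR_ge0// -expR0 ler_expR oppr_le0 mulr_ge0// ltW// abel_eps_gt0.
Qed.

Let abel_diff_cvg x : abel_inverse nu1 w1 n x - abel_inverse nu2 w2 n x @[n --> \oo] -->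
  pi * inverse_fourier x.
Proof.
rewrite /inverse_fourier mulVKf ?gt_eqF ?pi_gt0//.
under eq_cvg do rewrite abel_diff.
have d0 : abel_del n @[n --> \oo] --> (0 : R) by exact: cvg_harmonic.
have e0 : abel_eps n @[n --> \oo] --> (0 : R).
  by rewrite -[X in _ --> X](mulr0 0) /abel_eps; under eq_cvg do rewrite expr2; exact: cvgM.
apply: fine_cvg; rewrite fineK; last exact: integrable_fin_num (ig x).
apply: (@dominated_cvg _ _ _ mu _ _ _ _ (EFin \o (fun y => 2 * H y))) => //=.
- move=> n; apply/measurable_EFinP; apply: measurable_funTS; apply: measurable_funM => //.
  apply: (measurableT_comp (@measurable_expR R)).
  by apply: measurableT_comp => //; exact: mulrl_measurable.
- move=> y _; apply: cvg_EFin; first exact: nearW.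
  rewrite -[X in _ --> X]mul1r; apply: cvgM.
    rewrite -expR0 -oppr0 -(mul0r y).
    apply: (continuous_cvg _ (@continuous_expR R _)).
    by apply: cvgN; apply: cvgM => //; exact: cvg_cst.
  have xd : y * (x + abel_del n) @[n --> \oo] --> y * x.
    apply: cvgM; first exact: cvg_cst.
    by rewrite -[X in _ --> X]addr0; apply: cvgD => //; exact: cvg_cst.
  apply: cvgD; apply: cvgM; try exact: cvg_cst.
    exact: (continuous_cvg _ (@continuous_cos R _)).
  exact: (continuous_cvg _ (@continuous_sin R _)).
- by move=> n y; rewrite /= in_itv/= andbT => y0; rewrite lee_fin abel_diff_le.
Qed.

(** Neither transform is assumed integrable, only their difference. Each measure is
   regularised on its own, where the integrals can be exchanged; the difference of the
   regularisations converges by domination. *)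
Theorem inverse_fourierE a b : a <= b ->
  \int[nu1]_(x in `]a, b]) w1 x - \int[nu2]_(x in `]a, b]) w2 x =
  \int[mu]_(x in `[a, b]) inverse_fourier x.
Proof.
move=> ab.
have p0 : pi != 0 :> R by rewrite gt_eqF ?pi_gt0.
apply: (mulfI p0); rewrite mulrBr.
have c1 := cvg_integral_abel_inverse iw1 ab.
have c2 := cvg_integral_abel_inverse iw2 ab.
rewrite -(cvg_lim _ (cvgB c1 c2))//.
apply/cvg_lim => //=.
have iab := fun n => (integral_abel_inverse iw1 n ab).1.
have iab' := fun n => (integral_abel_inverse iw2 n ab).1.
have icst (r : R) : mu.-integrable `[a, b] (EFin \o (fun=> r)).
  apply: (@continuous_compact_integrable R); first exact: segment_compact.
  by apply: continuous_subspaceT => x; exact: cvg_cst.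
have iif : mu.-integrable `[a, b] (EFin \o inverse_fourier).
  apply: (@continuous_compact_integrable R); first exact: segment_compact.
  exact: continuous_subspaceT continuous_inverse_fourier.
have -> : (fun n => \int[mu]_(x in `[a, b]) abel_inverse nu1 w1 n x) -
    (fun n => \int[mu]_(x in `[a, b]) abel_inverse nu2 w2 n x) =
    (fun n => \int[mu]_(x in `[a, b]) (abel_inverse nu1 w1 n x - abel_inverse nu2 w2 n x)).
  by apply/funext => n; rewrite RintegralB.
rewrite -RintegralZl//.
set K := 2 * \int[mu]_(y in `[0, +oo[) H y.
apply: fine_cvg; rewrite fineK; last first.
  apply: integrable_fin_num => //.
  exact: integrable_scale iif.
apply: (@dominated_cvg _ _ _ mu _ _ _ _ (EFin \o (fun=> K))) => //=.
- move=> n; apply: (measurable_int mu).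
  exact: (integrableB _ (iab n) (iab' n)).
- by move=> x _; apply: cvg_EFin; [exact: nearW|exact: abel_diff_cvg].
- move=> n x _; rewrite lee_fin abel_diff /K -RintegralZl//.
  have ie : mu.-integrable `[0, +oo[ (EFin \o (fun y => expR (- (abel_eps n * y)) * g (x + abel_del n) y)).
    apply: le_integrable i2H => //.
      apply/measurable_EFinP; apply: measurable_funTS; apply: measurable_funM => //.
      apply: (measurableT_comp (@measurable_expR R)).
      by apply: measurableT_comp => //; exact: mulrl_measurable.
    move=> y; rewrite /= in_itv/= andbT => y0; rewrite lee_fin.
    by rewrite (le_trans (abel_diff_le _ _ y0))// ler_norm.
  apply: (le_trans (le_normr_Rintegral _ ie)) => //.
  apply: le_Rintegral => //; first exact: integrable_norm ie.
  by move=> y; rewrite /= in_itv/= andbT; exact: abel_diff_le.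
Qed.

End fourier_inversion.

(** * Integrals of continuous functions on the half-line *)

Lemma integrable_patch d (T : measurableType d) (R : realType)
    (mu : {measure set T -> \bar R}) (D : set T) (f : T -> R) :
  measurable D -> mu.-integrable D (EFin \o f) ->
  mu.-integrable setT (EFin \o (f \_ D)).
Proof. by move=> mD /(integrable_mkcond _ mD); rewrite restrict_EFin. Qed.

Section halfline.
Context {R : realType}.
Notation mu := (@lebesgue_measure R).

Lemma continuous_powR (p x : R) : 0 < x -> {for x, continuous (fun x => x `^ p)}.
Proof.
move=> x0; apply/differentiable_continuous/derivable1_diffP.
by have [] := is_derive1_powR p x0.
Qed.

Lemma Rintegral_dilation (c : R) (f : R -> R) : 0 < c ->
  measurable_fun [set: measurableTypeR R] f ->
  mu.-integrable `]0, +oo[ (EFin \o f) ->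
  \int[mu]_(x in `]0, +oo[) f (c * x) = c^-1 * \int[mu]_(x in `]0, +oo[) f x.
Proof.
move=> c0 mf intf.
have pre : (fun x => c * x) @^-1` `]0, +oo[ = `]0, +oo[%classic :> set R.
  by apply/seteqP; split=> x; rewrite /= !in_itv/= !andbT pmulr_rgt0.
have E (g : R -> \bar R) : measurable_fun [set: measurableTypeR R] g -> (forall x, (0 <= g x)%E) ->
    (\int[mu]_(x in `]0%R, +oo[) g (c * x)%R = (c^-1)%:E * \int[mu]_(x in `]0%R, +oo[) g x)%E.
  move=> mg g0; have := @ge0_integral_dilation R c `]0, +oo[ g c0 (measurable_itv _).
  rewrite pre; apply => //; exact: measurable_funTS.
have mfE : measurable_fun [set: measurableTypeR R] (EFin \o f) by exact/measurable_EFinP.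
have Ep := E _ (measurable_funepos mfE) (funepos_ge0 _).
have En := E _ (measurable_funeneg mfE) (funeneg_ge0 _).
have ip : (\int[mu]_(x in `]0%R, +oo[) (EFin \o f)^\+ x)%E \is a fin_num.
  by apply: integrable_fin_num => //; exact: integrable_funepos.
have im : (\int[mu]_(x in `]0%R, +oo[) (EFin \o f)^\- x)%E \is a fin_num.
  by apply: integrable_fin_num => //; exact: integrable_funeneg.
rewrite /Rintegral integralE [in RHS]integralE.
transitivity (fine ((c^-1)%:E * (\int[mu]_(x in `]0%R, +oo[) (EFin \o f)^\+ x) -
   (c^-1)%:E * (\int[mu]_(x in `]0%R, +oo[) (EFin \o f)^\- x))%E).
  by rewrite -Ep -En; congr (fine (_ - _)%E); apply: eq_integral => x _; rewrite ?funeposE ?funenegE.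
have aux (A B : \bar R) : A \is a fin_num -> B \is a fin_num ->
    fine ((c^-1)%:E * A - (c^-1)%:E * B)%E = c^-1 * fine (A - B)%E.
  by case: A => // r; case: B => // r' _ _; rewrite /= mulrBr.
exact: aux ip im.
Qed.

Lemma continuous_itv_integrable (p q : R) (f : R -> R) :
  (forall x, p <= x <= q -> {for x, continuous f}) -> mu.-integrable `[p, q] (EFin \o f).
Proof.
move=> cf; apply: continuous_compact_integrable; first exact: segment_compact.
apply: continuous_in_subspaceT => x; rewrite inE/= in_itv/=; exact: cf.
Qed.

Lemma continuous_segment_integrable (h : R -> R) a b : 0 < a ->
  (forall x, 0 < x -> {for x, continuous h}) -> mu.-integrable `[a, b] (EFin \o h).
Proof.
move=> a0 ch; apply: continuous_itv_integrable => x /andP[ax _].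
by apply: ch; exact: lt_le_trans ax.
Qed.

(** A negative value persists on a short interval, whose integral would be negative. *)
Lemma continuous_ge0_from_integrals (h : R -> R) :
  (forall x, 0 < x -> {for x, continuous h}) ->
  (forall a b, 0 < a -> a <= b -> 0 <= \int[mu]_(x in `[a, b]) h x) ->
  forall x, 0 < x -> 0 <= h x.
Proof.
move=> ch h0 x x0; rewrite leNgt; apply/negP => hx.
have : \forall y \near x, h y < h x / 2.
  by move: (ch _ x0) => /cvgr_lt; apply; lra.
move=> /nbhs_ballP[e /= e0 He].
pose dl := Num.min (e / 2) (x / 2).
have d0 : 0 < dl by rewrite lt_min !divr_gt0.
have dx : dl <= x / 2 by rewrite ge_min lexx orbT.
have de : dl <= e / 2 by rewrite ge_min lexx.
have a0 : 0 < x - dl by lra.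
have ab : x - dl <= x + dl by lra.
have := h0 _ _ a0 ab; apply/negP; rewrite -ltNge.
apply: (@le_lt_trans _ _ (\int[mu]_(y in `[x - dl, x + dl]) (cst (h x / 2) y))).
  apply: le_Rintegral => //.
  - exact: continuous_segment_integrable.
  - by apply: continuous_segment_integrable => // y _; exact: cvg_cst.
  - move=> y; rewrite /= in_itv/= => /andP[y1 y2]; apply: ltW; apply: He.
    by rewrite /ball/= ltr_norml; apply/andP; split; lra.
rewrite Rintegral_cst//= lebesgue_measure_itv/= lte_fin.
rewrite ifT; last by lra.
by rewrite /= pmulr_llt0; lra.
Qed.

Lemma continuous_eq_from_integrals (f g : R -> R) :
  (forall x, 0 < x -> {for x, continuous f}) ->
  (forall x, 0 < x -> {for x, continuous g}) ->
  (forall a b, 0 < a -> a <= b ->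
    \int[mu]_(x in `[a, b]) f x = \int[mu]_(x in `[a, b]) g x) ->
  forall x, 0 < x -> f x = g x.
Proof.
move=> cf cg E x x0; apply/eqP; rewrite eq_le; apply/andP; split; rewrite -subr_ge0.
- apply: (@continuous_ge0_from_integrals (fun x => g x - f x)) => //.
    by move=> y y0; apply: cvgB; [exact: cg|exact: cf].
  move=> a b a0 ab; rewrite RintegralB//; [|exact: continuous_segment_integrable|exact: continuous_segment_integrable].
  by rewrite E// subrr.
- apply: (@continuous_ge0_from_integrals (fun x => f x - g x)) => //.
    by move=> y y0; apply: cvgB; [exact: cf|exact: cg].
  move=> a b a0 ab; rewrite RintegralB//; [|exact: continuous_segment_integrable|exact: continuous_segment_integrable].
  by rewrite E// subrr.
Qed.

Lemma integrable_powR_01 (b : R) : 0 < b ->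
  mu.-integrable `]0, 1] (EFin \o (fun x => x `^ (b - 1))).
Proof.
move=> b0; apply/integrableP; split.
  by apply/measurable_EFinP; apply: measurable_funTS; exact: measurable_powR.
under eq_integral do rewrite /= ger0_norm ?powR_ge0//.
pose F (n : nat) : set (measurableTypeR R) := `[(n.+1%:R)^-1, 1]%classic.
have FE : \bigcup_n F n = `]0, 1]%classic.
  apply/seteqP; split=> [x [n _]|x]; rewrite /F /= !in_itv/= => /andP[h1 h2].
    by rewrite h2 andbT (lt_le_trans _ h1)// invr_gt0 ltr0n.
  exists (Num.truncn x^-1) => //; rewrite /= in_itv/= h2 andbT.
  rewrite -[leRHS]invrK lef_pV2 ?posrE ?invr_gt0 ?ltr0n//.
  by rewrite ltW// truncnS_gt.
have := @ge0_nondecreasing_set_cvg_integral _ _ R F (EFin \o (fun x => x `^ (b - 1))) mu.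
rewrite FE => cv.
have le1 n : (n.+1%:R : R)^-1 <= 1 by rewrite invf_le1 ?ltr0n// ler1n.
have bnd n : (\int[mu]_(x in F n) (x `^ (b - 1))%:E <= (b^-1)%:E)%E.
  case: n => [|n].
    rewrite /F invr1 set_itv1 integral_set1 lee_fin invr_ge0 ltW//.
  have n0 : 0 < (n.+2%:R : R)^-1 by rewrite invr_gt0 ltr0n.
  have lt1 : (n.+2%:R : R)^-1 < 1 by rewrite invf_lt1 ?ltr0n// ltr1n.
  have dp (x : R) : 0 < x -> is_derive x (1:R) (fun x => b^-1 * x `^ b) (x `^ (b - 1)).
    move=> x0; have d := is_derive1_powR b x0.
    by apply: is_derive_eq; rewrite /GRing.scale/=; field; rewrite gt_eqF.
  have cF (x : R) : 0 < x -> {for x, continuous (fun x => b^-1 * x `^ b)}.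
    by move=> x0; apply/differentiable_continuous/derivable1_diffP; have [] := dp _ x0.
  rewrite (@continuous_FTC2 _ _ (fun x => b^-1 * x `^ b) _ _ lt1)//.
  - by rewrite -EFinB lee_fin powR1 mulr1 gerBl mulr_ge0 ?powR_ge0// invr_ge0 ltW.
  - apply: continuous_in_subspaceT => x; rewrite inE/= in_itv/= => /andP[h _].
    by apply: continuous_powR; exact: lt_le_trans h.
  - split.
    + by move=> x; rewrite in_itv/= => /andP[h _]; have [] := dp _ (lt_trans n0 h).
    + exact/cvg_at_right_filter/cF.
    + exact/cvg_at_left_filter/cF.
  - move=> x; rewrite in_itv/= => /andP[h _]; rewrite derive1E.
    by have d := dp _ (lt_trans n0 h); rewrite derive_val.
apply: (@le_lt_trans _ _ (b^-1)%:E); last exact: ltry.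
apply: (cvge_to_le (cv _ _ _ _)).
- move=> m n mn; apply/subsetPset => x; rewrite /F /= !in_itv/= => /andP[h ->].
  by rewrite andbT (le_trans _ h)// lef_pV2 ?posrE ?ltr0n// ler_nat.
- by move=> n; exact: measurable_itv.
- move=> n; apply/measurable_EFinP; apply: measurable_funTS; exact: measurable_powR.
- by move=> n x _; rewrite lee_fin powR_ge0.
- exact: nearW.
Qed.

End halfline.

(** * The gamma function *)
Section gamma.
Context {R : realType}.
Notation mu := (@lebesgue_measure R).
Local Notation D := (`]0%R, +oo[%classic : set (measurableTypeR R)).
Implicit Types b s y : R.

Let mD : measurable D. Proof. exact: measurable_itv. Qed.
Let mid : measurable_fun D (@idfun R). Proof. exact: measurable_id. Qed.
Let id_ge0 (x : R) : D x -> 0 <= (@idfun R) x.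
Proof. by rewrite /= in_itv/= andbT => /ltW. Qed.

(** The power whose Laplace transform at $1$ is $\Gamma(b)$. *)
Definition gpow b (x : R) : R := x `^ (b - 1).
Local Notation LC b := (lapC mu D idfun (gpow b)).
Local Notation LS b := (lapS mu D idfun (gpow b)).

Lemma laplaceable_gpow b : 0 < b -> laplaceable mu D idfun (gpow b).
Proof.
move=> b0 s s0.
have l1 : laplaceable mu D idfun (fun=> 1).
  move=> t t0; have := integrable_expRN t0.
  move=> /(@integrableS _ _ _ mu _ D _ (measurable_itv _) mD) h.
  have {}h := h (fun x => _).
  have {}h : mu.-integrable D (EFin \o (fun x : R => expR (- (t * x)))).
    by apply: h => x; rewrite /= !in_itv/= !andbT; exact: ltW.
  by apply: eq_integrable h => // x _; rewrite /= mul1r.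
pose N := (Num.truncn b).+1.
have lN : laplaceable mu D idfun (fun x => x ^+ N).
  rewrite /N; elim: _.+1 => [|k IH].
    have -> : (fun x : R => x ^+ 0) = (fun=> 1) by apply/funext => x; rewrite expr0.
    exact: l1.
  have := laplaceable_xi mD mid id_ge0 IH; congr laplaceable.
  by apply/funext => x; rewrite exprS.
have i01 : mu.-integrable D (EFin \o (gpow b \_ `]0, 1])).
  apply: (@integrableS _ _ _ mu setT) => //.
  by apply: integrable_patch => //; exact: integrable_powR_01.
have mg : measurable_fun D (gpow b).
  by apply: measurable_funTS; exact: measurable_powR.
have := integrableD mD i01 (lN _ s0); apply: le_integrable => //.
  apply/measurable_EFinP; apply: measurable_funM => //.
  exact: (measurable_expR_xi mid).
move=> x; rewrite /= in_itv/= andbT => x0; rewrite lee_fin.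
have e1 : expR (- (s * x)) <= 1 by rewrite -expR0 ler_expR oppr_le0 mulr_ge0// ltW.
rewrite ger0_norm ?mulr_ge0 ?powR_ge0 ?expR_ge0//.
have r0 : 0 <= (gpow b \_ `]0, 1]) x by rewrite patchE; case: ifP => // _; exact: powR_ge0.
have p0 : 0 <= x ^+ N * expR (- (s * x)) by rewrite mulr_ge0 ?expR_ge0// exprn_ge0// ltW.
rewrite ger0_norm ?addr_ge0//.
have [x1|x1] := leP x 1.
  apply: ler_wpDr => //; rewrite patchE mem_set/= ?in_itv/= ?x0//.
  by rewrite ler_piMr// powR_ge0.
apply: ler_wpDl => //; rewrite ler_wpM2r ?expR_ge0// -powR_mulrn ?(ltW x0)//.
apply: ler_powR; first exact: ltW.
by have := truncnS_gt b; rewrite -/N; lra.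
Qed.

Lemma lap_dilation b t s y : 0 < t -> 0 < b -> 0 < s ->
  LC b (t * s) (t * y) = t `^ (- b) * LC b s y /\
  LS b (t * s) (t * y) = t `^ (- b) * LS b s y.
Proof.
move=> t0 b0 s0.
have lg := laplaceable_gpow b0.
have ts0 : 0 < t * s by rewrite mulr_gt0.
have tb : t `^ (b - 1) != 0 by rewrite gt_eqF// powR_gt0.
have tE : t `^ (- b) = (t `^ (b - 1))^-1 * t^-1.
  by rewrite -powRN -(powR_inv1 (ltW t0)) -powRD ?(gt_eqF t0) ?implybT//; congr powR; ring.
have mE (f : R -> R) c : continuous f ->
    measurable_fun [set: measurableTypeR R] (fun x => gpow b x * (expR (- (s * x)) * f (c * x))).
  move=> cf; apply: measurable_funM; first exact: measurable_powR.
  apply: measurable_funM.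
    apply: (measurableT_comp (@measurable_expR R)).
    by apply: measurableT_comp => //; exact: mulrl_measurable.
  apply: (measurableT_comp (continuous_measurable_fun cf)); exact: mulrl_measurable.
split; rewrite tE.
- have := Rintegral_dilation t0 (mE _ y (@continuous_cos R)) (integrable_lapC mD mid y s0 lg).
  rewrite -mulrA => <-; rewrite -[LHS](mulKf tb) -[X in _ = _ * X]/(Rintegral _ _ _); congr (_ * _).
  rewrite -RintegralZl//; last exact: (integrable_lapC mD mid (t * y) ts0 lg).
  apply: eq_Rintegral => x; rewrite inE/= in_itv/= andbT => x0.
  rewrite /gpow powRM ?(ltW x0) ?(ltW t0)// -!mulrA; congr (_ * (_ * (expR _ * cos _))); ring.
- have := Rintegral_dilation t0 (mE _ y (@continuous_sin R)) (integrable_lapS mD mid y s0 lg).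
  rewrite -mulrA => <-; rewrite -[LHS](mulKf tb) -[X in _ = _ * X]/(Rintegral _ _ _); congr (_ * _).
  rewrite -RintegralZl//; last exact: (integrable_lapS mD mid (t * y) ts0 lg).
  apply: eq_Rintegral => x; rewrite inE/= in_itv/= andbT => x0.
  rewrite /gpow powRM ?(ltW x0) ?(ltW t0)// -!mulrA; congr (_ * (_ * (expR _ * sin _))); ring.
Qed.

Lemma lap_xi_gpow b s y :
  lapC mu D idfun (fun x => idfun x * gpow b x) s y = LC (b + 1) s y /\
  lapS mu D idfun (fun x => idfun x * gpow b x) s y = LS (b + 1) s y.
Proof.
have E x : 0 < x -> x * gpow b x = gpow (b + 1) x.
  move=> x0; rewrite /gpow addrK -{1}(powRr1 (ltW x0)) -powRD ?(gt_eqF x0) ?implybT//.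
  by congr powR; ring.
by split; apply: eq_Rintegral => x; rewrite inE/= in_itv/= andbT => x0; rewrite E.
Qed.

Let is_derive_dilation b : is_derive (0 : R) (1 : R) (fun h => expR (- b * ln (1 + h))) (- b).
Proof.
have d1 : is_derive (0 : R) (1 : R) (fun h : R => 1 + h) 1.
  exact: is_derive_eq (is_deriveD (is_derive_cst (1 : R) (0 : R) (1 : R)) (is_derive_id (0 : R) (1 : R))) (add0r _).
have l1 : is_derive (1 + 0 : R) (1 : R) (@ln R) (1 + 0)^-1.
  by apply: is_derive1_ln; rewrite addr0.
have d2 := is_derive1_comp l1 d1.
have d3 : is_derive (0 : R) (1 : R) (fun h : R => ln (1 + h)) 1.
  by apply: (is_derive_eq d2); rewrite addr0 invr1 mulr1.
by apply: is_derive_eq; rewrite /GRing.scale/= addr0 ln1 mulr0 expR0; ring.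
Qed.

(** Euler's identity $zL'(z)=-bL(z)$ for the homogeneous transform of $x^{b-1}$: both sides
   are derivatives at $t=1$ of $L(tz)=t^{-b}L(z)$. *)
Lemma lap_euler b s y : 0 < b -> 0 < s ->
  s * LC (b + 1) s y + y * LS (b + 1) s y = b * LC b s y /\
  s * LS (b + 1) s y - y * LC (b + 1) s y = b * LS b s y.
Proof.
move=> b0 s0; have lg := laplaceable_gpow b0.
have [E1 E2] := lap_xi_gpow b s y.
have dil (h : R) : `|h| < 1 / 2 -> expR (- b * ln (1 + h)) = (1 + h) `^ (- b).
  move=> h1; have h0 : 0 < 1 + h by have := ler_norm (- h); rewrite normrN; lra.
  by rewrite /powR gt_eqF.
have k0 : 0 <= lap_rem mu D idfun (gpow b) s * (s ^+ 2 + y ^+ 2).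
  by rewrite mulr_ge0 ?lap_rem_ge0// addr_ge0// sqr_ge0.
have hs (h : R) : `|h| < 1 / 2 -> `|h * s| <= s / 2.
  by move=> h1; rewrite normrM (ger0_norm (ltW s0)); nra.
have dh := is_derive_dilation b.
have h12 : 0 < 1 / 2 :> R by rewrite divr_gt0.
split.
- have d1 : is_derive (0 : R) (1 : R) (fun h => expR (- b * ln (1 + h)) * LC b s y) (- b * LC b s y).
    by apply: is_derive_eq; rewrite /GRing.scale/=; ring.
  have d2 : is_derive (0 : R) (1 : R) (fun h => expR (- b * ln (1 + h)) * LC b s y)
      (- (s * LC (b + 1) s y + y * LS (b + 1) s y)).
    apply: (@is_derive_quadratic _ _ _ _ (lap_rem mu D idfun (gpow b) s * (s ^+ 2 + y ^+ 2)) (1 / 2)) => //.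
    move=> h h1; rewrite !addr0 ln1 mulr0 expR0 mul1r dil//.
    have h0 : 0 < 1 + h by have := ler_norm (- h); rewrite normrN; lra.
    rewrite -(lap_dilation y h0 b0 s0).1.
    have := lapC_taylor mD mid id_ge0 y (h * y) s0 lg (hs _ h1).
    rewrite E1 E2 real_normK ?num_real// => H; apply: (le_trans _ (le_trans H _)).
      rewrite le_eqVlt; apply/orP; left; apply/eqP; congr (`|_|).
      by rewrite !mulrDl !mul1r; ring.
    by rewrite le_eqVlt; apply/orP; left; apply/eqP; ring.
  have := derive_val (is_derive := d1); rewrite (derive_val (is_derive := d2)).
  by rewrite mulNr => /oppr_inj.
- have d1 : is_derive (0 : R) (1 : R) (fun h => expR (- b * ln (1 + h)) * LS b s y) (- b * LS b s y).
    by apply: is_derive_eq; rewrite /GRing.scale/=; ring.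
  have d2 : is_derive (0 : R) (1 : R) (fun h => expR (- b * ln (1 + h)) * LS b s y)
      (- (s * LS (b + 1) s y - y * LC (b + 1) s y)).
    apply: (@is_derive_quadratic _ _ _ _ (lap_rem mu D idfun (gpow b) s * (s ^+ 2 + y ^+ 2)) (1 / 2)) => //.
    move=> h h1; rewrite !addr0 ln1 mulr0 expR0 mul1r dil//.
    have h0 : 0 < 1 + h by have := ler_norm (- h); rewrite normrN; lra.
    rewrite -(lap_dilation y h0 b0 s0).2.
    have := lapS_taylor mD mid id_ge0 y (h * y) s0 lg (hs _ h1).
    rewrite E1 E2 real_normK ?num_real// => H; apply: (le_trans _ (le_trans H _)).
      rewrite le_eqVlt; apply/orP; left; apply/eqP; congr (`|_|).
      by rewrite !mulrDl !mul1r; ring.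
    by rewrite le_eqVlt; apply/orP; left; apply/eqP; ring.
  have := derive_val (is_derive := d1); rewrite (derive_val (is_derive := d2)).
  by rewrite mulNr => /oppr_inj.
Qed.

Lemma gamma_funE b : gamma_fun b = LC b 1 0.
Proof.
apply: eq_Rintegral => x _; rewrite /gpow /= mul0r cos0 mulr1 mul1r//.
Qed.

Lemma gamma_fun_gt0 b : 0 < b -> 0 < gamma_fun b.
Proof.
move=> b0; have lg := laplaceable_gpow b0.
have ig : mu.-integrable D (EFin \o (fun x => x `^ (b - 1) * expR (- x))).
  apply: eq_integrable (lg _ ltr01) => // x _.
  by rewrite /= mul1r.
pose c := expR (- `|b - 1| - 2).
have cg x : `[1, 2]%classic x -> c <= x `^ (b - 1) * expR (- x).
  rewrite /= in_itv/= => /andP[x1 x2]; have x0 : 0 < x by lra.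
  rewrite /powR gt_eqF// -expRD ler_expR.
  have l0 : 0 <= ln x by apply: ln_ge0.
  have l1 : ln x <= 1.
    rewrite -[leRHS]expRK ler_ln ?posrE ?expR_gt0//.
    by apply: (le_trans x2); have := expR_ge1Dx (1 : R); lra.
  have : - `|b - 1| <= (b - 1) * ln x.
    rewrite lerNl (le_trans (ler_norm _))// normrN normrM (ger0_norm l0) ler_piMr//.
  lra.
apply: (@lt_le_trans _ _ c); first exact: expR_gt0.
rewrite -lee_fin /gamma_fun fineK; last exact: integrable_fin_num.
apply: (@le_trans _ _ (\int[mu]_(x in `[1%R, 2%R]) (c%:E))%E).
  rewrite integral_cst//= lebesgue_measure_itv/= lte_fin ifT ?ltr1n// -EFinB -EFinM lee_fin.
  by rewrite (_ : 2 - 1 = 1) ?mulr1//; ring.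
apply: (@le_trans _ _ (\int[mu]_(x in `[1%R, 2%R]) (x `^ (b - 1) * expR (- x))%:E)%E).
  apply: ge0_le_integral => //.
  - by move=> x _; rewrite lee_fin expR_ge0.
  - apply/measurable_EFinP; apply: measurable_funTS; apply: measurable_funM; first exact: measurable_powR.
    apply: (measurableT_comp (@measurable_expR R)).
    by apply: continuous_measurable_fun; exact: opp_continuous.
apply: ge0_subset_integral => //.
- exact: measurable_int ig.
- by move=> x _; rewrite lee_fin mulr_ge0 ?powR_ge0 ?expR_ge0.
- by move=> x; rewrite /= !in_itv/= andbT => /andP[h _]; exact: lt_le_trans h.
Qed.

Lemma gamma_funD1 b : 0 < b -> gamma_fun (b + 1) = b * gamma_fun b.
Proof.
move=> b0; have [+ _] := lap_euler 0 b0 ltr01.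
by rewrite mul1r mul0r addr0 -!gamma_funE.
Qed.

Lemma sqrD1_gt0 y : 0 < 1 + y ^+ 2. Proof. by rewrite ltr_pwDl ?sqr_ge0. Qed.
#[local] Hint Resolve sqrD1_gt0 : core.

Let is_derive_radius b y : is_derive y (1 : R) (fun y => expR (b / 2 * ln (1 + y ^+ 2)))
  (expR (b / 2 * ln (1 + y ^+ 2)) * (b * y / (1 + y ^+ 2))).
Proof.
have d1 : is_derive y (1 : R) (fun y : R => 1 + y ^+ 2) (2 * y).
  by apply: is_derive_eq; rewrite /GRing.scale/=; ring.
have l1 : is_derive (1 + y ^+ 2) (1 : R) (@ln R) (1 + y ^+ 2)^-1 by exact: is_derive1_ln.
have d2 : is_derive y (1 : R) (fun y : R => ln (1 + y ^+ 2)) ((1 + y ^+ 2)^-1 * (2 * y)).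
  exact: (@is_derive1_comp R (@ln R) (fun y => 1 + y ^+ 2) y _ _ l1 d1).
by apply: is_derive_eq; rewrite /GRing.scale/=; field; rewrite gt_eqF.
Qed.

Lemma is_derive_batan b y : is_derive y (1 : R) (fun y => b * atan y) (b / (1 + y ^+ 2)).
Proof.
have d1 := is_derive1_atan y.
by apply: is_derive_eq; rewrite /GRing.scale/=; ring.
Qed.

Let is_derive_cosbatan b y :
  is_derive y (1 : R) (fun y => cos (b * atan y)) (- sin (b * atan y) * (b / (1 + y ^+ 2))).
Proof. exact: (is_derive1_comp (is_derive_cos _) (is_derive_batan b y)). Qed.

Lemma is_derive_sinbatan b y :
  is_derive y (1 : R) (fun y => sin (b * atan y)) (cos (b * atan y) * (b / (1 + y ^+ 2))).
Proof. exact: (is_derive1_comp (is_derive_sin _) (is_derive_batan b y)). Qed.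

(** Along the line $\Re z=1$ the function $z^bL(z)$ has derivative zero, by Euler's identity. *)
Lemma lap_gpow1 b y : 0 < b ->
  LC b 1 y = gamma_fun b * expR (- (b / 2 * ln (1 + y ^+ 2))) * cos (b * atan y) /\
  LS b 1 y = gamma_fun b * expR (- (b / 2 * ln (1 + y ^+ 2))) * sin (b * atan y).
Proof.
move=> b0; have lg := laplaceable_gpow b0.
have bn0 : b != 0 by rewrite gt_eqF.
pose E (y : R) := expR (b / 2 * ln (1 + y ^+ 2)).
pose P (y : R) := E y * (cos (b * atan y) * LC b 1 y + sin (b * atan y) * LS b 1 y).
pose Q (y : R) := E y * (sin (b * atan y) * LC b 1 y - cos (b * atan y) * LS b 1 y).
have eu x : LC b 1 x = (LC (b + 1) 1 x + x * LS (b + 1) 1 x) / b /\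
            LS b 1 x = (LS (b + 1) 1 x - x * LC (b + 1) 1 x) / b.
  have [h1 h2] := lap_euler x b0 ltr01.
  by move: h1 h2; rewrite !mul1r => -> ->; split; field.
have du x : is_derive x (1 : R) (fun x => LC b 1 x) (- LS (b + 1) 1 x).
  by have := is_derive_lapC mD mid id_ge0 x ltr01 lg; rewrite (lap_xi_gpow b 1 x).2.
have dv x : is_derive x (1 : R) (fun x => LS b 1 x) (LC (b + 1) 1 x).
  by have := is_derive_lapS mD mid id_ge0 x ltr01 lg; rewrite (lap_xi_gpow b 1 x).1.
have dE := is_derive_radius b.
have dc := is_derive_cosbatan b; have ds := is_derive_sinbatan b.
have P0 x : is_derive x (1 : R) P 0.
  have := eu x; have := du x; have := dv x; have := dE x; have := dc x; have := ds x.
  move=> ds' dc' dE' dv' du' [e1 e2].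
  rewrite /P /E; apply: is_derive_eq; rewrite /GRing.scale/= e1 e2; field.
  by rewrite bn0 gt_eqF.
have Q0 x : is_derive x (1 : R) Q 0.
  have := eu x; have := du x; have := dv x; have := dE x; have := dc x; have := ds x.
  move=> ds' dc' dE' dv' du' [e1 e2].
  rewrite /Q /E; apply: is_derive_eq; rewrite /GRing.scale/= e1 e2; field.
  by rewrite bn0 gt_eqF.
have PE : P y = gamma_fun b.
  rewrite (is_derive_0_is_cst y 0 P0) /P /E atan0 mulr0 cos0 sin0 mul0r addr0 mul1r.
  by rewrite expr0n/= addr0 ln1 mulr0 expR0 mul1r gamma_funE.
have QE : Q y = 0.
  rewrite (is_derive_0_is_cst y 0 Q0) /Q /E atan0 mulr0 cos0 sin0 mul0r sub0r mul1r.
  rewrite /lapS (_ : (fun x => _) = (fun=> 0)); last first.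
    by apply/funext => x; rewrite mul0r sin0 !mulr0.
  by rewrite Rintegral_cst// mul0r oppr0 mulr0.
have E0 : E y != 0 by rewrite gt_eqF// expR_gt0.
have cs := cos2Dsin2 (b * atan y).
rewrite expRN -/(E y) -PE; split.
- have -> : LC b 1 y = (cos (b * atan y) ^+ 2 + sin (b * atan y) ^+ 2) * LC b 1 y by rewrite cs mul1r.
  transitivity (P y / E y * cos (b * atan y) + Q y / E y * sin (b * atan y)); last first.
    by rewrite QE !mul0r addr0.
  by rewrite /P /Q; field.
- have -> : LS b 1 y = (cos (b * atan y) ^+ 2 + sin (b * atan y) ^+ 2) * LS b 1 y by rewrite cs mul1r.
  transitivity (P y / E y * sin (b * atan y) - Q y / E y * cos (b * atan y)); last first.
    by rewrite QE !mul0r subr0.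
  by rewrite /P /Q; field.
Qed.

(** Homogeneity carries the value on the line $\Re z=1$ to the ray through that point. *)
Lemma lap_gpowE b (z : R[i]) : 0 < b -> 0 < complex.Re z ->
  lap mu D idfun (gpow b) z = (gamma_fun b)%:C / cpow z b%:C.
Proof.
case: z => s y /= b0 s0.
pose t := y / s.
have yE : y = s * t by rewrite /t; field; rewrite gt_eqF.
have rE : ComplexField.Normc.normc (s +i* y) = s * Num.sqrt (1 + t ^+ 2).
  rewrite /= {1}yE -[in RHS](ger0_norm (ltW s0)) -sqrtr_sqr -sqrtrM ?sqr_ge0//.
  by congr Num.sqrt; ring.
have q0 : 0 < Num.sqrt (1 + t ^+ 2) by rewrite sqrtr_gt0.
have thE : carg (s +i* y) = atan t.
  rewrite /carg rE /=; have -> : s / (s * Num.sqrt (1 + t ^+ 2)) = cos (atan t).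
    by rewrite cos_atan; field; rewrite !gt_eqF.
  have a1 := atan_ltpi2 t; have a2 := atan_gtNpi2 t; have pi0 := pi_gt0 R.
  have y0 : (0 <= y) = (0 <= t) by rewrite /t pmulr_lge0 ?invr_gt0.
  rewrite y0; case: (leP 0 t) => t0.
    have : 0 <= atan t.
      by move: t0; rewrite le_eqVlt => /predU1P[<-|/lt_atan/ltW]; rewrite atan0.
    by move=> a0; rewrite cosK// in_itv/= a0/=; lra.
  have : atan t < 0 by rewrite -(atan0 R) lt_atan.
  by move=> a0; rewrite cosKN ?opprK//; lra.
have lnE : ln (ComplexField.Normc.normc (s +i* y)) = ln s + 2^-1 * ln (1 + t ^+ 2).
  rewrite rE lnM ?posrE// -powR12_sqrt ?ln_powR// ltW//.
have [hC hS] := lap_dilation t s0 b0 ltr01; rewrite mulr1 -yE in hC hS.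
have [uC uS] := lap_gpow1 t b0.
set c := cpow _ _.
have cE : c = (expR (b * (ln s + 2^-1 * ln (1 + t ^+ 2))) * cos (b * atan t)) +i*
   (expR (b * (ln s + 2^-1 * ln (1 + t ^+ 2))) * sin (b * atan t)).
  rewrite /c /cpow /cexp /clog lnE thE /=.
  by congr (_ * _ +i* (_ * _)); [congr expR|congr cos|congr expR|congr sin]; ring.
have prodE : lap mu D idfun (gpow b) (s +i* y) * c = (gamma_fun b)%:C.
  rewrite /lap /= hC hS uC uS cE; apply/eqP; rewrite eq_complex /=.
  have sE : s `^ (- b) = expR (- (b * ln s)) by rewrite /powR gt_eqF// mulNr.
  have eE : s `^ (- b) * expR (- (b / 2 * ln (1 + t ^+ 2))) *
      expR (b * (ln s + 2^-1 * ln (1 + t ^+ 2))) = 1.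
    by rewrite sE -!expRD -expR0; congr expR; field.
  apply/andP; split; apply/eqP.
  - have cs := cos2Dsin2 (b * atan t).
    transitivity (gamma_fun b * (s `^ (- b) * expR (- (b / 2 * ln (1 + t ^+ 2))) *
        expR (b * (ln s + 2^-1 * ln (1 + t ^+ 2)))) * (cos (b * atan t) ^+ 2 + sin (b * atan t) ^+ 2)).
      ring.
    by rewrite eE cs !mulr1.
  - ring.
have c0 : c != 0.
  apply/negP => /eqP c0; move: prodE; rewrite c0 mulr0 => /eqP; rewrite eq_sym.
  by rewrite eq_complex /= gt_eqF ?gamma_fun_gt0.
by rewrite -prodE mulfK.
Qed.

Lemma rgammaE b : 0 < b -> rgamma b = (gamma_fun b)^-1.
Proof.
move=> b0; rewrite /rgamma; set m := _.+1.
have E : \prod_(0 <= i < m) (b + i%:R) * gamma_fun b = gamma_fun (b + m%:R).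
  elim: m => [|m IH]; first by rewrite big_geq// mul1r addr0.
  rewrite big_nat_recr//= mulrAC IH mulrC -gamma_funD1 ?ltr_wpDr//.
  by rewrite -addrA natr1.
have g0 := gamma_fun_gt0 b0.
have gm : 0 < gamma_fun (b + m%:R) by apply: gamma_fun_gt0; rewrite ltr_wpDr.
have p0 : \prod_(0 <= i < m) (b + i%:R) != 0.
  by apply/eqP => p0; move: gm; rewrite -E p0 mul0r ltxx.
by rewrite -E invfM mulrA mulfV ?mul1r.
Qed.

Lemma rgamma0 : rgamma (0 : R) = 0.
Proof. by rewrite /rgamma normr0 truncn0 big_nat1 addr0 mul0r. Qed.

Lemma integrable_powR_tail (a : R) : 0 < a ->
  mu.-integrable `[0, +oo[ (EFin \o (fun y => (1 + y) `^ (- (a + 1)))).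
Proof.
move=> a0.
have dF (y : R) : 0 <= y -> is_derive y (1 : R) (fun y => - a^-1 * (1 + y) `^ (- a)) ((1 + y) `^ (- (a + 1))).
  move=> y0.
  have d1 : is_derive y (1 : R) (fun h : R => 1 + h) 1.
    exact: is_derive_eq (is_deriveD (is_derive_cst (1 : R) y (1 : R)) (is_derive_id y (1 : R))) (add0r _).
  have y1 : 0 < 1 + y by rewrite ltr_pwDl.
  have d2 := @is_derive1_comp R (fun x => x `^ (- a)) (fun h : R => 1 + h) y _ _ (is_derive1_powR (- a) y1) d1.
  have d3 : is_derive y (1 : R) (fun y => (1 + y) `^ (- a)) (- a * (1 + y) `^ (- a - 1) * 1) := d2.
  apply: is_derive_eq; rewrite /GRing.scale/= opprD; field; exact: lt0r_neq0.
have cF (y : R) : 0 <= y -> {for y, continuous (fun y => - a^-1 * (1 + y) `^ (- a))}.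
  by move=> y0; apply/differentiable_continuous/derivable1_diffP; have [] := dF _ y0.
have c1 (y : R) : {for y, continuous (fun y : R => 1 + y)}.
  by apply: cvgD; [exact: cvg_cst|exact: cvg_id].
apply/integrableP; split.
  apply/measurable_EFinP; apply: measurable_funTS.
  apply: (measurableT_comp (measurable_powR _)).
  by apply: measurable_funD.
under eq_integral do rewrite /= ger0_norm ?powR_ge0//.
rewrite (@ge0_continuous_FTC2y _ _ (fun y => - a^-1 * (1 + y) `^ (- a)) 0 0).
- by rewrite -EFinB ltry.
- by move=> x _; exact: powR_ge0.
- apply: continuous_in_subspaceT => x; rewrite inE/= in_itv/= andbT => x0.
  apply: (@continuous_comp _ _ _ (fun y : R => 1 + y) (fun t => t `^ (- (a + 1))) x (c1 x)).
  by apply: continuous_powR; rewrite ltr_pwDl.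
- rewrite -[X in _ --> X](mulr0 (- a^-1)); apply: cvgM; first exact: cvg_cst.
  apply/cvgrPdist_le => e e0; near=> x.
  have x0 : 0 <= x by near: x; exact: nbhs_pinfty_ge.
  have x1 : 0 < 1 + x by rewrite ltr_pwDl.
  have xe : e^-1 `^ (a^-1) <= 1 + x.
    by apply: ler_wpDl => //; near: x; apply: nbhs_pinfty_ge; rewrite num_real.
  rewrite sub0r normrN ger0_norm ?powR_ge0// powRN -[leRHS]invrK.
  rewrite lef_pV2 ?posrE ?invr_gt0 ?powR_gt0//.
  have -> : e^-1 = (e^-1 `^ a^-1) `^ a.
    by rewrite -powRrM mulVf ?gt_eqF// powRr1// invr_ge0 ltW.
  by apply: ge0_ler_powR => //; rewrite ?nnegrE ?powR_ge0// ltW.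
- by move=> x x0; have [] := dF _ (ltW x0).
- exact/cvg_at_right_filter/cF.
- move=> x; rewrite in_itv/= andbT => x0; rewrite derive1E.
  by have d := dF _ (ltW x0); rewrite derive_val.
Unshelve. all: by end_near. Qed.

End gamma.

(** * Euler's reflection formula *)

Section reflection.
Context {R : realType}.
Notation mu := (@lebesgue_measure R).
Local Notation D := (`]0%R, +oo[%classic : set (measurableTypeR R)).
Local Notation LC b := (lapC mu D idfun (gpow b)).
Local Notation LS b := (lapS mu D idfun (gpow b)).
Implicit Types b s y : R.
#[local] Hint Resolve sqrD1_gt0 : core.

Let mD : measurable D. Proof. exact: measurable_itv. Qed.
Let mid : measurable_fun D (@idfun R). Proof. exact: measurable_id. Qed.
Let id_ge0 (x : R) : D x -> 0 <= (@idfun R) x.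
Proof. by rewrite /= in_itv/= andbT => /ltW. Qed.

(** Both sides of $x^ae^{-x}=\pi^{-1}\int_0^\infty\Re(e^{ixy}\,\Gamma(1+a)(1+iy)^{-1-a})\,dy$
   are integrated against $x^{-a}e^{-x}$; the right-hand side then only involves
   $(1-iy)^{a-1}(1+iy)^{-1-a}$, which has an elementary primitive. *)
Theorem gamma_reflection (a : R) : 0 < a < 1 ->
  gamma_fun a * gamma_fun (1 - a) * sin (pi * a) = pi.
Proof.
move=> /andP[a0 a1]; pose b := a + 1; have b0 : 0 < b by rewrite addr_gt0.
pose b' := 1 - a; have b'0 : 0 < b' by rewrite subr_gt0.
have lb := laplaceable_gpow b0; have lb' := laplaceable_gpow b'0.
have gb := gamma_fun_gt0 b0.
pose wc (x : R) := gpow b x * expR (- x).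
pose w := wc \_ D.
have iD : mu.-integrable D (EFin \o wc).
  by apply: eq_integrable (lb _ ltr01) => // x _; rewrite /= mul1r.
have iw : mu.-integrable setT (EFin \o w).
  exact: integrable_patch.
have i0 : mu.-integrable setT (EFin \o (fun=> 0 : R)) by exact: integrable0.
have fC y : fourC mu w y - fourC mu (fun=> 0) y = LC b 1 y.
  rewrite /fourC [X in _ - X](_ : _ = 0) ?subr0; last first.
    by under eq_Rintegral do rewrite mul0r; rewrite Rintegral_cst// mul0r.
  rewrite [RHS]Rintegral_mkcond; apply: eq_Rintegral => x _; rewrite /w !patchE.
  by case: ifP => _; rewrite ?mul0r// /wc mul1r mulrA.
have fS y : fourS mu w y - fourS mu (fun=> 0) y = LS b 1 y.
  rewrite /fourS [X in _ - X](_ : _ = 0) ?subr0; last first.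
    by under eq_Rintegral do rewrite mul0r; rewrite Rintegral_cst// mul0r.
  rewrite [RHS]Rintegral_mkcond; apply: eq_Rintegral => x _; rewrite /w !patchE.
  by case: ifP => _; rewrite ?mul0r// /wc mul1r mulrA.
(* An integrable majorant of gamma_fun b * |1 + i y| ^ (- b), from (1 + y)^2 <= 2 (1 + y^2). *)
pose H (y : R) := gamma_fun b * expR (b / 2 * ln 2) * (1 + y) `^ (- b).
have iH : mu.-integrable `[0, +oo[ (EFin \o H).
  by apply: integrable_scale => //; exact: integrable_powR_tail.
have rH y : 0 <= y -> gamma_fun b * expR (- (b / 2 * ln (1 + y ^+ 2))) <= H y.
  move=> y0; rewrite /H -[leRHS]mulrA ler_wpM2l ?(ltW gb)//.
  have y1 : 0 < 1 + y by rewrite ltr_pwDl.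
  rewrite /powR gt_eqF// -expRD ler_expR.
  have : ln (1 + y) * 2 <= ln 2 + ln (1 + y ^+ 2).
    rewrite -lnM ?posrE ?sqrD1_gt0// mulr_natr -lnXn// ler_ln ?posrE ?exprn_gt0 ?mulr_gt0 ?sqrD1_gt0//.
    by have := sqr_ge0 (1 - y); rewrite !expr2; lra.
  nra.
have GcH y : 0 <= y -> `|fourC mu w y - fourC mu (fun=> 0) y| <= H y.
  move=> y0; rewrite fC (lap_gpow1 y b0).1; apply: le_trans (rH _ y0).
  rewrite normrM ger0_norm ?mulr_ge0 ?expR_ge0 ?(ltW gb)//.
  by rewrite ler_piMr ?mulr_ge0 ?expR_ge0 ?(ltW gb)// ler_norml cos_geN1 cos_le1.
have GsH y : 0 <= y -> `|fourS mu w y - fourS mu (fun=> 0) y| <= H y.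
  move=> y0; rewrite fS (lap_gpow1 y b0).2; apply: le_trans (rH _ y0).
  rewrite normrM ger0_norm ?mulr_ge0 ?expR_ge0 ?(ltW gb)//.
  by rewrite ler_piMr ?mulr_ge0 ?expR_ge0 ?(ltW gb)// ler_norml sin_geN1 sin_le1.
have cLC c : 0 < c -> continuous (fun y => LC c 1 y).
  move=> c0.
  exact: (continuous_is_derive (fun y => is_derive_lapC mD mid id_ge0 y ltr01 (laplaceable_gpow c0))).
have cLS c : 0 < c -> continuous (fun y => LS c 1 y).
  move=> c0.
  exact: (continuous_is_derive (fun y => is_derive_lapS mD mid id_ge0 y ltr01 (laplaceable_gpow c0))).
have mGc : measurable_fun [set: measurableTypeR R] (fun y => fourC mu w y - fourC mu (fun=> 0) y).
  under eq_fun do rewrite fC; exact: continuous_measurable_fun (cLC _ b0).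
have mGs : measurable_fun [set: measurableTypeR R] (fun y => fourS mu w y - fourS mu (fun=> 0) y).
  under eq_fun do rewrite fS; exact: continuous_measurable_fun (cLS _ b0).
have inv := @inverse_fourierE R mu mu w (fun=> 0) iw i0 H iH mGc mGs GcH GsH.
have cinv := continuous_inverse_fourier iH mGc mGs GcH GsH.
have vE x : 0 < x -> wc x = inverse_fourier mu mu w (fun=> 0) x.
  apply: (continuous_eq_from_integrals (f := wc)).
  - move=> y y0; apply: cvgM; first exact: continuous_powR.
    by apply: (@continuous_comp _ _ _ (fun x : R => - x)); [apply: cvgN; exact: cvg_id|exact: continuous_expR].
  - by move=> y _; exact: cinv.
  - move=> p q p0 pq; rewrite -inv// [X in _ - X](_ : _ = 0) ?subr0; last first.
      by rewrite Rintegral_cst// mul0r.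
    rewrite -Rintegral_itv_obnd_cbnd; last first.
      apply: integrableS iD => // t; rewrite /= !in_itv/= andbT => /andP[h _].
      exact: lt_trans h.
    apply: eq_Rintegral => t; rewrite inE/= in_itv/= => /andP[h _].
    by rewrite /w patchE mem_set//= in_itv/= andbT (lt_trans p0).
pose g1 x := gpow b' x * expR (- x).
have ig1 : mu.-integrable D (EFin \o g1).
  by apply: eq_integrable (lb' _ ltr01) => // x _; rewrite /= mul1r.
pose f (z : R * R) := g1 z.1 * (cos (z.2 * z.1) * LC b 1 z.2 + sin (z.2 * z.1) * LS b 1 z.2).
have mf : measurable_fun [set: measurableTypeR R * measurableTypeR R] f.
  have m21 : measurable_fun [set: measurableTypeR R * measurableTypeR R] (fun z => z.2 * z.1).
    by apply: measurable_funM; [exact: measurable_snd|exact: measurable_fst].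
  apply: measurable_funM.
    apply: (measurableT_comp _ measurable_fst); apply: measurable_funM; first exact: measurable_powR.
    apply: (measurableT_comp (@measurable_expR R)).
    by apply: continuous_measurable_fun; exact: opp_continuous.
  apply: measurable_funD; apply: measurable_funM.
  - exact: (measurableT_comp (continuous_measurable_fun (@continuous_cos R))).
  - exact: (measurableT_comp (continuous_measurable_fun (cLC _ b0)) measurable_snd).
  - exact: (measurableT_comp (continuous_measurable_fun (@continuous_sin R))).
  - exact: (measurableT_comp (continuous_measurable_fun (cLS _ b0)) measurable_snd).
have fle (x y : measurableTypeR R) : D x -> (`[0%R, +oo[%classic : set (measurableTypeR R)) y ->
    `|f (x, y)| <= g1 x * (2 * H y).
  rewrite /= !in_itv/= !andbT => x0 y0; rewrite /f/= normrM ger0_norm; last first.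
    by rewrite mulr_ge0 ?powR_ge0 ?expR_ge0.
  rewrite ler_wpM2l ?mulr_ge0 ?powR_ge0 ?expR_ge0// (le_trans (ler_normD _ _))//.
  rewrite [leRHS]mulrDl !mul1r !normrM lerD//.
    rewrite (le_trans _ (GcH _ y0))// fC ler_piMl//.
    by rewrite ler_norml cos_geN1 cos_le1.
  rewrite (le_trans _ (GsH _ y0))// fS ler_piMl//.
  by rewrite ler_norml sin_geN1 sin_le1.
have i2H : mu.-integrable `[0, +oo[ (EFin \o (fun y => 2 * H y)).
  by apply: integrable_scale => //; exact: measurable_itv.
have E2 x : 0 < x -> g1 x * wc x = expR (- (2 * x)).
  move=> x0; have xn0 : (b' - 1 + (b - 1) == 0) ==> (x != 0) by rewrite gt_eqF// implybT.
  have e0 : b' - 1 + (b - 1) = 0 by rewrite /b /b'; ring.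
  have e2 : - x + - x = - (2 * x) by ring.
  by rewrite /g1 /wc /gpow mulrACA -(powRD xn0) -expRD e0 powRr0 mul1r e2.
have i2 : mu.-integrable D (EFin \o (fun x : R => expR (- (2 * x)))).
  apply: (@integrableS _ _ _ mu `[0, +oo[) => //; last exact: integrable_expRN.
  by move=> x; rewrite /= !in_itv/= !andbT => /ltW.
have half : \int[mu]_(x in D) expR (- (2 * x)) = 1 / 2.
  have <- : \int[mu]_(x in `[0, +oo[) (expR (- (2 * x)) * cos (0 * x)) = 1 / 2.
    by rewrite laplace_cos// expr0n/= addr0; field.
  rewrite Rintegral_itv_obnd_cbnd//.
  by apply: eq_Rintegral => x _; rewrite mul0r cos0 mulr1.
have pin0 : pi != 0 :> R by rewrite gt_eqF ?pi_gt0.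
pose g3 x y := cos (y * x) * (fourC mu w y - fourC mu (fun=> 0) y) +
                     sin (y * x) * (fourS mu w y - fourS mu (fun=> 0) y).
have i3 x : mu.-integrable `[0, +oo[ (EFin \o g3 x).
  apply: le_integrable i2H.
  - exact: measurable_itv.
  - apply/measurable_EFinP; apply: measurable_funTS; apply: measurable_funD.
      apply: measurable_funM; last exact: mGc.
      apply: (measurableT_comp (continuous_measurable_fun (@continuous_cos R))).
      exact: mulrr_measurable.
    apply: measurable_funM; last exact: mGs.
    apply: (measurableT_comp (continuous_measurable_fun (@continuous_sin R))).
    exact: mulrr_measurable.
  - move=> y; rewrite /= in_itv/= andbT => y0; rewrite lee_fin.
    apply: (le_trans (ler_normD _ _)); apply: le_trans (ler_norm _).
    rewrite [leRHS]mulrDl !mul1r !normrM; apply: lerD.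
      apply: (le_trans _ (GcH _ y0)); apply: ler_piMl => //.
      by rewrite ler_norml cos_geN1 cos_le1.
    apply: (le_trans _ (GsH _ y0)); apply: ler_piMl => //.
    by rewrite ler_norml sin_geN1 sin_le1.
have inner_y x : 0 < x -> \int[mu]_(y in `[0, +oo[) f (x, y) = pi * expR (- (2 * x)).
  move=> x0; rewrite -(E2 _ x0) (vE _ x0) /inverse_fourier mulrCA (mulVKf pin0).
  transitivity (\int[mu]_(y in `[0, +oo[) (g1 x * g3 x y)).
    by apply: eq_Rintegral => y _; rewrite /f /g3 fC fS.
  by rewrite (RintegralZl _ _ (i3 x)); last exact: measurable_itv.
have lhs : \int[mu]_(x in D) (\int[mu]_(y in `[0, +oo[) f (x, y)) = pi / 2.
  transitivity (\int[mu]_(x in D) (pi * expR (- (2 * x)))).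
    by apply: eq_Rintegral => x; rewrite inE/= in_itv/= andbT; exact: inner_y.
  by rewrite RintegralZl ?half ?mul1r//; exact: mD.
(* The moduli of the two transforms multiply to (1 + y^2)^-1 and their arguments subtract. *)
pose G (y : R) := cos (2 * a * atan y) / (1 + y ^+ 2).
have inner y : \int[mu]_(x in D) f (x, y) = gamma_fun b * gamma_fun b' * G y.
  have iC := integrable_lapC mD mid y ltr01 lb'; have iS := integrable_lapS mD mid y ltr01 lb'.
  transitivity (LC b' 1 y * LC b 1 y + LS b' 1 y * LS b 1 y).
    rewrite -!RintegralZr// -RintegralD//.
    - by apply: eq_Rintegral => x _; rewrite /f /g1 /= mul1r; ring.
    - by have := integrable_scale (LC b 1 y) mD iC; apply: eq_integrable => // x _; rewrite /= mulrC.
    - by have := integrable_scale (LS b 1 y) mD iS; apply: eq_integrable => // x _; rewrite /= mulrC.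
  have [-> ->] := lap_gpow1 y b0; have [-> ->] := lap_gpow1 y b'0.
  have eE : expR (- (b / 2 * ln (1 + y ^+ 2))) * expR (- (b' / 2 * ln (1 + y ^+ 2))) = (1 + y ^+ 2)^-1.
    rewrite -expRD -[RHS]lnK ?posrE ?invr_gt0 ?sqrD1_gt0// lnV ?posrE ?sqrD1_gt0//.
    by congr expR; rewrite /b /b'; field.
  rewrite /G (_ : 2 * a * atan y = b * atan y - b' * atan y); last by rewrite /b /b'; ring.
  rewrite cosB -eE; ring.
have iG : mu.-integrable `[0, +oo[ (EFin \o G).
  have i4 : mu.-integrable `[0, +oo[ (EFin \o (fun y => 2 * (1 + y) `^ (- (1 + 1)))).
    by apply: integrable_scale; [exact: measurable_itv|exact: integrable_powR_tail].
  move: i4.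
  have cG : continuous G.
    move=> y; apply: cvgM.
      apply: (@continuous_comp _ _ _ (fun y => 2 * a * atan y) cos); last exact: continuous_cos.
      by apply: cvgM; [exact: cvg_cst|exact: continuous_atan].
    apply: cvgV; first by rewrite (gt_eqF (sqrD1_gt0 y)).
    by apply: cvgD; [exact: cvg_cst|rewrite expr2; apply: cvgM; exact: cvg_id].
  apply: le_integrable; [exact: measurable_itv| | ].
    by apply/measurable_EFinP; apply: measurable_funTS; exact: continuous_measurable_fun.
  move=> y; rewrite /= in_itv/= andbT => y0; rewrite lee_fin.
  apply: le_trans (ler_norm _).
  have y1 : 0 < 1 + y by rewrite ltr_pwDl.
  rewrite powRN (_ : 1 + 1 = 2%:R)// powR_mulrn ?(ltW y1)// /G normrM.
  have v0 : 0 < (1 + y ^+ 2)^-1 by rewrite invr_gt0 sqrD1_gt0.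
  rewrite (ger0_norm (ltW v0)).
  apply: (@le_trans _ _ (1 + y ^+ 2)^-1).
    by rewrite ler_piMl ?invr_ge0 ?(ltW (sqrD1_gt0 y))// ler_norml cos_geN1 cos_le1.
  rewrite ler_pdivlMr ?exprn_gt0// ler_pdivrMl ?sqrD1_gt0//.
  by have := sqr_ge0 (1 - y); rewrite !expr2; lra.
have intG : \int[mu]_(y in `[0, +oo[) G y = sin (pi * a) / (2 * a).
  pose F (y : R) := sin (2 * a * atan y) / (2 * a).
  have dF (y : R) : is_derive y (1 : R) F (G y).
    have d := is_derive_sinbatan (2 * a) y.
    apply: is_derive_eq; rewrite /GRing.scale/= /G; field.
    by rewrite (gt_eqF (sqrD1_gt0 y)) gt_eqF.
  rewrite -[RHS]subr0.
  rewrite [X in _ = _ - X](_ : _ = F 0); last by rewrite /F atan0 mulr0 sin0 mul0r.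
  apply: (Rintegral_halfline_FTC dF) => //.
    move=> y; apply: cvgM.
      apply: (@continuous_comp _ _ _ (fun y => 2 * a * atan y) cos); last exact: continuous_cos.
      by apply: cvgM; [exact: cvg_cst|exact: continuous_atan].
    apply: cvgV; first by rewrite (gt_eqF (sqrD1_gt0 y)).
    by apply: cvgD; [exact: cvg_cst|rewrite expr2; apply: cvgM; exact: cvg_id].
  apply: cvgM; last exact: cvg_cst.
  rewrite (_ : pi * a = 2 * a * (pi / 2)); last by field.
  apply: (continuous_cvg _ (@continuous_sin R _)).
  by apply: cvgM; [exact: cvg_cst|apply: cvg_atan_pinfty; exact: cvgr_idn].
have an0 : a != 0 by rewrite gt_eqF.
have rhsE : \int[mu]_(y in `[0, +oo[) (gamma_fun b * gamma_fun b' * G y) = gamma_fun b * gamma_fun b' * (sin (pi * a) / (2 * a)).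
  by rewrite (RintegralZl _ _ iG) ?intG//; exact: measurable_itv.
move: (@Rintegral_exchange _ _ _ _ _ mu mu D `[0, +oo[ f g1 (fun y => 2 * H y) mD (measurable_itv _) mf ig1 i2H fle).
rewrite lhs; under eq_Rintegral => y _ do rewrite inner.
rewrite rhsE /b (gamma_funD1 a0) -/b' => E.
apply: (@mulIf _ 2^-1); first by rewrite invr_eq0.
by rewrite E /b'; field.
Qed.

End reflection.

(** * The potential measure as an occupation measure *)

Section occupation.
Context d (T : measurableType d) (R : realType) (P : probability T R).
Notation mu := (@lebesgue_measure R).
Variables (Y : R -> T -> R) (zeta : T -> \bar R).
Hypothesis mY : forall t, 0 <= t -> measurable_fun setT (Y t).
Hypothesis rcY : forall w t, 0 <= t -> Y u w @[u --> t^'+] --> Y t w.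
Hypothesis Y0 : forall w, Y 0 w = 0.
Hypothesis ndY : forall w t t', 0 <= t -> t <= t' -> Y t w <= Y t' w.
Hypothesis mzeta : measurable_fun setT zeta.

Lemma path_ge0 t w : 0 <= t -> 0 <= Y t w.
Proof. by move=> t0; rewrite -(Y0 w); exact: ndY. Qed.

(** Right continuity and monotonicity: $Y_t$ is the infimum of the path over rational times after $t$.
   This makes the path measurable in time and randomness jointly. *)
Lemma path_ge_rat w t x : 0 <= t ->
  x <= Y t w <-> forall r : rat, t < ratr r -> x <= Y (ratr r) w.
Proof.
move=> t0; split=> [xY r tr|xr]; first by apply: (le_trans xY); exact/ndY/ltW.
apply: (cvgr_to_ge (@rcY w t t0)); near=> u.
have tu : t < u by near: u; exact: nbhs_right_gt.
have [q] := rat_in_itvoo tu; rewrite in_itv/= => /andP[tq qu].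
apply: (le_trans (xr _ tq)); apply: ndY; last exact: ltW.
exact: le_trans (ltW tq).
Unshelve. all: by end_near. Qed.

(** Negative times are sent to $0$: the hypotheses on the path only concern $t\ge0$, and
   measurability is needed on the whole line. *)
Definition joint_path (p : measurableTypeR R * T) : measurableTypeR R := Y (Num.max p.1 0) p.2.

Definition alive_at t : set T := [set w | (t%:E < zeta w)%E].

Definition alive : set (measurableTypeR R * T) :=
  [set p | 0 <= p.1 /\ alive_at p.1 p.2].

Lemma measurable_joint_path : measurable_fun [set: measurableTypeR R * T] joint_path.
Proof.
apply: (measurability (@RGenCInfty.G R)) => [|/= _ [_] [x] -> <-].
  exact: RGenCInfty.measurableE.
rewrite setTI [X in measurable X](_ : _ = ~` \bigcup_(r : rat)
    ((@fst (measurableTypeR R) T @^-1` [set t | Num.max t 0 < ratr r]) `&`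
     (@snd (measurableTypeR R) T @^-1` [set w | Y (ratr r) w < x]))); last first.
  apply/seteqP; split=> [[t w]|[t w]] /=.
    rewrite in_itv/= andbT /joint_path/= path_ge_rat ?le_max ?lexx ?orbT// => H [r _ /=[tr]].
    by rewrite ltNge H.
  move=> H; rewrite in_itv/= andbT /joint_path/= path_ge_rat ?le_max ?lexx ?orbT// => r tr.
  by rewrite leNgt; apply/negP => xr; apply: H; exists r.
apply: measurableC; apply: bigcupT_measurable_rat => r.
have [r0|r0] := leP (ratr r : R) 0.
  rewrite [X in measurable X](_ : _ = set0)//; apply/seteqP; split=> [[t w]|[t w]]//= [].
  by rewrite gt_max [X in _ && X]ltNge r0 andbF.
apply: measurableI.
  rewrite [X in measurable X](_ : _ = @fst (measurableTypeR R) T @^-1` `]-oo, ratr r[%classic).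
    by apply: (measurable_preimage measurable_fst); exact: measurable_itv.
  by apply/seteqP; split=> [[t w]|[t w]] /=; rewrite in_itv/= gt_max r0 andbT.
apply: (measurable_preimage measurable_snd).
rewrite (_ : [set w | _] = Y (ratr r) @^-1` `]-oo, x[%classic).
  by apply: measurable_preimage; [exact/mY/ltW|exact: measurable_itv].
by apply/seteqP; split=> w /=; rewrite in_itv.
Qed.

Lemma measurable_alive_at t : measurable (alive_at t).
Proof.
rewrite -[X in measurable X]setTI; apply: measurable_lte => //.
Qed.

Lemma measurable_alive : measurable alive.
Proof.
rewrite (_ : alive = (@fst (measurableTypeR R) T @^-1` `[0, +oo[%classic) `&`
   ([set: measurableTypeR R * T] `&` [set p | ((EFin \o fst) p < (zeta \o snd) p)%E])); last first.
  by apply/seteqP; split=> [[t w]|[t w]] /=; rewrite /alive/= in_itv/= andbT; [move=> []|move=> [? []]].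
apply: measurableI.
  by apply: (measurable_preimage measurable_fst); exact: measurable_itv.
apply: measurable_lte => //.
  by apply/measurable_EFinP; exact: measurable_fst.
exact: (measurableT_comp mzeta measurable_snd).
Qed.

Let g (p : measurableTypeR R * T) : R := \1_alive p.

Let mg : measurable_fun setT g.
Proof. by apply: measurable_indic; exact: measurable_alive. Qed.

Let g0 p : 0 <= g p.
Proof. by rewrite /g indicE. Qed.

(** The image of $dt\otimes P$, restricted to the times before the killing, under the path. It agrees with
   the potential measure ([potential_measureE]) and is defined on all Borel sets of the line. *)
Definition occupation : {measure set (measurableTypeR R) -> \bar R} :=
  weighted_law (mu \x P)%E mg g0 measurable_joint_path.

Section occupation_integral.
Variable f : measurableTypeR R -> \bar R.
Hypothesis mf : measurable_fun [set: measurableTypeR R] f.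
Hypothesis f0 : forall x, (0 <= f x)%E.

Let mfg : measurable_fun [set: measurableTypeR R * T] (fun p => f (joint_path p) * (g p)%:E)%E.
Proof.
apply: emeasurable_funM; last by apply/measurable_EFinP; exact: mg.
exact: (measurableT_comp mf measurable_joint_path).
Qed.

Let fg0 p : (0 <= f (joint_path p) * (g p)%:E)%E.
Proof. by apply: mule_ge0 => //; rewrite lee_fin. Qed.

Let fgE t w : 0 <= t -> (f (joint_path (t, w)) * (g (t, w))%:E)%E =
  ((fun w => f (Y t w)) \_ (alive_at t)) w.
Proof.
move=> t0; rewrite patchE /joint_path/= max_l// /g indicE.
rewrite (_ : ((t, w) \in alive) = (w \in alive_at t)).
  by case: ifP => _; rewrite ?mule1 ?mule0.
by apply/idP/idP; rewrite !inE; [case|split].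
Qed.

Let fgN t w : t < 0 -> (f (joint_path (t, w)) * (g (t, w))%:E)%E = 0%E.
Proof.
move=> t0; rewrite /g indicE memNset ?mule0// => -[/=].
by rewrite leNgt t0.
Qed.

Lemma ge0_integral_occupation :
  (\int[occupation]_x f x = \int[mu]_(t in `[0%R, +oo[) \int[P]_(w in alive_at t) f (Y t w))%E.
Proof.
rewrite /occupation ge0_integral_weighted_law// preimage_setT fubini_tonelli1//.
rewrite [RHS]integral_mkcond.
apply: eq_integral => t _; rewrite patchE /fubini_F.
case: ifPn => [|]; rewrite ?notin_setE ?inE/= in_itv/= andbT => t0.
  by rewrite [RHS]integral_mkcond; apply: eq_integral => w _; exact: fgE.
by apply: integral0_eq => w _; apply: fgN; rewrite ltNge; apply/negP.
Qed.

Lemma ge0_integral_occupation_swap :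
  (\int[occupation]_x f x = \int[P]_w \int[mu]_(t in `[0%R, +oo[) ((fun w => f (Y t w)) \_ (alive_at t)) w)%E.
Proof.
rewrite /occupation ge0_integral_weighted_law// preimage_setT fubini_tonelli2//.
apply: eq_integral => w _; rewrite [RHS]integral_mkcond.
apply: eq_integral => t _; rewrite patchE.
case: ifPn => [|]; rewrite ?notin_setE ?inE/= in_itv/= andbT => t0.
  exact: fgE.
by apply: fgN; rewrite ltNge; apply/negP.
Qed.

Lemma occupation_nneg :
  (\int[occupation]_(x in `[0%R, +oo[) f x = \int[occupation]_x f x)%E.
Proof.
rewrite /occupation ge0_integral_weighted_law//; last exact: measurable_funTS.
rewrite ge0_integral_weighted_law//; congr (integral _ _ _).
apply/seteqP; split=> p//= _; rewrite in_itv/= andbT.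
by apply: path_ge0; rewrite le_max lexx orbT.
Qed.

End occupation_integral.

Lemma potential_measureE (X : R -> T -> option R) (A : set R) :
  (forall t w, 0 <= t -> X t w = if (t%:E < zeta w)%E then Some (Y t w) else None) ->
  measurable (A : set (measurableTypeR R)) ->
  potential_measure P X A = occupation A.
Proof.
move=> XE mA; rewrite -[A in RHS]setIT -integral_indic//.
rewrite ge0_integral_occupation_swap//; last by apply/measurable_EFinP; exact: measurable_indic.
apply: eq_integral => w _; apply: eq_integral => t; rewrite inE/= in_itv/= andbT => t0.
rewrite patchE XE// (_ : (w \in alive_at t) = (t%:E < zeta w)%E); last first.
  by apply/idP/idP; rewrite inE.
case: ifPn => h; rewrite !indicE; last by rewrite memNset// => -[].
congr (_%:R%:E); congr nat_of_bool; apply/idP/idP; rewrite !inE; last by exists (Y t w).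
by move=> [y Ay [<-]].
Qed.

End occupation.

(** * Laplace transform of the potential measure *)

Section measurable_trig.
Context {R : realType}.

Lemma measurable_expRM (s : R) :
  measurable_fun [set: measurableTypeR R] (fun x : R => expR (- (s * x))).
Proof.
apply: continuous_measurable_fun => x.
apply: (continuous_comp (f := fun x => - (s * x))); last exact: continuous_expR.
by apply: cvgN; apply: cvgM; [exact: cvg_cst|exact: cvg_id].
Qed.

Lemma measurable_cosM (y : R) :
  measurable_fun [set: measurableTypeR R] (fun x : R => cos (y * x)).
Proof.
apply: continuous_measurable_fun => x.
apply: (continuous_comp (f := fun x => y * x)); last exact: continuous_cos.
by apply: cvgM; [exact: cvg_cst|exact: cvg_id].
Qed.

Lemma measurable_sinM (y : R) :
  measurable_fun [set: measurableTypeR R] (fun x : R => sin (y * x)).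
Proof.
apply: continuous_measurable_fun => x.
apply: (continuous_comp (f := fun x => y * x)); last exact: continuous_sin.
by apply: cvgM; [exact: cvg_cst|exact: cvg_id].
Qed.

Lemma norm1_addr1 (x : R) : `|x| <= 1 -> 0 <= 1 + x <= 2.
Proof. by rewrite ler_norml; lra. Qed.

End measurable_trig.

Section potential_laplace.
Context d (T : measurableType d) (R : realType) (P : probability T R).
Notation mu := (@lebesgue_measure R).
Local Notation D := (`[0%R, +oo[%classic : set (measurableTypeR R)).
Variables (Y : R -> T -> R) (zeta : T -> \bar R).
Hypothesis mY : forall t, 0 <= t -> measurable_fun setT (Y t).
Hypothesis rcY : forall w t, 0 <= t -> Y u w @[u --> t^'+] --> Y t w.
Hypothesis Y0 : forall w, Y 0 w = 0.
Hypothesis ndY : forall w t t', 0 <= t -> t <= t' -> Y t w <= Y t' w.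
Hypothesis mzeta : measurable_fun setT zeta.
Local Notation U := (occupation P mY rcY ndY mzeta).

Let mD : measurable D. Proof. exact: measurable_itv. Qed.

Lemma integrable_alive (s t : R) (f : R -> R) : 0 <= s -> 0 <= t ->
  measurable_fun [set: measurableTypeR R] f -> (forall x, `|f x| <= 2) ->
  P.-integrable (alive_at zeta t) (EFin \o (fun w => expR (- (s * Y t w)) * f (Y t w))).
Proof.
move=> s0 t0 mf f2; apply: measurable_bounded_integrable.
- exact: measurable_alive_at.
- by apply: le_lt_trans (ltry 1); exact/probability_le1/measurable_alive_at.
- apply: measurable_funTS; apply: measurable_funM; last exact: measurableT_comp (mY t0).
  apply: measurableT_comp => //; apply: measurableT_comp => //.
  by apply: measurable_funM => //; exact: mY.
- exists 2; split=> // x x2 w _; apply: (le_trans _ (ltW x2)).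
  rewrite normrM ger0_norm ?expR_ge0// -[leRHS]mul1r ler_pM ?expR_ge0//.
  by rewrite -expR0 ler_expR oppr_le0 mulr_ge0 ?(path_ge0 Y0 ndY).
Qed.

Section exponential_functional.
Variables (s : R) (f k : R -> R).
Hypothesis s0 : 0 < s.
Hypothesis mf : measurable_fun [set: measurableTypeR R] f.
Hypothesis kE : forall t, 0 <= t ->
  \int[P]_(w in alive_at zeta t) (expR (- (s * Y t w)) * f (Y t w)) = k t.
Hypothesis ik : mu.-integrable `[0, +oo[ (EFin \o k).

Lemma ge0_occupation_exp : (forall x, 0 <= f x <= 2) ->
  (\int[U]_(x in D) (expR (- (s * x)) * f x)%:E)%E = (\int[mu]_(t in `[0, +oo[) k t)%:E.
Proof.
move=> f02.
have f2 x : `|f x| <= 2 by have /andP[f0 f2] := f02 x; rewrite ger0_norm.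
have mh : measurable_fun [set: measurableTypeR R] (fun x : R => (expR (- (s * x)) * f x)%:E).
  by apply/measurable_EFinP; apply: measurable_funM => //; exact: measurable_expRM.
have h0 (x : measurableTypeR R) : (0 <= (expR (- (s * x)) * f x)%:E)%E.
  by rewrite lee_fin mulr_ge0 ?expR_ge0//; have /andP[] := f02 x.
rewrite occupation_nneg// ge0_integral_occupation// /Rintegral fineK; last exact: integrable_fin_num.
apply: eq_integral => t; rewrite inE/= in_itv/= andbT => t0.
rewrite -kE// /Rintegral fineK//; apply: integrable_fin_num.
  exact: measurable_alive_at.
exact: integrable_alive (ltW s0) t0 mf f2.
Qed.

End exponential_functional.

Variables (X : R -> T -> option R) (Phi : R[i] -> R[i]).
Hypothesis XE : forall t w, 0 <= t ->
  X t w = if (t%:E < zeta w)%E then Some (Y t w) else None.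
Hypothesis hPhi : is_laplace_exponent P X Phi.
Hypothesis Phi_gt0 : forall z, 0 < complex.Re z -> 0 < complex.Re (Phi z).

Lemma alive_laplace s y t : 0 <= s -> 0 <= t ->
  \int[P]_(w in alive_at zeta t) (expR (- (s * Y t w)) * cos (y * Y t w)) =
    expR (- (complex.Re (Phi (s +i* y)) * t)) * cos (complex.Im (Phi (s +i* y)) * t) /\
  \int[P]_(w in alive_at zeta t) (expR (- (s * Y t w)) * sin (y * Y t w)) =
    expR (- (complex.Re (Phi (s +i* y)) * t)) * sin (complex.Im (Phi (s +i* y)) * t).
Proof.
move=> s0 t0; have := hPhi (z := s +i* y) t0 s0.
have aE w : (w \in alive_at zeta t) = (t%:E < zeta w)%E by apply/idP/idP; rewrite inE.
case: (Phi _) => p q; rewrite /cintegral /cexp/= => -[].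
rewrite !mulr0 !subr0 !add0r !cosN !sinN mulrN => EC ES; split.
  rewrite -EC Rintegral_mkcond; apply: eq_Rintegral => w _.
  by rewrite patchE XE// aE; case: ifP => //= _; rewrite subr0 add0r cosN.
apply: oppr_inj; rewrite -ES Rintegral_mkcond -mulN1r -RintegralZl//; last first.
  apply: integrable_patch; first exact: measurable_alive_at.
  apply: (integrable_alive (f := fun x => sin (y * x)) s0 t0); first exact: measurable_sinM.
  by move=> x; rewrite (@le_trans _ _ 1)// ?ler1n// ler_norml sin_geN1 sin_le1.
apply: eq_Rintegral => w _.
rewrite patchE XE// aE; case: ifP => _ /=; last by rewrite mulr0.
by rewrite subr0 add0r sinN mulrN mulN1r.
Qed.

Let PR s y := complex.Re (Phi (s +i* y)).
Let PI s y := complex.Im (Phi (s +i* y)).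

Let PR_gt0 s y : 0 < s -> 0 < PR s y.
Proof. exact: (Phi_gt0 (z := s +i* y)). Qed.

Let ikC s y : 0 < s -> mu.-integrable `[0, +oo[ (EFin \o (fun t => expR (- (PR s y * t)) * cos (PI s y * t))).
Proof.
move=> s0; apply: (expR_halfline_integrable (f := fun t => cos (PI s y * t))); first exact: PR_gt0.
  move=> t; apply: (continuous_comp (f := fun t => PI s y * t)); last exact: continuous_cos.
  by apply: cvgM; [exact: cvg_cst|exact: cvg_id].
by move=> t; rewrite ler_norml cos_geN1 cos_le1.
Qed.

Let ikS s y : 0 < s -> mu.-integrable `[0, +oo[ (EFin \o (fun t => expR (- (PR s y * t)) * sin (PI s y * t))).
Proof.
move=> s0; apply: (expR_halfline_integrable (f := fun t => sin (PI s y * t))); first exact: PR_gt0.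
  move=> t; apply: (continuous_comp (f := fun t => PI s y * t)); last exact: continuous_sin.
  by apply: cvgM; [exact: cvg_cst|exact: cvg_id].
by move=> t; rewrite ler_norml sin_geN1 sin_le1.
Qed.

Lemma laplaceable_occupation : laplaceable U D idfun (fun=> 1).
Proof.
move=> s s0; apply/integrableP; split.
  apply/measurable_EFinP; apply: measurable_funTS; apply: measurable_funM => //.
  exact: measurable_expRM.
rewrite (_ : (\int[U]_(x in D) _)%E = (\int[U]_(x in D) (expR (- (s * x)) * 1)%:E)%E); last first.
  by apply: eq_integral => x _; rewrite /= mul1r mulr1 ger0_norm ?expR_ge0.
rewrite (ge0_occupation_exp s0 (f := fun=> 1) (k := fun t => expR (- (PR s 0 * t)) * cos (PI s 0 * t))) ?ltry//.
- move=> t t0; rewrite -(alive_laplace 0 (ltW s0) t0).1.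
  by apply: eq_Rintegral => w _; rewrite mul0r cos0.
- exact: ikC.
- by move=> x; rewrite ler01 ler1n.
Qed.

(** Exchanging the integrals needs a nonnegative integrand: the exchange is done for $1+c$ and
   for $1$, and the results are subtracted. *)
Let occupation_trig (s : R) (c k : R -> R) : 0 < s ->
  measurable_fun [set: measurableTypeR R] c -> (forall x, `|c x| <= 1) ->
  (forall t, 0 <= t -> \int[P]_(w in alive_at zeta t) (expR (- (s * Y t w)) * c (Y t w)) = k t) ->
  mu.-integrable `[0, +oo[ (EFin \o k) ->
  \int[U]_(x in D) (1 * (expR (- (s * idfun x)) * c x)) = \int[mu]_(t in `[0, +oo[) k t.
Proof.
move=> s0 mc c1 kE ik.
pose k0 t := expR (- (PR s 0 * t)) * cos (PI s 0 * t).
have k0E t : 0 <= t -> \int[P]_(w in alive_at zeta t) (expR (- (s * Y t w)) * 1) = k0 t.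
  move=> t0; rewrite /k0 -(alive_laplace 0 (ltW s0) t0).1.
  by apply: eq_Rintegral => w _; rewrite mul0r cos0.
have ik0 : mu.-integrable `[0, +oo[ (EFin \o k0) by exact: ikC.
have E0 : \int[U]_(x in D) (expR (- (s * x)) * 1) = \int[mu]_(t in `[0, +oo[) k0 t.
  rewrite {1}/Rintegral (ge0_occupation_exp s0 (f := fun=> 1) (k := k0))//.
  by move=> x; rewrite ler01 ler1n.
have n1 (x : R) : `|1 : R| <= 2 by rewrite normr1 ler1n.
have n2 (x : R) : `|c x| <= 2 by rewrite (le_trans (c1 x))// ler1n.
have E1 : \int[U]_(x in D) (expR (- (s * x)) * (1 + c x)) = \int[mu]_(t in `[0, +oo[) (k0 t + k t).
  rewrite {1}/Rintegral (ge0_occupation_exp s0 (f := fun x => 1 + c x) (k := fun t => k0 t + k t))//.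
  - by apply: measurable_funD.
  - move=> t t0; rewrite -k0E// -kE// -RintegralD//.
    + by apply: eq_Rintegral => w _; rewrite mulrDr.
    + exact: measurable_alive_at.
    + exact: (integrable_alive (f := fun=> 1) (ltW s0) t0).
    + exact: (integrable_alive (f := c) (ltW s0) t0).
  - by move: (integrableD mD ik0 ik).
  - by move=> x; exact/norm1_addr1/c1.
have i1 : U.-integrable D (EFin \o (fun x => expR (- (s * x)) * 1)).
  by apply: eq_integrable (laplaceable_occupation s0) => // x _; rewrite /= mul1r mulr1.
have i2 : U.-integrable D (EFin \o (fun x => 1 * (expR (- (s * idfun x)) * c x))).
  apply: (laplaceable_dominated mD (@measurable_id _ _ D) s0 laplaceable_occupation) => //.
  exact: measurable_funTS.
apply: (@addrI _ (\int[mu]_(t in `[0, +oo[) k0 t)).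
rewrite -RintegralD// -?E1.
rewrite -E0 -RintegralD//.
by apply: eq_Rintegral => x _; rewrite mul1r mulrDr.
Qed.

(** $E\int_0^\zeta e^{-zX_t}dt=\int_0^\infty e^{-t\Phi(z)}dt=1/\Phi(z)$, as $\Re\Phi(z)>0$. *)
Theorem lap_occupation z : 0 < complex.Re z -> lap U D idfun (fun=> 1) z = (Phi z)^-1.
Proof.
case: z => s y /= s0; have p0 := PR_gt0 y s0.
rewrite /lap/=.
have -> : lapC U D idfun (fun=> 1) s y = PR s y / (PR s y ^+ 2 + PI s y ^+ 2).
  rewrite -laplace_cos// /lapC; apply: (occupation_trig (c := fun x => cos (y * x)) s0).
  - exact: measurable_cosM.
  - by move=> x; rewrite ler_norml cos_geN1 cos_le1.
  - by move=> t t0; rewrite (alive_laplace y (ltW s0) t0).1.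
  - exact: ikC.
have -> : lapS U D idfun (fun=> 1) s y = PI s y / (PR s y ^+ 2 + PI s y ^+ 2).
  rewrite -laplace_sin// /lapS; apply: (occupation_trig (c := fun x => sin (y * x)) s0).
  - exact: measurable_sinM.
  - by move=> x; rewrite ler_norml sin_geN1 sin_le1.
  - by move=> t t0; rewrite (alive_laplace y (ltW s0) t0).2.
  - exact: ikS.
rewrite /PR /PI in p0 *; case: (Phi _) p0 => p q/= p0.
apply: (@mulrI _ (p +i* q)); first by rewrite unitfE eq_complex/= negb_and gt_eqF.
rewrite mulfV; last by rewrite eq_complex/= negb_and gt_eqF.
have h : p ^+ 2 + q ^+ 2 != 0 by rewrite gt_eqF// ltr_pwDl ?sqr_ge0// exprn_gt0.
by apply/eqP; rewrite eq_complex/=; apply/andP; split; apply/eqP; field.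
Qed.

End potential_laplace.

(** * The Laplace exponent and its Levy triplet *)

Section levy_triplet.
Context (R : realType) (Phi : R[i] -> R[i]) (a b : R) (Pi : {measure set R -> \bar R}).
Hypothesis hPi : has_levy_triplet Phi a b Pi.
Local Notation D := (`]0%R, +oo[%classic : set R).

Let mD : measurable D. Proof. exact: measurable_itv. Qed.

Lemma measurable_expRcos (s y : R) : measurable_fun [set: R] (fun x : R => 1 - expR (- (s * x)) * cos (y * x)).
Proof.
apply: continuous_measurable_fun => x; apply: cvgB; first exact: cvg_cst.
apply: cvgM.
  apply: (continuous_comp (f := fun x => - (s * x))); last exact: continuous_expR.
  by apply: cvgN; apply: cvgM; [exact: cvg_cst|exact: cvg_id].
apply: (continuous_comp (f := fun x => y * x)); last exact: continuous_cos.
by apply: cvgM; [exact: cvg_cst|exact: cvg_id].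
Qed.

(** The last bound makes $1-\Re e^{-zx}$ integrable for the Levy measure, which integrates $1\wedge x$;
   the others say that it is nonnegative and smallest on the real axis. *)
Lemma expRcos_le (s y x : R) : 0 <= s -> 0 < x ->
  [/\ 0 < s -> 0 < 1 - expR (- (s * x)), 0 <= 1 - expR (- (s * x)),
     1 - expR (- (s * x)) <= 1 - expR (- (s * x)) * cos (y * x) &
     1 - expR (- (s * x)) * cos (y * x) <= (2 + s + y ^+ 2) * Num.min 1 x].
Proof.
move=> s0 x0; have sx0 : 0 <= s * x by rewrite mulr_ge0// ltW.
have E0 := expR_ge0 (- (s * x)).
have E1 : expR (- (s * x)) <= 1 by rewrite -expR0 ler_expR oppr_le0.
have C1 := cos_le1 (y * x); have C2 := cos_geN1 (y * x).
have s2 := sqr_ge0 y.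
split; first by move=> s1; rewrite subr_gt0 -expR0 ltr_expR oppr_lt0 mulr_gt0.
- by rewrite subr_ge0.
- by rewrite lerD2l lerN2 ler_piMr.
have [x1|x1] := leP 1 x.
  rewrite mulr1 (@le_trans _ _ 2)//; last by lra.
  nra.
have E2 := expR_ge1Dx (- (s * x)).
have C3 : 1 - cos (y * x) <= (y * x) ^+ 2.
  by have := normr_cosB1_le (y * x); rewrite distrC; apply: le_trans; exact: ler_norm.
have -> : 1 - expR (- (s * x)) * cos (y * x) =
  (1 - expR (- (s * x))) + expR (- (s * x)) * (1 - cos (y * x)) by ring.
have h : (y * x) ^+ 2 <= y ^+ 2 * x.
  by rewrite exprMn ler_wpM2l// expr2 ler_piMl ?(ltW x0)// ltW.
have h2 : expR (- (s * x)) * (1 - cos (y * x)) <= 1 - cos (y * x).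
  by rewrite ler_piMl// subr_ge0.
have -> : (2 + s + y ^+ 2) * x = 2 * x + s * x + y ^+ 2 * x by ring.
lra.
Qed.

Lemma integrable_min1 : Pi.-integrable D (EFin \o (fun x => Num.min 1 x)).
Proof.
have [_ _ _ h _] := hPi; apply/integrableP; split.
  apply/measurable_EFinP; apply: measurable_funTS; apply: measurable_minr => //.
apply: le_lt_trans h; rewrite le_eqVlt; apply/orP; left; apply/eqP.
apply: eq_integral => x; rewrite inE/= in_itv/= andbT => x0.
by rewrite ger0_norm// le_min ler01 ltW.
Qed.

Lemma integrable_expRcos s y : 0 <= s ->
  Pi.-integrable D (EFin \o (fun x => 1 - expR (- (s * x)) * cos (y * x))).
Proof.
move=> s0; apply: le_integrable (integrable_scale (2 + s + y ^+ 2) mD integrable_min1) => //.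
  by apply/measurable_EFinP; apply: measurable_funTS; exact: measurable_expRcos.
move=> x; rewrite /= in_itv/= andbT => x0; rewrite lee_fin.
have [_ h0 h1 h2] := expRcos_le y s0 x0.
rewrite ger0_norm; last exact: le_trans h1.
exact: le_trans (ler_norm _).
Qed.

Lemma Re_levy_exponent s y : 0 <= s -> complex.Re (Phi (s +i* y)) =
  a + b * s + \int[Pi]_(x in D) (1 - expR (- (s * x)) * cos (y * x)).
Proof.
move=> s0; have [_ _ _ _ /(_ (s +i* y) s0) ->] := hPi.
rewrite /= mul0r subr0; congr (_ + _ + _); apply: eq_Rintegral => x _.
by rewrite !mulr0 subr0 add0r cosN.
Qed.

Lemma levy_tail_lty x : 0 < x -> (Pi `]x, +oo[%classic < +oo)%E.
Proof.
move=> x0; have m1 : 0 < Num.min 1 x by rewrite lt_min ltr01.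
have sD : `]x, +oo[%classic `<=` D.
  by move=> y; rewrite /= !in_itv/= !andbT; exact: lt_trans.
have h : ((Num.min 1 x)%:E * Pi `]x, +oo[%classic < +oo)%E.
  rewrite -integral_cst//.
  have [_ _ _ h _] := hPi; apply: le_lt_trans h.
  apply: (@le_trans _ _ (\int[Pi]_(y in `]x, +oo[) (Num.min 1 y)%:E)%E).
    apply: ge0_le_integral => //.
    - by move=> y _; rewrite lee_fin ltW.
    - by apply/measurable_EFinP; apply: measurable_funTS; exact: measurable_minr.
    - move=> y; rewrite /= in_itv/= andbT => xy; rewrite lee_fin le_min ge_min lexx/= ge_min.
      by rewrite (ltW xy) orbT.
  apply: ge0_subset_integral => //.
    by apply/measurable_EFinP; apply: measurable_funTS; exact: measurable_minr.
  by move=> y; rewrite /= in_itv/= andbT => y0; rewrite lee_fin le_min ler01 ltW.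
have := measure_ge0 Pi `]x, +oo[%classic; move: h; case: (Pi `]x, +oo[%classic) => // [r _ _|].
  by rewrite ltry.
by rewrite gt0_muley ?lte_fin.
Qed.

Hypothesis nonzero : [\/ 0 < a, 0 < b | (0 < Pi `]0%R, +oo[%classic)%E].

(** The three terms of $\Re\Phi$ are nonnegative, and the integrand of the last one is
   positive everywhere, so its integral vanishes only with the measure. *)
Lemma Re_levy_exponent_gt0 z : 0 < complex.Re z -> 0 < complex.Re (Phi z).
Proof.
case: z => s y /= s0; rewrite Re_levy_exponent ?ltW//.
have [[a0 b0] _ _ _ _] := hPi.
have I0 : 0 <= \int[Pi]_(x in D) (1 - expR (- (s * x)) * cos (y * x)).
  apply: Rintegral_ge0 => x; rewrite /= in_itv/= andbT => x0.
  by have [_ h0 h1 _] := expRcos_le y (ltW s0) x0; exact: le_trans h1.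
have bs0 : 0 <= b * s by rewrite mulr_ge0// ltW.
case: nonzero => [a1|b1|P1].
- by lra.
- have : 0 < b * s by rewrite mulr_gt0//.
  lra.
suff : 0 < \int[Pi]_(x in D) (1 - expR (- (s * x)) * cos (y * x)) by lra.
rewrite lt_neqAle I0 andbT; apply/eqP => /esym I1.
have ii := integrable_expRcos y (ltW s0).
have mi := measurable_int _ ii.
have : (\int[Pi]_(x in D) `|(EFin \o (fun x => (1 - expR (- (s * x)) * cos (y * x))%R)) x|)%E = 0%E.
  transitivity (EFin (\int[Pi]_(x in D) (1 - expR (- (s * x)) * cos (y * x)))); last by rewrite I1.
  rewrite /Rintegral fineK ?integrable_fin_num//; apply: eq_integral => x.
  rewrite inE/= in_itv/= andbT => x0; congr EFin; apply: ger0_norm.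
  by have [_ h0 h1 _] := expRcos_le y (ltW s0) x0; exact: le_trans h1.
move/(ae_eq_integral_abs Pi mD mi) => [A [mA A0 sA]].
move: P1; suff -> : Pi D = 0%E by rewrite ltxx.
apply: (measure_negligible mD); exists A; split=> // x Dx; apply: sA => /(_ Dx)/=[].
move: Dx; rewrite /= in_itv/= andbT => x0 e0.
have [/(_ s0) h0 _ h1 _] := expRcos_le y (ltW s0) x0.
by move: (lt_le_trans h0 h1); rewrite e0 ltxx.
Qed.

End levy_triplet.

(** * Measures that agree on intervals *)

Section pack.
Context d (T : measurableType d) (R : realType).

(** A measure proved to be sigma-finite, repackaged with the structure that the exchange
   of integrals expects. *)
Definition sigma_finite_measure_of (m : {measure set T -> \bar R})
  (h : sigma_finite setT m) : set T -> \bar R := m.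

HB.instance Definition _ (m : {measure set T -> \bar R}) (h : sigma_finite setT m) :=
  Measure.copy (sigma_finite_measure_of h) m.

HB.instance Definition _ (m : {measure set T -> \bar R}) (h : sigma_finite setT m) :=
  @Measure_isSigmaFinite.Build _ _ _ (sigma_finite_measure_of h) h.

End pack.

Section measure_eq_exhaust.
Context {R : realType}.
Variables (m1 m2 : {measure set (measurableTypeR R) -> \bar R}) (l r : nat -> R).
Hypothesis l_ni : forall m n, (m <= n)%N -> l n <= l m.
Hypothesis r_nd : forall m n, (m <= n)%N -> r m <= r n.
Hypothesis m12 : forall n a b, l n <= a -> a <= b -> b <= r n -> m1 `]a, b]%classic = m2 `]a, b]%classic.
Hypothesis m1_fin : forall n, (m1 `]l n, r n]%classic < +oo)%E.

Local Notation E n := (`]l n, r n]%classic : set (measurableTypeR R)).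
Let mE n : measurable (E n). Proof. exact: measurable_itv. Qed.

(** Half-open intervals generate the Borel sets and are stable under intersection, so the
   measures agree inside each window; continuity from below does the rest. *)
Lemma measure_eq_exhaust A : measurable A -> A `<=` \bigcup_n E n -> m1 A = m2 A.
Proof.
move=> mA sA.
have mAE n : measurable (A `&` E n) by exact: measurableI.
have AE : \bigcup_n (A `&` E n) = A by rewrite -setI_bigcupr; exact/setIidPl.
have ndE : {homo (fun n => A `&` E n) : n m / (n <= m)%N >-> (n <= m)%O}.
  move=> n m nm; apply/subsetPset => x [Ax p]; split=> //; move: p.
  rewrite /= !in_itv/= => /andP[h1 h2].
  by rewrite (le_lt_trans (l_ni nm))// (le_trans h2)// r_nd.
have c1 := nondecreasing_cvg_mu (mu := m1) mAE (bigcupT_measurable _ mAE) ndE.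
have c2 := nondecreasing_cvg_mu (mu := m2) mAE (bigcupT_measurable _ mAE) ndE.
rewrite AE in c1 c2; rewrite -(cvg_lim _ c1)// -(cvg_lim _ c2)//; congr (limn _).
apply/funext => n /=.
pose M1 : {measure set (measurableTypeR R) -> \bar R} := mrestr m1 (mE n).
pose M2 : {measure set (measurableTypeR R) -> \bar R} := mrestr m2 (mE n).
have mr1 : forall B, M1 B = m1 (B `&` E n) by [].
have mr2 : forall B, M2 B = m2 (B `&` E n) by [].
rewrite -mr1 -mr2.
pose g k := (`](- k%:R)%R, k%:R]%classic : set (measurableTypeR R)).
apply: (@measure_unique _ R (measurableTypeR R) (@ocitv R) g _ _ _ _ M1 M2) => //.
- exact: ocitvI.
- by move=> k; exists (- k%:R, k%:R).
- rewrite -subTset => x _; exists (Num.truncn `|x|).+1 => //=.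
  by rewrite /g/= in_itv/=; have := truncnS_gt `|x|; rewrite ltr_norml => /andP[-> /ltW ->].
- move=> _ [[p q] _ <-]; rewrite /= mr1 mr2.
  rewrite (_ : _ `&` E n = `]Num.max p (l n), Num.min q (r n)]%classic); last first.
    apply/seteqP; split=> x; rewrite /= !in_itv/= gt_max le_min.
      by move=> [/andP[-> ->] /andP[-> ->]].
    by move=> /andP[/andP[-> ->] /andP[-> ->]].
  have [ab|ba] := leP (Num.max p (l n)) (Num.min q (r n)).
    apply: (m12 (n := n)) => //; first by rewrite le_max lexx orbT.
    by rewrite ge_min lexx orbT.
  by rewrite set_itv_ge ?measure0// bnd_simp -leNgt ltW.
- move=> k; apply: (@le_lt_trans _ _ (m1 (E n))) => //; rewrite mr1.
  by apply: le_measure; rewrite ?inE//; apply: measurableI => //; exact: measurable_itv.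
Qed.

End measure_eq_exhaust.

(** * A continuous density from Fourier inversion *)

Section density_at_abscissa.
Context {R : realType}.
Notation mu := (@lebesgue_measure R).
Local Notation D := (`[0%R, +oo[%classic : set (measurableTypeR R)).
Local Notation D0 := (`]0%R, +oo[%classic : set (measurableTypeR R)).
Variables (U : {sigma_finite_measure set (measurableTypeR R) -> \bar R}) (W H : R -> R) (s : R).
Local Notation C1 := (lapC U D idfun (fun x => idfun x * 1) s).
Local Notation S1 := (lapS U D idfun (fun x => idfun x * 1) s).
Local Notation C2 := (lapC mu D0 idfun (fun x => idfun x * W x) s).
Local Notation S2 := (lapS mu D0 idfun (fun x => idfun x * W x) s).
Hypothesis s0 : 0 < s.
Hypothesis lU : laplaceable U D idfun (fun=> 1).
Hypothesis lW : laplaceable mu D0 idfun W.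
Hypothesis cW : forall x, 0 < x -> {for x, continuous W}.
Hypothesis iH : mu.-integrable `[0, +oo[ (EFin \o H).
Hypothesis HC : forall y, 0 <= y -> `|C1 y - C2 y| <= H y.
Hypothesis HS : forall y, 0 <= y -> `|S1 y - S2 y| <= H y.

Let mD : measurable D. Proof. exact: measurable_itv. Qed.
Let mD0 : measurable D0. Proof. exact: measurable_itv. Qed.
Let midD : measurable_fun D (@idfun R). Proof. exact: measurable_id. Qed.
Let midD0 : measurable_fun D0 (@idfun R). Proof. exact: measurable_id. Qed.
Let id_ge0 (x : R) : D x -> 0 <= (@idfun R) x.
Proof. by rewrite /= in_itv/= andbT. Qed.
Let id_ge00 (x : R) : D0 x -> 0 <= (@idfun R) x.
Proof. by rewrite /= in_itv/= andbT => /ltW. Qed.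

Let wU (x : R) := (idfun x * 1) * expR (- (s * idfun x)).
Let wW (x : R) := (idfun x * W x) * expR (- (s * idfun x)).
Let w1 := wU \_ D.
Let w2 := wW \_ D0.

Let lU1 := laplaceable_xi mD midD id_ge0 lU.
Let lW1 := laplaceable_xi mD0 midD0 id_ge00 lW.

Let iw1 : U.-integrable setT (EFin \o w1).
Proof. exact: integrable_patch mD (lU1 s0). Qed.

Let iw2 : mu.-integrable setT (EFin \o w2).
Proof. exact: integrable_patch mD0 (lW1 s0). Qed.

Let fCE y : fourC U w1 y - fourC mu w2 y = C1 y - C2 y.
Proof.
congr (_ - _); rewrite /fourC [RHS]Rintegral_mkcond; apply: eq_Rintegral => x _;
  rewrite /w1 /w2 !patchE; case: ifP => _; rewrite ?mul0r//.
  by rewrite /wU mulrA.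
by rewrite /wW mulrA.
Qed.

Let fSE y : fourS U w1 y - fourS mu w2 y = S1 y - S2 y.
Proof.
congr (_ - _); rewrite /fourS [RHS]Rintegral_mkcond; apply: eq_Rintegral => x _;
  rewrite /w1 /w2 !patchE; case: ifP => _; rewrite ?mul0r//.
  by rewrite /wU mulrA.
by rewrite /wW mulrA.
Qed.

Let mGc : measurable_fun [set: measurableTypeR R] (fun y => fourC U w1 y - fourC mu w2 y).
Proof.
under eq_fun do rewrite fCE; apply: continuous_measurable_fun => y.
have c1 := continuous_is_derive (fun y => is_derive_lapC mD midD id_ge0 y s0 lU1).
have c2 := continuous_is_derive (fun y => is_derive_lapC mD0 midD0 id_ge00 y s0 lW1).
by apply: cvgB; [exact: c1|exact: c2].
Qed.

Let mGs : measurable_fun [set: measurableTypeR R] (fun y => fourS U w1 y - fourS mu w2 y).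
Proof.
under eq_fun do rewrite fSE; apply: continuous_measurable_fun => y.
have c1 := continuous_is_derive (fun y => is_derive_lapS mD midD id_ge0 y s0 lU1).
have c2 := continuous_is_derive (fun y => is_derive_lapS mD0 midD0 id_ge00 y s0 lW1).
by apply: cvgB; [exact: c1|exact: c2].
Qed.

Let GcH y : 0 <= y -> `|fourC U w1 y - fourC mu w2 y| <= H y.
Proof. by rewrite fCE; exact: HC. Qed.

Let GsH y : 0 <= y -> `|fourS U w1 y - fourS mu w2 y| <= H y.
Proof. by rewrite fSE; exact: HS. Qed.

Let v := inverse_fourier U mu w1 w2.

Let cv : continuous v.
Proof. exact: (continuous_inverse_fourier iH mGc mGs GcH GsH). Qed.

Let vE p q : p <= q -> \int[U]_(x in `]p, q]) w1 x - \int[mu]_(x in `]p, q]) w2 x =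
  \int[mu]_(x in `[p, q]) v x.
Proof. by move=> pq; rewrite (@inverse_fourierE R U mu w1 w2 iw1 iw2 H iH mGc mGs GcH GsH). Qed.

Let q x := v x + wW x.

Let cq x : 0 < x -> {for x, continuous q}.
Proof.
move=> x0; apply: cvgD; first exact: cv.
apply: cvgM; first by apply: cvgM; [exact: cvg_id|exact: cW].
apply: (continuous_comp (f := fun x => - (s * x))); last exact: continuous_expR.
by apply: cvgN; apply: cvgM; [exact: cvg_cst|exact: cvg_id].
Qed.

Let qE a b : 0 < a -> a <= b ->
  \int[U]_(x in `]a, b]) w1 x = \int[mu]_(x in `[a, b]) q x.
Proof.
move=> a0 ab; apply: (@addIr _ (- \int[mu]_(x in `]a, b]) w2 x)).
have sub x : `]a, b]%classic x -> D0 x.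
  by rewrite /= !in_itv/= andbT => /andP[ax _]; exact: lt_trans ax.
have iW : mu.-integrable `[a, b] (EFin \o wW).
  apply: (integrableS mD0) (lW1 s0); first exact: measurable_itv.
  by move=> x; rewrite /= !in_itv/= andbT => /andP[ax _]; exact: lt_le_trans ax.
rewrite vE// [in X in _ = _ - X](_ : \int[mu]_(x in `]a, b]) w2 x = \int[mu]_(x in `[a, b]) wW x).
  rewrite /q RintegralD ?addrK//.
  by apply: continuous_segment_integrable => // x _; exact: cv.
rewrite -Rintegral_itv_obnd_cbnd; last first.
  apply: integrableS iW => //.
  by move=> x; rewrite /= !in_itv/= => /andP[/ltW -> ->].
by apply: eq_Rintegral => x; rewrite inE => /sub Dx; rewrite /w2 patchE mem_set.
Qed.

Let w1_ge0 x : 0 <= w1 x.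
Proof.
rewrite /w1 patchE; case: ifPn => //; rewrite inE/= in_itv/= andbT => x0.
by rewrite /wU mulr1 mulr_ge0 ?expR_ge0.
Qed.

Let q_ge0 x : 0 < x -> 0 <= q x.
Proof.
apply: continuous_ge0_from_integrals => // a b a0 ab.
by rewrite -qE//; apply: Rintegral_ge0.
Qed.

Let mw1 : measurable_fun [set: measurableTypeR R] w1.
Proof. by have /measurable_int/measurable_EFinP := iw1. Qed.

Let mw2 : measurable_fun [set: measurableTypeR R] w2.
Proof. by have /measurable_int/measurable_EFinP := iw2. Qed.

Let g2 (x : R) := Num.max (v x + w2 x) 0.

Let mg2 : measurable_fun [set: measurableTypeR R] g2.
Proof.
apply: measurable_maxr => //; apply: measurable_funD => //.
exact: continuous_measurable_fun.
Qed.

Let g2_ge0 x : 0 <= g2 x. Proof. by rewrite le_max lexx orbT. Qed.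

Let g2E x : 0 < x -> g2 x = q x.
Proof.
move=> x0; rewrite /g2 /w2 patchE mem_set ?max_l//; first exact: q_ge0.
by rewrite /= in_itv/= andbT.
Qed.

Let m1 : {measure set (measurableTypeR R) -> \bar R} :=
  weighted_law U mw1 w1_ge0 (@measurable_id _ (measurableTypeR R) setT).
Let m2 : {measure set (measurableTypeR R) -> \bar R} :=
  weighted_law mu mg2 g2_ge0 (@measurable_id _ (measurableTypeR R) setT).

Let m12 A : measurable (A : set (measurableTypeR R)) -> A `<=` D0 -> m1 A = m2 A.
Proof.
move=> mA sA.
have iw1' a b : U.-integrable `]a, b] (EFin \o w1).
  by apply: integrableS iw1 => //; exact: measurable_itv.
apply: (@measure_eq_exhaust R m1 m2 (fun n => n.+1%:R^-1) (fun n => n.+1%:R)) => //.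
- by move=> m n mn; rewrite lef_pV2 ?posrE// ler_nat.
- by move=> m n mn; rewrite ler_nat.
- move=> n a b na ab _; have a0 : 0 < a by apply: lt_le_trans na; rewrite invr_gt0.
  rewrite /m1 /m2 /= /weighted_law !preimage_id.
  have i2 : mu.-integrable `]a, b] (EFin \o q).
    apply: (@integrableS _ _ _ mu `[a, b]); [exact: measurable_itv|exact: measurable_itv| |].
      by move=> x; rewrite /= !in_itv/= => /andP[/ltW -> ->].
    exact: continuous_segment_integrable.
  transitivity (\int[U]_(x in `]a, b]) w1 x)%:E; first by rewrite /Rintegral fineK// integrable_fin_num// measurable_itv.
  rewrite qE// -Rintegral_itv_obnd_cbnd// /Rintegral fineK; last by rewrite integrable_fin_num// measurable_itv.
  apply: eq_integral => x; rewrite inE/= in_itv/= => /andP[ax _].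
  by rewrite g2E// (lt_trans a0).
- move=> n; rewrite /m1 /= /weighted_law !preimage_id.
  exact: integral_fune_lt_pinfty (iw1' _ _).
- move=> x /sA; rewrite /= in_itv/= andbT => x0.
  have xi : 0 < x^-1 by rewrite invr_gt0.
  have /ltW h := truncnS_gt (x + x^-1).
  exists (Num.truncn (x + x^-1)) => //=; rewrite in_itv/=; apply/andP; split.
    rewrite -[ltRHS]invrK ltf_pV2 ?posrE//.
    by rewrite (lt_le_trans _ h)// ltrDr.
  by rewrite (le_trans _ h)// lerDl ltW.
Qed.

Let u x := expR (s * x) * x `^ (- 1) * g2 x.

Let uE x : 0 < x -> u x = expR (s * x) / x * q x.
Proof. by move=> x0; rewrite /u g2E// powR_inv1// ltW. Qed.

(** The hypotheses bound the difference of the Fourier transforms of $xe^{-sx}U(dx)$ and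
   $xe^{-sx}W(x)dx$. Inversion gives the difference of these measures a continuous density, at most
   $\frac2\pi\int H$ in absolute value; $U$ is recovered after multiplication by $e^{sx}/x$. *)
Lemma density_at_abscissa : exists u : R -> R,
  [/\ forall x, 0 < x -> 0 <= u x,
      forall x, 0 < x -> {for x, continuous u},
      forall A, measurable (A : set (measurableTypeR R)) -> A `<=` D0 ->
        U A = (\int[mu]_(x in A) (u x)%:E)%E &
      forall x, 0 < x -> `|u x - W x| <=
        expR (s * x) / x * (2 / pi * \int[mu]_(y in `[0, +oo[) H y)].
Proof.
exists u; split.
- by move=> x x0; rewrite uE// mulr_ge0 ?q_ge0// divr_ge0 ?expR_ge0// ltW.
- move=> x x0.
  have cu : {for x, continuous (fun x => expR (s * x) * x `^ (- 1) * q x)}.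
    apply: cvgM; last exact: cq.
    apply: cvgM; last exact: continuous_powR.
    apply: (continuous_comp (f := fun x => s * x)); last exact: continuous_expR.
    by apply: cvgM; [exact: cvg_cst|exact: cvg_id].
  rewrite /prop_for /continuous_at /u g2E//.
  apply: cvg_trans cu; apply: near_eq_cvg; near=> y; rewrite g2E//.
  by near: y; exact: lt_nbhsr.
- move=> A mA sA.
  pose f (x : R) := (expR (s * x) * x `^ (- 1))%:E.
  have mf : measurable_fun [set: measurableTypeR R] f.
    apply/measurable_EFinP; apply: measurable_funM; last exact: measurable_powR.
    apply: continuous_measurable_fun => x.
    apply: (continuous_comp (f := fun x => s * x)); last exact: continuous_expR.
    by apply: cvgM; [exact: cvg_cst|exact: cvg_id].
  have f0 x : (0 <= f x)%E by rewrite lee_fin mulr_ge0 ?expR_ge0 ?powR_ge0.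
  transitivity (\int[m1]_(x in A) f x)%E.
    rewrite ge0_integral_weighted_law ?preimage_id//; last exact: measurable_funTS.
    rewrite -[A in LHS]setIT -integral_indic// [RHS]integral_mkcond.
    apply: eq_integral => x _; rewrite patchE indicE; case: ifPn => // xA.
    have : D0 x by apply: sA; move: xA; rewrite inE.
    rewrite /= in_itv/= andbT => x0.
    rewrite /f /w1 patchE mem_set /=; last by rewrite in_itv/= andbT ltW.
    rewrite -EFinM /wU /idfun powR_inv1 ?(ltW x0)//; congr EFin.
    rewrite mulr1 (mulrC x) mulrACA -expRD subrr expR0 mul1r mulVf// gt_eqF//.
  rewrite (@eq_measure_integral _ _ _ A m2 m1); last first.
    by move=> B mB BA; apply: m12 => // x /BA; exact: sA.
  rewrite ge0_integral_weighted_law//; last exact: measurable_funTS.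
- move=> x x0; rewrite uE//.
  have -> : expR (s * x) / x * q x - W x = expR (s * x) / x * v x.
    rewrite /q /wW /idfun; have -> : expR (- (s * x)) = (expR (s * x))^-1 by rewrite expRN.
    by field; rewrite gt_eqF//= gt_eqF// expR_gt0.
  rewrite normrM ger0_norm ?divr_ge0 ?expR_ge0 ?(ltW x0)//.
  rewrite ler_wpM2l ?divr_ge0 ?expR_ge0 ?(ltW x0)//.
  exact: (inverse_fourier_bound iH mGc mGs GcH GsH).
Unshelve. all: by end_near. Qed.

End density_at_abscissa.

(** * The potential density near zero *)

Section normc.
Context {R : realType}.
Local Notation normc := ComplexField.Normc.normc.

Lemma normr_Re_le (z : R[i]) : `|complex.Re z| <= normc z.
Proof.
by case: z => x y /=; rewrite -sqrtr_sqr ler_sqrt ?addr_ge0 ?sqr_ge0// lerDl sqr_ge0.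
Qed.

Lemma normr_Im_le (z : R[i]) : `|complex.Im z| <= normc z.
Proof.
by case: z => x y /=; rewrite -sqrtr_sqr ler_sqrt ?addr_ge0 ?sqr_ge0// lerDr sqr_ge0.
Qed.

End normc.

Section lap_linear.
Context d (T : measurableType d) (R : realType).
Variables (mu : {measure set T -> \bar R}) (D : set T) (xi : T -> R).
Hypotheses (mD : measurable D) (mxi : measurable_fun D xi).

Lemma laplaceableDZ (f g : T -> R) k : laplaceable mu D xi f -> laplaceable mu D xi g ->
  laplaceable mu D xi (fun x => f x + k * g x).
Proof.
move=> lf lg s s0.
have := integrableD mD (lf _ s0) (integrable_scale k mD (lg _ s0)).
by apply: eq_integrable => // x _; rewrite /= -EFinD mulrDl mulrA.
Qed.

Lemma lapDZ (f g : T -> R) k z : laplaceable mu D xi f -> laplaceable mu D xi g ->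
  0 < complex.Re z ->
  lap mu D xi (fun x => f x + k * g x) z = lap mu D xi f z + k%:C * lap mu D xi g z.
Proof.
case: z => s y lf lg /= s0; rewrite /lap/=.
apply/eqP; rewrite eq_complex/= !mul0r subr0 addr0; apply/andP; split; apply/eqP.
  rewrite /lapC -RintegralZl//; last exact: integrable_lapC.
  rewrite -RintegralD//; first by apply: eq_Rintegral => x _; ring.
    exact: integrable_lapC.
  by apply: integrable_scale => //; exact: integrable_lapC.
rewrite mulrN -opprD; congr (- _).
rewrite /lapS -RintegralZl//; last exact: integrable_lapS.
rewrite -RintegralD//; first by apply: eq_Rintegral => x _; ring.
  exact: integrable_lapS.
by apply: integrable_scale => //; exact: integrable_lapS.
Qed.

End lap_linear.

Section potential_density.
Context {R : realType}.
Notation mu := (@lebesgue_measure R).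
Local Notation normc := ComplexField.Normc.normc.
Local Notation D := (`[0%R, +oo[%classic : set (measurableTypeR R)).
Local Notation D0 := (`]0%R, +oo[%classic : set (measurableTypeR R)).
Variables (n : nat) (c beta : nat -> R) (rho : R -> R).
Hypothesis hbeta0 : 0 < beta 0%N <= 1.
Hypothesis hbeta : forall k : nat, (k < n)%N -> beta k < beta k.+1.
Hypothesis hrho_gt0 : forall t, 0 < t -> 0 < rho t.
Hypothesis hrho_loc : locally_integrable `]0, +oo[ rho.
Variable r : R.
Hypothesis r0 : 0 < r.
Hypothesis hrho_mono : forall t t', r < t -> t <= t' -> rho t' <= rho t.
Hypothesis hrho_o : rho t / t `^ (- 1 - beta n) @[t --> +oo] --> (0 : R).

Let mD : measurable D. Proof. exact: measurable_itv. Qed.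
Let mD0 : measurable D0. Proof. exact: measurable_itv. Qed.
Let midD : measurable_fun D (@idfun R). Proof. exact: measurable_id. Qed.
Let midD0 : measurable_fun D0 (@idfun R). Proof. exact: measurable_id. Qed.
Let id_ge0 (x : R) : D x -> 0 <= (@idfun R) x.
Proof. by rewrite /= in_itv/= andbT. Qed.
Let id_ge00 (x : R) : D0 x -> 0 <= (@idfun R) x.
Proof. by rewrite /= in_itv/= andbT => /ltW. Qed.

Lemma exponent_gt0 k : (k <= n)%N -> 0 < beta k.
Proof.
elim: k => [_|k IH kn]; first by have /andP[] := hbeta0.
by apply: lt_trans (hbeta kn); exact/IH/ltnW.
Qed.

(** The function with Laplace transform $\sum_{k<m}1/(c_kz^{\beta_k})$. *)
Definition power_density (m : nat) (x : R) : R :=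
  \sum_(0 <= k < m) rgamma (beta k) / c k * x `^ (beta k - 1).

Lemma continuous_power_density m x : 0 < x -> {for x, continuous (power_density m)}.
Proof.
move=> x0; elim: m => [|m IH].
  rewrite /prop_for /continuous_at /power_density big_geq//.
  by under eq_fun do rewrite big_geq//; exact: cvg_cst.
rewrite /prop_for /continuous_at /power_density.
under eq_fun do rewrite big_nat_recr//=.
rewrite big_nat_recr//=; apply: cvgD; first exact: IH.
by apply: cvgM; [exact: cvg_cst|exact: continuous_powR].
Qed.

Lemma lap_power_density m : (m <= n.+1)%N ->
  laplaceable mu D0 idfun (power_density m) /\
  forall z, 0 < complex.Re z -> lap mu D0 idfun (power_density m) z =
    \sum_(0 <= k < m) ((c k)%:C * cpow z (beta k)%:C)^-1.
Proof.
elim: m => [_|m IH mn].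
  have E : power_density 0 = fun=> 0 by apply/funext => x; rewrite /power_density big_geq.
  rewrite E; split=> [s s0|z z0].
    apply: (eq_integrable mD0 (fun=> 0%E)) => //; first by move=> x _; rewrite /= mul0r.
    exact: integrable0.
  rewrite big_geq// /lap /lapC /lapS.
  by under eq_Rintegral do rewrite mul0r; under [in X in _ +i* X]eq_Rintegral do rewrite mul0r;
    rewrite Rintegral_cst// mul0r oppr0.
have [lm lmE] := IH (ltnW mn).
have bm := exponent_gt0 mn.
have lg := laplaceable_gpow bm.
have E : power_density m.+1 = fun x => power_density m x + rgamma (beta m) / c m * gpow (beta m) x.
  by apply/funext => x; rewrite /power_density big_nat_recr.
rewrite E; split=> [|z z0]; first exact: laplaceableDZ.
rewrite lapDZ// lmE// big_nat_recr//=; congr (_ + _).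
rewrite lap_gpowE// rgammaE//.
have g0 := gamma_fun_gt0 bm.
rewrite mulrA -rmorphM/= mulrAC mulVf ?gt_eqF// mul1r invfM; congr (_ / _).
by rewrite fmorphV.
Qed.

(** Far away the bound is the assumption on $\rho$ at infinity; before that, monotonicity
   bounds $\rho$ by $\rho(s)$. *)
Lemma rho_power_bound s : r < s -> exists2 K, 0 <= K &
  forall t, s <= t -> rho t <= K * (1 + t) `^ (- (beta n + 1)).
Proof.
move=> rs; have s0 : 0 < s := lt_trans r0 rs.
have bn := exponent_gt0 (leqnn n).
have [N [_ hN]] : \forall t \near +oo, `|0 - rho t / t `^ (- 1 - beta n)| < 1.
  by move/cvgrPdist_lt : hrho_o => /(_ _ ltr01).
pose M := Num.max 1 (Num.max N s).
have M1 : 1 <= M by rewrite /M le_max lexx.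
have e0 : - (beta n + 1) = - 1 - beta n by ring.
pose K := (1 + M) `^ (beta n + 1) * rho s + 2 `^ (beta n + 1).
have rs0 := hrho_gt0 s0.
exists K; first by rewrite addr_ge0 ?mulr_ge0 ?powR_ge0// ltW.
move=> t st; have t0 : 0 < t := lt_le_trans s0 st.
have t1 : 0 < 1 + t by rewrite addr_gt0.
have p0 : 0 < (1 + t) `^ (- (beta n + 1)) by rewrite powR_gt0.
have pp : (1 + t) `^ (beta n + 1) * (1 + t) `^ (- (beta n + 1)) = 1.
  rewrite -powRD; last by rewrite (gt_eqF t1) implybT.
  by rewrite subrr powRr0.
have b1 : 0 <= beta n + 1 by rewrite addr_ge0// ltW.
have [tM|Mt] := leP t M.
  apply: (@le_trans _ _ ((1 + M) `^ (beta n + 1) * rho s * (1 + t) `^ (- (beta n + 1)))); last first.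
    by rewrite ler_wpM2r ?(ltW p0)// lerDl powR_ge0.
  rewrite mulrAC; apply: (@le_trans _ _ (1 * rho s)); first by rewrite mul1r hrho_mono.
  rewrite ler_wpM2r ?(ltW rs0)// -[leLHS]pp ler_wpM2r ?(ltW p0)//.
  apply: ge0_ler_powR; rewrite ?nnegrE ?(ltW t1) ?lerD2l//.
  by rewrite addr_ge0// (le_trans ler01).
have Nt : N < t by apply: le_lt_trans Mt; rewrite /M !le_max lexx !orbT.
have {hN} := hN _ Nt; rewrite sub0r normrN ger0_norm; last first.
  by rewrite divr_ge0 ?powR_ge0// ltW// hrho_gt0.
rewrite ltr_pdivrMr ?powR_gt0// mul1r => /ltW h; apply: (le_trans h).
apply: (@le_trans _ _ (2 `^ (beta n + 1) * (1 + t) `^ (- (beta n + 1)))); last first.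
  by rewrite ler_wpM2r ?(ltW p0)// lerDr mulr_ge0 ?powR_ge0// ltW.
rewrite -e0 !powRN -ler_pdivrMr; last by rewrite invr_gt0 powR_gt0.
rewrite invrK mulrC ler_pdivrMr ?powR_gt0//.
rewrite -(powRM _ (ler0n _ 2) (ltW t0)).
apply: ge0_ler_powR; rewrite ?nnegrE ?mulr_ge0 ?(ltW t0) ?(ltW t1)//.
by have := le_lt_trans M1 Mt; lra.
Qed.

(** A bound for $C\rho(|z|)$ at $z=s+iy$, as $|z|\ge\max(s,y)$. *)
Definition rho_floor (C s y : R) := C * rho (Num.max s y).

Lemma measurable_rho_floor C s : 0 < s ->
  measurable_fun [set: measurableTypeR R] (rho_floor C s).
Proof.
move=> s0; have [mr _ _] := hrho_loc.
apply: measurable_funM => //.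
pose h := rho \_ `[s, +oo[%classic.
have mh : measurable_fun [set: measurableTypeR R] h.
  apply/(measurable_restrictT _ _).1; first exact: measurable_itv.
  apply: measurable_funS mr; first exact: measurable_itv.
  by move=> x; rewrite /= !in_itv/= !andbT; exact: lt_le_trans.
rewrite (_ : (fun y => rho (Num.max s y)) = h \o (fun y => Num.max s y)).
  by apply: measurableT_comp => //; exact: measurable_maxr.
by apply/funext => y; rewrite /h /= patchE mem_set//= in_itv/= andbT le_max lexx.
Qed.

Lemma integrable_rho_floor C s : 0 <= C -> r < s ->
  mu.-integrable `[0, +oo[ (EFin \o rho_floor C s).
Proof.
move=> C0 rs; have s0 : 0 < s := lt_trans r0 rs.
have [K K0 hK] := rho_power_bound rs.
have i1 : mu.-integrable `[0, +oo[ (EFin \o (fun y => C * K * (1 + y) `^ (- (beta n + 1)))).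
  by apply: integrable_scale; [exact: measurable_itv|exact/integrable_powR_tail/exponent_gt0].
apply: le_integrable i1; first exact: measurable_itv.
  by apply/measurable_EFinP; apply: measurable_funTS; exact: measurable_rho_floor.
move=> y; rewrite /= in_itv/= andbT => y0; rewrite lee_fin.
have m0 : 0 < Num.max s y by rewrite lt_max s0.
rewrite /rho_floor ger0_norm ?mulr_ge0 ?(ltW (hrho_gt0 m0))//.
apply: le_trans (ler_norm _); rewrite -mulrA ler_wpM2l//.
apply: (le_trans (hK _ _)); first by rewrite le_max lexx.
have y1 : 0 < 1 + y by rewrite ltr_pwDl.
have ym : 0 < 1 + Num.max s y by rewrite addr_gt0.
have b1 : 0 <= beta n + 1 by rewrite addr_ge0// ltW// exponent_gt0.
rewrite ler_wpM2l// !powRN lef_pV2 ?posrE ?powR_gt0//.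
apply: ge0_ler_powR; rewrite ?nnegrE ?(ltW y1) ?(ltW ym)//.
by rewrite lerD2l le_max lexx orbT.
Qed.

Lemma integrable_rho s : r < s -> mu.-integrable `[s, +oo[ (EFin \o rho).
Proof.
move=> rs; have s0 : 0 < s := lt_trans r0 rs.
have i1 : mu.-integrable `[s, +oo[ (EFin \o rho_floor 1 s).
  apply: (integrableS mD) (integrable_rho_floor ler01 rs); first exact: measurable_itv.
  by move=> x; rewrite /= !in_itv/= !andbT; apply: le_trans; exact: ltW.
apply: eq_integrable i1; first exact: measurable_itv.
by move=> x; rewrite inE/= in_itv/= andbT => sx; rewrite /rho_floor max_r// mul1r.
Qed.

Lemma integral_rho_floor C s : 0 <= C -> r < s ->
  \int[mu]_(y in `[0, +oo[) rho_floor C s y =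
  C * (s * rho s + \int[mu]_(t in `[s, +oo[) rho t).
Proof.
move=> C0 rs; have s0 : 0 < s := lt_trans r0 rs.
have ii := integrable_rho_floor C0 rs.
have E : `[0, +oo[%classic = `[0, s[%classic `|` `[s, +oo[%classic :> set (measurableTypeR R).
  apply/seteqP; split=> x; rewrite /= !in_itv/= !andbT.
    by move=> ->; rewrite /=; case: (ltP x s); [left|right].
  by move=> [/andP[]|/(lt_le_trans s0)/ltW].
rewrite E in ii *; rewrite Rintegral_setU//; last first.
  apply/disj_setPS => x [] /=; rewrite !in_itv/= andbT => /andP[_ xs] sx.
  by move: (lt_le_trans xs sx); rewrite ltxx.
rewrite mulrDr; congr (_ + _).
  transitivity (\int[mu]_(x in `[0, s[) (C * rho s)).
    apply: eq_Rintegral => x; rewrite inE/= in_itv/= => /andP[_ xs].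
    by rewrite /rho_floor max_l// ltW.
  rewrite Rintegral_cst//.
  have h := lebesgue_measure_itv (`[0, s[ : interval R).
  rewrite /= lte_fin s0 -EFinB subr0 in h.
  rewrite (_ : fine _ = s); last exact: (congr1 fine h).
  by rewrite -mulrA (mulrC (rho s)).
rewrite -RintegralZl//; last exact: integrable_rho.
apply: eq_Rintegral => x; rewrite inE/= in_itv/= andbT => xs.
by rewrite /rho_floor max_r.
Qed.

Variables (U : {sigma_finite_measure set (measurableTypeR R) -> \bar R}) (Phi : R[i] -> R[i]).
Hypothesis lU : laplaceable U D idfun (fun=> 1).
Hypothesis lapU : forall z, 0 < complex.Re z -> lap U D idfun (fun=> 1) z = (Phi z)^-1.
Variables (C M : R).
Hypothesis C0 : 0 < C.
Hypothesis hPhi_O : forall z : R[i],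
       0 < complex.Re z -> M < ComplexField.Normc.normc z ->
       ComplexField.Normc.normc (cderiv (fun z => (Phi z)^-1 -
           \sum_(0 <= k < n.+1) ((c k)%:C * cpow z (beta k)%:C)^-1) z)
         <= C * rho (ComplexField.Normc.normc z).

Local Notation W := (power_density n.+1).

Let lW : laplaceable mu D0 idfun W. Proof. exact: (lap_power_density (leqnn _)).1. Qed.

Let derE z : 0 < complex.Re z ->
  cderiv (fun z => (Phi z)^-1 - \sum_(0 <= k < n.+1) ((c k)%:C * cpow z (beta k)%:C)^-1) z =
  lap mu D0 idfun (fun x => idfun x * W x) z - lap U D idfun (fun x => idfun x * 1) z.
Proof.
move=> z0.
have d1 := is_derive_lap mD midD id_ge0 lU z0 (fun z' z'0 => esym (lapU z'0)).
have d2 := is_derive_lap mD0 midD0 id_ge00 lW z0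
  (fun z' z'0 => esym ((lap_power_density (leqnn _)).2 _ z'0)).
have d3 := is_deriveB d1 d2.
rewrite /cderiv derive1E (_ : (fun z => _) = (fun z0 => (Phi z0)^-1) - (fun z0 => \sum_(0 <= k < n.+1) ((c k)%:C * cpow z0 (beta k)%:C)^-1))//.
by rewrite (@derive_val _ _ _ _ _ _ _ d3) opprK addrC.
Qed.

Let transform_bound s y : Num.max M r < s -> 0 <= y ->
  `|lapC U D idfun (fun x => idfun x * 1) s y - lapC mu D0 idfun (fun x => idfun x * W x) s y| <= rho_floor C s y /\
  `|lapS U D idfun (fun x => idfun x * 1) s y - lapS mu D0 idfun (fun x => idfun x * W x) s y| <= rho_floor C s y.
Proof.
rewrite gt_max => /andP[Ms rs] y0; have s0 : 0 < s := lt_trans r0 rs.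
pose z := s +i* y.
have zs : Num.max s y <= normc z.
  rewrite ge_max (le_trans (ler_norm _) (normr_Re_le z)).
  by rewrite (le_trans (ler_norm _) (normr_Im_le z)).
have sz : s <= normc z by apply: le_trans zs; rewrite le_max lexx.
have h : normc (lap mu D0 idfun (fun x => idfun x * W x) z - lap U D idfun (fun x => idfun x * 1) z) <= rho_floor C s y.
  rewrite -derE//; apply: (le_trans (hPhi_O _ _)) => //; first exact: lt_le_trans sz.
  by rewrite ler_wpM2l ?(ltW C0)// hrho_mono// lt_max rs.
split.
  by rewrite distrC; apply: le_trans h; apply: le_trans (normr_Re_le _).
apply: le_trans h; apply: le_trans (normr_Im_le _).
by rewrite /lap/= opprK addrC.
Qed.

Let density_at s : Num.max M r < s -> exists u : R -> R,
  [/\ forall x, 0 < x -> 0 <= u x,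
      forall x, 0 < x -> {for x, continuous u},
      forall A, measurable (A : set (measurableTypeR R)) -> A `<=` D0 ->
        U A = (\int[mu]_(x in A) (u x)%:E)%E &
      forall x, 0 < x -> `|u x - W x| <=
        expR (s * x) / x * (2 / pi * (C * (s * rho s + \int[mu]_(t in `[s, +oo[) rho t)))].
Proof.
move=> Ms; move: (Ms); rewrite gt_max => /andP[_ rs].
have s0 : 0 < s := lt_trans r0 rs.
have iH := integrable_rho_floor (ltW C0) rs.
have := @density_at_abscissa R U W (rho_floor C s) s s0 lU lW
  (fun x x0 => continuous_power_density (m := n.+1) x0) iH (fun y y0 => (transform_bound Ms y0).1) (fun y y0 => (transform_bound Ms y0).2).
by rewrite (integral_rho_floor (ltW C0) rs).
Qed.

Theorem potential_density_exists : exists u : R -> R,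
  [/\ forall x, 0 < x -> 0 <= u x,
      forall x, 0 < x -> {for x, continuous u} &
      forall A, measurable (A : set (measurableTypeR R)) -> A `<=` D0 ->
        U A = (\int[mu]_(x in A) (u x)%:E)%E].
Proof.
have Ms : Num.max M r < Num.max M r + 1 by rewrite ltrDl.
by have [u [? ? ? _]] := density_at Ms; exists u; split.
Qed.

(** The line of integration is free. At $\Re z=1/x$ the exponential $e^{sx}$ is a
   constant and the bound is a multiple of $\varepsilon_1(x)$; the densities found on different lines
   coincide, being continuous densities of one measure. *)
Theorem potential_density_asymptotics (u : R -> R) :
  (forall x, 0 < x -> 0 <= u x) ->
  (forall x, 0 < x -> {for x, continuous u}) ->
  (forall A, measurable (A : set (measurableTypeR R)) -> A `<=` D0 ->
        U A = (\int[mu]_(x in A) (u x)%:E)%E) ->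
  exists K x0, [/\ 0 < K, 0 < x0 & forall x, 0 < x < x0 -> `|u x - W x| <= K * eps1 rho x].
Proof.
move=> u_ge0 cu uE; pose m := Num.max M r.
have m0 : 0 < m by rewrite lt_max r0 orbT.
have p0 : 0 < pi :> R := pi_gt0 R.
(* For x < 1 / m the line Re z = 1 / x lies beyond M and r. *)
exists (expR 1 * (2 / pi * C)), m^-1; split.
- by rewrite !mulr_gt0 ?invr_gt0 ?expR_gt0.
- by rewrite invr_gt0.
move=> x /andP[x0 xm].
have Ms : m < x^-1 by rewrite -[m]invrK ltf_pV2 ?posrE ?invr_gt0.
have [u' [u'_ge0 cu' u'E /(_ x x0)]] := density_at Ms.
have -> : u' x = u x.
  apply: continuous_eq_from_integrals x0 => // a b a0 ab.
  have sab : `[a, b]%classic `<=` D0.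
    by move=> t; rewrite /= !in_itv/= andbT => /andP[at_ _]; exact: lt_le_trans at_.
  by rewrite /Rintegral -u'E ?uE//; exact: measurable_itv.
move/le_trans; apply; rewrite mulVf ?gt_eqF// /eps1.
rewrite (_ : x `^ (- 2) = x^-1 * x^-1); last by rewrite powR_invn ?(ltW x0)// expr2 invfM.
by rewrite le_eqVlt; apply/orP; left; apply/eqP; ring.
Qed.

End potential_density.

(** * Small-time means of polynomial functionals *)

Section smoothstep.
Context {R : realType}.
Implicit Types w v : R.

(** The polynomial $3w^2-2w^3$ fixes $0$, $\frac12$ and $1$ and has zero derivative at $0$ and $1$, so
   that its iterates tend to the indicator of $w>\frac12$ on $[0,1]$. *)
Definition smoothstep w : R := 3 * w ^+ 2 - 2 * w ^+ 3.

Lemma smoothstep_itv w : 0 <= w <= 1 -> 0 <= smoothstep w <= 1.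
Proof.
move=> /andP[w0 w1]; rewrite /smoothstep; apply/andP; split.
  have -> : 3 * w ^+ 2 - 2 * w ^+ 3 = w ^+ 2 * (1 + 2 * (1 - w)) by ring.
  by rewrite mulr_ge0 ?sqr_ge0//; lra.
rewrite -subr_ge0.
have -> : 1 - (3 * w ^+ 2 - 2 * w ^+ 3) = (1 - w) ^+ 2 * (1 + 2 * w) by ring.
by rewrite mulr_ge0 ?sqr_ge0//; lra.
Qed.

Lemma smoothstep_sym w : smoothstep (1 - w) = 1 - smoothstep w.
Proof. by rewrite /smoothstep; ring. Qed.

Definition step n w : R := iter n.+1 smoothstep w.

Lemma step_itv n w : 0 <= w <= 1 -> 0 <= step n w <= 1.
Proof. by move=> w01; elim: n => [|n IH]; exact: smoothstep_itv. Qed.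

Lemma step_sym n w : step n (1 - w) = 1 - step n w.
Proof.
elim: n => [|n IH]; first exact: smoothstep_sym.
by rewrite /step iterS -/(step n _) IH smoothstep_sym.
Qed.

(** Below $\frac12$ every iteration contracts by $3t_0-2t_0^2<1$. The first iteration is
   used instead to gain the factor $w^2$, which the Levy measure integrates. *)
Lemma step_small (n : nat) w t0 : 0 <= w -> w <= t0 -> t0 <= 2^-1 ->
  step n w <= (3 * t0 - 2 * t0 ^+ 2) ^+ n * (3 * w ^+ 2) /\ step n w <= t0.
Proof.
move=> w0 wt t12.
have h0 : 0 <= 3 * t0 - 2 * t0 ^+ 2 by nra.
have key v : 0 <= v -> v <= t0 -> smoothstep v <= (3 * t0 - 2 * t0 ^+ 2) * v /\ smoothstep v <= t0.
  move=> v0 vt; have h1 : smoothstep v <= (3 * t0 - 2 * t0 ^+ 2) * v.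
    have -> : smoothstep v = (3 * v - 2 * v ^+ 2) * v by rewrite /smoothstep; ring.
    by rewrite ler_wpM2r//; nra.
  split=> //; apply: (le_trans h1); apply: (le_trans _ vt).
  have h2 : 0 <= (1 - t0) * (1 - 2 * t0) by rewrite mulr_ge0// subr_ge0; lra.
  by rewrite ler_piMl//; nra.
elim: n => [|n [IH1 IH2]].
  rewrite expr0 mul1r; split; last by have [] := key w w0 wt.
  by rewrite /step /= /smoothstep gerBl mulr_ge0// exprn_ge0.
have s0 : 0 <= step n w.
  by have /andP[] : 0 <= step n w <= 1; [apply: step_itv; apply/andP; split=> //; lra|].
have [k1 k2] := key _ s0 IH2.
rewrite /step iterS -/(step n w); split=> //; apply: (le_trans k1).
by rewrite [_ ^+ n.+1]exprS -mulrA ler_wpM2l.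
Qed.

(** The quotient of the iterate by $w^2$. *)
Fixpoint step_poly n : {poly R} :=
  if n is m.+1 then 'X^2 * step_poly m ^+ 2 * (3%:P - 2%:P * ('X^2 * step_poly m))
  else 3%:P - 2%:P * 'X.

Lemma step_polyE n w : step n w = w ^+ 2 * (step_poly n).[w].
Proof.
elim: n => [|n IH]; first by rewrite /step /= /smoothstep !(hornerD, hornerN, hornerM, hornerC, hornerX); ring.
have -> : step_poly n.+1 = 'X^2 * step_poly n ^+ 2 * (3%:P - 2%:P * ('X^2 * step_poly n)) by [].
rewrite /step iterS -/(step n w) IH /smoothstep !(hornerD, hornerN, hornerM, hornerC, hornerX); ring.
Qed.

End smoothstep.

Section tame.
Context d (T : measurableType d) (R : realType) (P : probability T R).
Variables (Y : R -> T -> R) (zeta : T -> \bar R).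
Hypothesis mY : forall t, 0 <= t -> measurable_fun setT (Y t).
Hypothesis Y0 : forall w, Y 0 w = 0.
Hypothesis ndY : forall w t t', 0 <= t -> t <= t' -> Y t w <= Y t' w.
Hypothesis mzeta : measurable_fun setT zeta.
Variables (phi : R -> R) (a b : R) (Pi : {measure set R -> \bar R}).
Local Notation D := (`]0%R, +oo[%classic : set R).
Hypothesis killed_exp : forall p t, 0 <= p -> 0 <= t ->
  \int[P]_(w in alive_at zeta t) expR (- (p * Y t w)) = expR (- (phi p * t)).
Hypothesis ie : forall p, 0 <= p -> Pi.-integrable D (EFin \o (fun x => 1 - expR (- (p * x)))).
Hypothesis phiE : forall p, 0 <= p -> phi p = a + b * p + \int[Pi]_(x in D) (1 - expR (- (p * x))).

Let mD : measurable D. Proof. exact: measurable_itv. Qed.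

Definition time n : R := n.+1%:R^-1.
Lemma time_gt0 n : 0 < time n. Proof. by rewrite invr_gt0. Qed.
Let time_ge0 n : 0 <= time n := ltW (time_gt0 n).

Definition killed_mean (f : R -> R) n : R := \int[P]_(w in alive_at zeta (time n)) f (Y (time n) w).

Definition bounded_nneg (f : R -> R) := measurable_fun [set: R] f /\ exists K, forall x, 0 <= x -> `|f x| <= K.

Lemma integrable_killed f n : bounded_nneg f ->
  P.-integrable (alive_at zeta (time n)) (EFin \o (fun w => f (Y (time n) w))).
Proof.
move=> [mf [K fK]]; apply: measurable_bounded_integrable.
- exact: measurable_alive_at.
- by apply: le_lt_trans (ltry 1); exact/probability_le1/measurable_alive_at.
- by apply: measurable_funTS; exact: measurableT_comp (mY (time_ge0 n)).
- exists K; split; [exact: num_real|] => x Kx w _; apply: (le_trans _ (ltW Kx)).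
  by apply: fK; exact: (path_ge0 Y0 ndY).
Qed.

(** Functions for which $nE[f(X_{1/n});1/n<\zeta]\to\int f\,d\Pi$. *)
Definition tame (f : R -> R) := [/\ bounded_nneg f, Pi.-integrable D (EFin \o f) &
  n.+1%:R * killed_mean f n @[n --> \oo] --> \int[Pi]_(x in D) f x].

Lemma tame_addZ f g k : tame f -> tame g -> tame (fun x => f x + k * g x).
Proof.
move=> [bf jf cf] [bg jg cg].
have [mf [K fK]] := bf; have [mg [L gL]] := bg.
have ikg := integrable_scale k mD jg.
split.
- split; first by apply: measurable_funD => //; exact: measurable_funM.
  exists (K + `|k| * L) => x x0; apply: (le_trans (ler_normD _ _)).
  by rewrite normrM lerD ?fK// ler_wpM2l// gL.
- by have := integrableD mD jf ikg; apply: eq_integrable.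
- rewrite RintegralD// RintegralZl//.
  rewrite (_ : (fun n => _) = fun n => n.+1%:R * killed_mean f n + k * (n.+1%:R * killed_mean g n)).
    by apply: cvgD => //; apply: cvgM => //; exact: cvg_cst.
  apply/funext => n; rewrite /killed_mean.
  have mA : measurable (alive_at zeta (time n)) by exact: measurable_alive_at.
  have i1 := integrable_killed n bf; have i2 := integrable_killed n bg.
  rewrite RintegralD// ?RintegralZl//; first by ring.
  exact: integrable_scale.
Qed.

Lemma cvg_exp_quotient (c : R) : n.+1%:R * (expR (- (c * time n)) - 1) @[n --> \oo] --> - c.
Proof.
have h n : `|n.+1%:R * (expR (- (c * time n)) - 1) - (- c)| <= c ^+ 2 * expR `|c| * time n.
  have t0 := time_gt0 n.
  have hh := normr_expRB1B_le (- (c * time n)); rewrite opprK in hh; rewrite opprK.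
  have tn : n.+1%:R * time n = 1 :> R by rewrite /time mulfV.
  have -> : n.+1%:R * (expR (- (c * time n)) - 1) + c =
     n.+1%:R * (expR (- (c * time n)) - 1 + c * time n).
    by rewrite [RHS]mulrDr (mulrCA _ c) tn mulr1.
  rewrite normrM ger0_norm//.
  apply: (le_trans (ler_wpM2l (ler0n _ _) hh)).
  rewrite sqrrN exprMn (_ : n.+1%:R * (c ^+ 2 * time n ^+ 2 * expR `|- (c * time n)|) =
     (n.+1%:R * time n) * (c ^+ 2 * time n * expR `|- (c * time n)|)); last by ring.
  rewrite tn mul1r mulrAC ler_wpM2r ?(ltW t0)// ler_wpM2l ?sqr_ge0// ler_expR normrN normrM.
  by rewrite (ger0_norm (ltW t0)) ler_piMr// invf_le1// ler1n.
apply/subr_cvg0/norm_cvg0P.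
apply: (@squeeze_cvgr _ _ _ _ (fun=> 0) (fun n => c ^+ 2 * expR `|c| * time n)).
- by apply: nearW => n; rewrite normr_ge0 h.
- exact: cvg_cst.
- rewrite -(mulr0 (c ^+ 2 * expR `|c|)); apply: cvgM; first exact: cvg_cst.
  exact: cvg_harmonic.
Qed.

Section monomials.
Variable lam : R.
Hypothesis lam0 : 0 < lam.
Let w x : R := 1 - expR (- (lam * x)).

Lemma measurable_expM (c : R) : measurable_fun [set: R] (fun x : R => expR (- (c * x))).
Proof.
apply: continuous_measurable_fun => x.
apply: (continuous_comp (f := fun x => - (c * x))); last exact: continuous_expR.
by apply: cvgN; apply: cvgM; [exact: cvg_cst|exact: cvg_id].
Qed.

Let expM_itv (c x : R) : 0 <= c -> 0 <= x -> 0 <= expR (- (c * x)) <= 1.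
Proof. by move=> c0 x0; rewrite expR_ge0 -expR0 ler_expR oppr_le0 mulr_ge0. Qed.

Lemma w_itv x : 0 <= x -> 0 <= w x <= 1.
Proof. by move=> /(expM_itv (ltW lam0)); rewrite /w => /andP[? ?]; apply/andP; split; lra. Qed.

Let mono (m : nat) (p x : R) := w x ^+ m * expR (- (p * x)).

Let mono_bounded m p : 0 <= p -> bounded_nneg (mono m p).
Proof.
move=> p0; split.
  apply: measurable_funM; last exact: measurable_expM.
  by apply: measurable_funX; apply: measurable_funB => //; exact: measurable_expM.
exists 1 => x x0; have /andP[w0 w1] := w_itv x0; have /andP[e0 e1] := expM_itv p0 x0.
by rewrite ger0_norm ?mulr_ge0 ?exprn_ge0// mulr_ile1 ?exprn_ge0// exprn_ile1.
Qed.

Let mono_integrable m p : 0 <= p -> Pi.-integrable D (EFin \o mono m.+1 p).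
Proof.
move=> p0; apply: le_integrable (ie (ltW lam0)) => //.
  by apply/measurable_EFinP; apply: measurable_funTS; have [] := mono_bounded m.+1 p0.
move=> x; rewrite /= in_itv/= andbT => x0; rewrite lee_fin.
have /andP[w0 w1] := w_itv (ltW x0); have /andP[e0 e1] := expM_itv p0 (ltW x0).
rewrite !ger0_norm ?mulr_ge0 ?exprn_ge0// /mono exprS -mulrA ler_piMr//.
by rewrite mulr_ile1 ?exprn_ge0// exprn_ile1.
Qed.

Let monoS m p x : mono m.+1 p x = mono m p x + (-1) * mono m (p + lam) x.
Proof.
have -> : mono m (p + lam) x = mono m p x * expR (- (lam * x)).
  by rewrite /mono -mulrA -expRD; congr (_ * expR _); ring.
by rewrite /mono exprS /w; ring.
Qed.

Let killed_mean_lin (f g : R -> R) k n : bounded_nneg f -> bounded_nneg g ->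
  killed_mean (fun x => f x + k * g x) n = killed_mean f n + k * killed_mean g n.
Proof.
move=> bf bg.
have mA : measurable (alive_at zeta (time n)) by exact: measurable_alive_at.
have i1 := integrable_killed n bf; have i2 := integrable_killed n bg.
rewrite /killed_mean RintegralD// ?RintegralZl//.
exact: integrable_scale.
Qed.

(** The function $w^me^{-px}$ is a difference of order $m$ of exponentials in $p$, and
   $n(E[e^{-pX_{1/n}}]-1)\to-\Phi(p)$. The killing rate and the drift are affine in $p$: the former
   disappears with the first difference and the latter with the second. *)
Let mono_cvg m p : 0 <= p ->
  n.+1%:R * killed_mean (mono m.+1 p) n @[n --> \oo] -->
  (m == 0)%:R * (b * lam) + \int[Pi]_(x in D) mono m.+1 p x.
Proof.
have KS m' p' n : 0 <= p' -> killed_mean (mono m'.+1 p') n =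
    killed_mean (mono m' p') n - killed_mean (mono m' (p' + lam)) n.
  move=> p0; rewrite -mulN1r -killed_mean_lin.
  - by apply: eq_Rintegral => v _; exact: monoS.
  - exact: mono_bounded.
  - by apply: mono_bounded; rewrite addr_ge0// ltW.
elim: m p => [|m IH] p p0; have pl0 : 0 <= p + lam by rewrite addr_ge0// ltW.
  have K0 p' n : 0 <= p' -> killed_mean (mono 0 p') n = expR (- (phi p' * time n)).
    move=> p'0; rewrite -killed_exp//.
    by apply: eq_Rintegral => v _; rewrite /mono expr0 mul1r.
  have -> : (0 == 0)%N%:R * (b * lam) + \int[Pi]_(x in D) mono 1 p x = - phi p - - phi (p + lam).
    rewrite mul1r !phiE// [in X in _ = _ - - X]mulrDr.
    have -> : \int[Pi]_(x in D) mono 1 p x = \int[Pi]_(x in D) (1 - expR (- ((p + lam) * x))) -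
        \int[Pi]_(x in D) (1 - expR (- (p * x))).
      rewrite -RintegralB//; try exact: ie.
      apply: eq_Rintegral => x _; rewrite monoS /mono expr0 !mul1r; ring.
    ring.
  rewrite (_ : (fun n => _) = fun n => n.+1%:R * (expR (- (phi p * time n)) - 1) -
      n.+1%:R * (expR (- (phi (p + lam) * time n)) - 1)).
    by apply: cvgB; exact: cvg_exp_quotient.
  by apply/funext => n; rewrite KS// !K0//; ring.
have -> : (m.+1 == 0)%N%:R * (b * lam) + \int[Pi]_(x in D) mono m.+2 p x =
   ((m == 0)%:R * (b * lam) + \int[Pi]_(x in D) mono m.+1 p x) -
   ((m == 0)%:R * (b * lam) + \int[Pi]_(x in D) mono m.+1 (p + lam) x).
  have -> : \int[Pi]_(x in D) mono m.+2 p x = \int[Pi]_(x in D) mono m.+1 p x -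
      \int[Pi]_(x in D) mono m.+1 (p + lam) x.
    rewrite -RintegralB//; try exact: mono_integrable.
    by apply: eq_Rintegral => x _; rewrite monoS; ring.
  by rewrite mul0r add0r; ring.
rewrite (_ : (fun n => _) = fun n => n.+1%:R * killed_mean (mono m.+1 p) n -
    n.+1%:R * killed_mean (mono m.+1 (p + lam)) n).
  by apply: cvgB; exact: IH.
by apply/funext => n; rewrite KS//; ring.
Qed.

Lemma tame_power m : tame (fun x => w x ^+ m.+2).
Proof.
have E : (fun x => w x ^+ m.+2) = mono m.+2 0.
  by apply/funext => x; rewrite /mono mul0r oppr0 expR0 mulr1.
rewrite E; split; [exact: mono_bounded|exact: mono_integrable|].
by have := @mono_cvg m.+1 0 (lexx _); rewrite mul0r add0r.
Qed.

Lemma tame_poly (q : {poly R}) : tame (fun x => w x ^+ 2 * q.[w x]).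
Proof.
suff H : forall j, tame (fun x => w x ^+ j.+2 * q.[w x]) by exact: (H 0%N).
elim/poly_ind: q => [|q c IH] j.
  have -> : (fun x => w x ^+ j.+2 * 0.[w x]) = (fun x => w x ^+ j.+2 + (-1) * w x ^+ j.+2).
    by apply/funext => x; rewrite horner0; ring.
  by apply: tame_addZ; exact: tame_power.
have -> : (fun x => w x ^+ j.+2 * (q * 'X + c%:P).[w x]) =
    (fun x => w x ^+ j.+3 * q.[w x] + c * w x ^+ j.+2).
  by apply/funext => x; rewrite hornerMXaddC [_ ^+ j.+3]exprS; ring.
by apply: tame_addZ; [exact: IH|exact: tame_power].
Qed.

(** The iterate has a double zero at $0$, so it is a combination of powers $w^m$ with $m\ge2$. *)
Lemma tame_step m : tame (fun x => step m (w x)).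
Proof.
rewrite (_ : (fun x => _) = (fun x => w x ^+ 2 * (step_poly m).[w x])); first exact: tame_poly.
by apply/funext => x; exact: step_polyE.
Qed.

End monomials.

End tame.

(** * The Levy tail as a small-time limit *)

Section step_between.
Context {R : realType}.

(** The rate is chosen such that $w=\frac12$ at the midpoint of $r_0$ and $r_1$; the iterates then
   separate the two points. The errors carry the factor $w^2$ so as to be integrable for the
   Levy measure. *)
Lemma step_between (r0 r1 : R) : 0 < r0 -> r0 < r1 -> exists lam th : R,
  [/\ 0 < lam, 0 <= th < 1 & forall m x, 0 <= x -> let w := 1 - expR (- (lam * x)) in
    step m w <= \1_(`]r0, +oo[%classic) x + 3 * th ^+ m * w ^+ 2 /\
    \1_(`[r1, +oo[%classic) x <= step m w + 12 * th ^+ m * w ^+ 2].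
Proof.
move=> r00 r01; pose c : R := (r0 + r1) / 2.
have r0c : r0 < c by rewrite /c; lra.
have cr1 : c < r1 by rewrite /c; lra.
have c0 : 0 < c by lra.
have l20 : 0 < ln 2 :> R by rewrite ln_gt0// ltr1n.
(* This rate gives w c = 1 - exp (- ln 2) = 1 / 2. *)
pose lam : R := ln 2 / c; have lam0 : 0 < lam by rewrite divr_gt0.
have lc : lam * c = ln 2 by rewrite /lam mulfVK// gt_eqF.
pose w (x : R) := 1 - expR (- (lam * x)).
have wle x y : x <= y -> w x <= w y.
  by move=> xy; rewrite lerD2l lerN2 ler_expR lerN2 ler_wpM2l// ltW.
have wlt x y : x < y -> w x < w y.
  by move=> xy; rewrite ltrD2l ltrN2 ltr_expR ltrN2 ltr_pM2l.
have wc : w c = 2^-1.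
  rewrite /w lc expRN lnK ?posrE//; lra.
have w0 : w 0 = 0 by rewrite /w mulr0 oppr0 expR0 subrr.
have wx0 x : 0 <= x -> 0 <= w x by rewrite -{2}w0; exact: wle.
have wx1 x : w x <= 1 by rewrite gerBl expR_ge0.
pose t0 := Num.max (w r0) (1 - w r1).
have t0h : t0 < 2^-1 by rewrite gt_max -wc wlt//= wc; have := wlt _ _ cr1; rewrite wc; lra.
have t00 : 0 <= t0 by rewrite le_max wx0// ltW.
pose th := 3 * t0 - 2 * t0 ^+ 2.
have th01 : 0 <= th < 1 by rewrite /th; apply/andP; split; nra.
have th0 m : 0 <= th ^+ m by rewrite exprn_ge0//; have /andP[] := th01.
exists lam, th; split=> // m x x0; rewrite -/(w x) /=.
have sx := step_itv m (w := w x); rewrite wx0// wx1 in sx; have /andP[s0 s1] := sx isT.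
split.
  rewrite indicE; have [xr|xr] := leP x r0.
    rewrite memNset ?add0r; last by rewrite /= in_itv/= andbT => /(le_lt_trans xr); rewrite ltxx.
    have wt : w x <= t0 by rewrite le_max wle.
    have [h _] := step_small m (wx0 _ x0) wt (ltW t0h).
    by rewrite -mulrA mulrCA.
  rewrite mem_set; last by rewrite /= in_itv/= andbT.
  have h3 : 0 <= 3 * th ^+ m * w x ^+ 2 by rewrite mulr_ge0 ?sqr_ge0// mulr_ge0.
  by rewrite /= mulr1n; lra.
rewrite indicE; have [rx|rx] := leP r1 x; last first.
  rewrite memNset; last by rewrite /= in_itv/= andbT => /(lt_le_trans rx); rewrite ltxx.
  have h3 : 0 <= 12 * th ^+ m * w x ^+ 2 by rewrite mulr_ge0 ?sqr_ge0// mulr_ge0.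
  by rewrite /= mulr0n; lra.
rewrite mem_set /= ?mulr1n; last by rewrite /= in_itv/= andbT.
have v0 : 0 <= 1 - w x by rewrite subr_ge0.
have vt : 1 - w x <= t0.
  by rewrite le_max; apply/orP; right; rewrite lerD2l lerN2; exact: wle.
have [h _] := step_small m v0 vt (ltW t0h).
have wh : 2^-1 <= w x by rewrite -wc wle// (le_trans (ltW cr1)).
move: h; rewrite step_sym -/th => h.
(* Above r1 the estimate of 1 - step is quadratic in 1 - w; as w >= 1 / 2, (1 - w)^2 <= 4 w^2. *)
have h1 : 3 * (1 - w x) ^+ 2 <= 12 * w x ^+ 2 by have := wx1 x; nra.
have h2 : th ^+ m * (3 * (1 - w x) ^+ 2) <= th ^+ m * (12 * w x ^+ 2) by rewrite ler_wpM2l.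
rewrite (_ : 12 * th ^+ m * w x ^+ 2 = th ^+ m * (12 * w x ^+ 2)); last by ring.
lra.
Qed.

End step_between.

Section killed_tail.
Context d (T : measurableType d) (R : realType) (P : probability T R).
Variables (Y : R -> T -> R) (zeta : T -> \bar R).
Hypothesis mY : forall t, 0 <= t -> measurable_fun setT (Y t).
Hypothesis Y0 : forall w, Y 0 w = 0.
Hypothesis ndY : forall w t t', 0 <= t -> t <= t' -> Y t w <= Y t' w.
Hypothesis mzeta : measurable_fun setT zeta.
Variables (phi : R -> R) (a b : R) (Pi : {measure set R -> \bar R}).
Local Notation D := (`]0%R, +oo[%classic : set R).
Hypothesis killed_exp : forall p t, 0 <= p -> 0 <= t ->
  \int[P]_(w in alive_at zeta t) expR (- (p * Y t w)) = expR (- (phi p * t)).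
Hypothesis ie : forall p, 0 <= p -> Pi.-integrable D (EFin \o (fun x => 1 - expR (- (p * x)))).
Hypothesis phiE : forall p, 0 <= p -> phi p = a + b * p + \int[Pi]_(x in D) (1 - expR (- (p * x))).
Hypothesis Pi_fin : forall x, 0 < x -> (Pi `]x, +oo[%classic < +oo)%E.

Let mD : measurable D. Proof. exact: measurable_itv. Qed.
Local Notation time := (@time R).
Local Notation KM := (killed_mean P Y zeta).
Local Notation tame := (tame P Y zeta Pi).
Local Notation alive n := (alive_at zeta (time n)).
Let time_ge0 n : 0 <= time n.
Proof. by rewrite invr_ge0. Qed.

Let mA n : measurable (alive n). Proof. exact: measurable_alive_at. Qed.

Definition killed_law (t : R) (A : set R) : R := fine (P (alive_at zeta t `&` Y t @^-1` A)).

Let killed_lawE n A : measurable A -> killed_law (time n) A = KM (\1_A) n.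
Proof.
move=> mSA; rewrite /killed_law /killed_mean /Rintegral.
have -> : (fun w => (\1_A (Y (time n) w))%:E) = (fun w => (\1_(Y (time n) @^-1` A) w)%:E) by [].
rewrite integral_indic//; first by rewrite setIC.
by apply: measurable_preimage => //; exact: mY.
Qed.

Let indic_bounded A : measurable A -> bounded_nneg (\1_A : R -> R).
Proof.
move=> mSA; split; first exact: measurable_indic.
by exists 1 => x _; rewrite indicE; case: (_ \in _); rewrite ?normr1 ?normr0.
Qed.

Let KM_le f g n : bounded_nneg f -> bounded_nneg g ->
  (forall x, 0 <= x -> f x <= g x) -> KM f n <= KM g n.
Proof.
move=> bf bg fg; apply: le_Rintegral => //.
- exact: (integrable_killed P mY Y0 ndY mzeta n).
- exact: (integrable_killed P mY Y0 ndY mzeta n).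
- by move=> w _; apply: fg; exact: (path_ge0 Y0 ndY).
Qed.

Let tailE r : 0 < r -> Pi.-integrable D (EFin \o (\1_(`]r, +oo[%classic) : R -> R)) /\
  \int[Pi]_(x in D) \1_(`]r, +oo[%classic) x = levy_tail Pi r.
Proof.
move=> r0.
have sD : `]r, +oo[%classic `&` D = `]r, +oo[%classic.
  by apply/setIidPl => x; rewrite /= !in_itv/= !andbT; exact: lt_trans.
have E : (\int[Pi]_(x in D) (\1_(`]r, +oo[%classic) x)%:E)%E = Pi `]r, +oo[%classic.
  by rewrite integral_indic// sD.
split; last by rewrite /Rintegral E.
apply/integrableP; split; first exact/measurable_EFinP/measurable_funTS/measurable_indic.
rewrite (_ : (\int[Pi]_(x in D) _)%E = Pi `]r, +oo[%classic); first exact: Pi_fin.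
by rewrite -E; apply: eq_integral => x _; rewrite /= ger0_norm// indicE.
Qed.

Let eventually_small (th B e : R) : 0 <= th < 1 -> 0 < e -> exists m, 15 * th ^+ m * B <= e.
Proof.
move=> /andP[th0 th1] e0.
have h : 15 * th ^+ m * B @[m --> \oo] --> (0 : R).
  rewrite -[X in _ --> X](mul0r B) -(mulr0 15).
  apply: cvgM; last exact: cvg_cst.
  apply: cvgM; first exact: cvg_cst.
  by apply: cvg_expr; rewrite ger0_norm.
have [N _ hN] := cvgr_le _ h _ e0.
by exists N; apply: hN => /=.
Qed.

(** The indicator of $[r_1,\infty)$ is at most a tame function whose integral for the Levy measure
   exceeds that of the indicator of $(r_0,\infty)$ by as little as desired. *)
Lemma killed_tail_le (r0 r1 e : R) : 0 < r0 -> r0 < r1 -> 0 < e ->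
  \forall n \near \oo, n.+1%:R * killed_law (time n) `[r1, +oo[ <= levy_tail Pi r0 + e.
Proof.
move=> r00 r01 e0; have [lam [th [lam0 th01 H]]] := step_between r00 r01.
pose w x := 1 - expR (- (lam * x)); pose B := \int[Pi]_(x in D) (w x ^+ 2).
have [m hm] := eventually_small B th01 (divr_gt0 e0 (ltr0n _ 2)).
have ts := tame_step mY Y0 ndY mzeta killed_exp ie phiE lam0 m.
have tw := tame_power mY Y0 ndY mzeta killed_exp ie phiE lam0 0.
have tf := tame_addZ mY Y0 ndY mzeta (12 * th ^+ m) ts tw.
have [bf jf cf] := tf; have [_ js _] := ts; have [_ jw _] := tw.
have [jt tE] := tailE r00.
have If : \int[Pi]_(x in D) (step m (w x) + 12 * th ^+ m * w x ^+ 2) <= levy_tail Pi r0 + e / 2.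
  apply: (le_trans _ (lerD (lexx _) hm)).
  rewrite -tE /B -RintegralZl// -RintegralD//; last exact: integrable_scale.
  apply: le_Rintegral => //.
    have := integrableD mD jt (integrable_scale (15 * th ^+ m) mD jw).
    by apply: eq_integrable.
  move=> x; rewrite /= in_itv/= andbT => x0.
  have [h _] := H m x (ltW x0); rewrite -/(w x) in h.
  by move: h; rewrite -lerBlDr; lra.
have lt_e : \int[Pi]_(x in D) (step m (w x) + 12 * th ^+ m * w x ^+ 2) < levy_tail Pi r0 + e by lra.
move: cf => /(@cvgr_le _ _ _ _ _ _)/(_ _ lt_e); apply: filterS => n; apply: le_trans.
rewrite ler_wpM2l// killed_lawE; last exact: measurable_itv.
apply: KM_le => //; first by apply: indic_bounded; exact: measurable_itv.
by move=> x x0; have [_ h] := H m x x0.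
Qed.

Lemma killed_tail_ge (r0 r1 e : R) : 0 < r0 -> r0 < r1 -> 0 < e ->
  \forall n \near \oo, levy_tail Pi r1 - e <= n.+1%:R * killed_law (time n) `]r0, +oo[.
Proof.
move=> r00 r01 e0; have [lam [th [lam0 th01 H]]] := step_between r00 r01.
pose w x := 1 - expR (- (lam * x)); pose B := \int[Pi]_(x in D) (w x ^+ 2).
have [m hm] := eventually_small B th01 (divr_gt0 e0 (ltr0n _ 2)).
have ts := tame_step mY Y0 ndY mzeta killed_exp ie phiE lam0 m.
have tw := tame_power mY Y0 ndY mzeta killed_exp ie phiE lam0 0.
have tf := tame_addZ mY Y0 ndY mzeta (- (3 * th ^+ m)) ts tw.
have [bf jf cf] := tf; have [_ js _] := ts; have [_ jw _] := tw.
have [jt tE] := tailE (lt_trans r00 r01).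
have If : levy_tail Pi r1 - e / 2 <= \int[Pi]_(x in D) (step m (w x) + - (3 * th ^+ m) * w x ^+ 2).
  apply: (le_trans (lerD (lexx _) (_ : - (e / 2) <= - (15 * th ^+ m * B)))); first by rewrite lerN2.
  rewrite -tE /B -mulNr -RintegralZl// -RintegralD//; last exact: integrable_scale.
  apply: le_Rintegral => //.
    have := integrableD mD jt (integrable_scale (- (15 * th ^+ m)) mD jw).
    by apply: eq_integrable.
  move=> x; rewrite /= in_itv/= andbT => x0.
  have [_ h] := H m x (ltW x0); rewrite -/(w x) in h.
  have i01 : \1_(`]r1, +oo[%classic) x <= \1_(`[r1, +oo[%classic) x :> R.
    rewrite !indicE; case: (boolP (x \in `]r1, +oo[%classic)) => [|_]; last by rewrite ler0n.
    by rewrite inE/= in_itv/= andbT => h1; rewrite mem_set//= in_itv/= andbT ltW.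
  lra.
have lt_e : levy_tail Pi r1 - e < \int[Pi]_(x in D) (step m (w x) + - (3 * th ^+ m) * w x ^+ 2) by lra.
move: cf => /(@cvgr_ge _ _ _ _ _ _)/(_ _ lt_e); apply: filterS => n /le_trans; apply.
rewrite ler_wpM2l// killed_lawE; last exact: measurable_itv.
apply: KM_le => //; first by apply: indic_bounded; exact: measurable_itv.
move=> x x0; have [h _] := H m x x0; rewrite -/(w x) in h *.
by rewrite mulNr lerBlDr.
Qed.

End killed_tail.

(** * The process along a time grid *)

Section integral_test.
Context {R : realType}.
Notation mu := (@lebesgue_measure R).
Variables (N : R -> R) (h : R).
Hypothesis Nni : {homo N : m n /~ n <= m}.
Hypothesis N01 : forall t, 0 <= N t <= 1.
Hypothesis h0 : 0 < h.

Let F (k : nat) : set (measurableTypeR R) := `[k%:R * h, k.+1%:R * h[%classic.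
Let mF k : measurable (F k). Proof. exact: measurable_itv. Qed.

Let bigF : \bigcup_k F k = `[0%R, +oo[%classic.
Proof.
apply/seteqP; split=> x /=.
  by move=> [k _]; rewrite /F/= !in_itv/= andbT => /andP[+ _]; apply: le_trans; rewrite mulr_ge0// ltW.
rewrite in_itv/= andbT => x0; exists (Num.truncn (x / h)) => //=.
have /truncn_itv/andP[a1 a2] : 0 <= x / h by rewrite divr_ge0// ltW.
by rewrite /F/= in_itv/= -ler_pdivlMr// a1 -ltr_pdivrMr.
Qed.

Let trivF : trivIset setT F.
Proof.
apply: ltn_trivIset => n m nm; apply/seteqP; split=> // x [] /=.
rewrite /F/= !in_itv/= => /andP[_ x1] /andP[x2 _].
have h1 : m.+1%:R * h <= n%:R * h by rewrite ler_pM2r// ler_nat.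
by move: (lt_le_trans (le_lt_trans x2 x1) h1); rewrite ltxx.
Qed.

Let mN (A : set (measurableTypeR R)) : measurable A -> measurable_fun A (EFin \o N).
Proof. by move=> mA; apply/measurable_EFinP; apply: nonincreasing_measurable. Qed.

Let mU : measurable_fun (\bigcup_k F k) (EFin \o N).
Proof. by rewrite bigF; apply: mN; exact: measurable_itv. Qed.

Let N0 t : (0 <= (N t)%:E)%E. Proof. by rewrite lee_fin; have /andP[] := N01 t. Qed.

Let muF k : mu (F k) = h%:E.
Proof.
have := lebesgue_measure_itv (`[k%:R * h, k.+1%:R * h[ : interval R).
rewrite /= lte_fin ltr_pM2r// ltr_nat ltnSn -EFinB -mulrBl -natrB//.
by rewrite subSnn mul1r.
Qed.

Let cstF (x : R) k : (\int[mu]_(t in F k) x%:E = h%:E * x%:E)%E.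
Proof. by rewrite integral_cst// muleC; congr (_ * _)%E; exact: muF. Qed.

Let I0 k : (0 <= \int[mu]_(t in F k) (N t)%:E)%E. Proof. exact: integral_ge0. Qed.

Lemma integral_le_riemann :
  (\int[mu]_(t in `[0%R, +oo[) (N t)%:E <= h%:E * \sum_(0 <= k <oo) (N (k%:R * h)%R)%:E)%E.
Proof.
rewrite -nneseriesZl// -bigF ge0_integral_bigcup//.
apply: lee_nneseries => // k _.
apply: (@le_trans _ _ (\int[mu]_(t in F k) (N (k%:R * h)%R)%:E)%E).
  apply: ge0_le_integral => //; first exact: mN.
  by move=> t; rewrite /F/= in_itv/= => /andP[kt _]; rewrite lee_fin Nni.
by rewrite cstF.
Qed.

Lemma riemann_le_integral :
  (h%:E * \sum_(0 <= k <oo) (N (k%:R * h)%R)%:E <= \int[mu]_(t in `[0%R, +oo[) (N t)%:E + h%:E)%E.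
Proof.
rewrite -nneseriesZl//; apply: lime_le; first by apply: is_cvg_nneseries => n _ _; rewrite mule_ge0// lee_fin ltW.
apply: nearW => -[|n].
  by rewrite big_geq// adde_ge0// ?lee_fin ?(ltW h0)//; exact: integral_ge0.
rewrite big_nat_recl// addeC; apply: leeD.
  by rewrite -EFinM lee_fin ler_piMr ?(ltW h0)//; have /andP[] := N01 (0 * h).
rewrite -bigF ge0_integral_bigcup//.
apply: (@le_trans _ _ (\sum_(0 <= k < n) \int[mu]_(t in F k) (N t)%:E)%E); last exact: nneseries_lim_ge.
apply: lee_sum => k _.
apply: (@le_trans _ _ (\int[mu]_(t in F k) (N (k.+1%:R * h)%R)%:E)%E).
  by rewrite cstF.
apply: ge0_le_integral => //; first exact: mN.
by move=> t; rewrite /F/= in_itv/= => /andP[_ kt]; rewrite lee_fin Nni// ltW.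
Qed.

End integral_test.

Section skeleton.
Context d (T : measurableType d) (R : realType) (P : probability T R).
Notation mu := (@lebesgue_measure R).
Variables (Y : R -> T -> R) (zeta : T -> \bar R) (q : R).
Hypothesis mY : forall t, 0 <= t -> measurable_fun setT (Y t).
Hypothesis Y0 : forall w, Y 0 w = 0.
Hypothesis ndY : forall w t t', 0 <= t -> t <= t' -> Y t w <= Y t' w.
Hypothesis mzeta : measurable_fun setT zeta.
Hypothesis indepY : forall t h, 0 <= t -> 0 <= h ->
  independent_systems P (sigma_process `[0, t] Y)
    (preimage_set_system setT (fun w => Y (t + h) w - Y t w) measurable).
Hypothesis stationaryY : forall t h, 0 <= t -> 0 <= h -> forall B : set R, measurable B ->
  P ((fun w => Y (t + h) w - Y t w) @^-1` B) = P ((fun w => Y h w - Y 0 w) @^-1` B).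
Hypothesis zetalaw : forall t, 0 <= t -> P [set w | (t%:E < zeta w)%E] = (expR (- (q * t)))%:E.
Hypothesis indepz : independent_systems P (sigma_process `[0, +oo[ Y)
  (preimage_set_system setT zeta measurable).

Let sigma_at (I : set R) t (A : set R) : I t -> measurable A -> sigma_process I Y (Y t @^-1` A).
Proof.
move=> It mA; apply: sub_sigma_algebra; exists t => //; exists A => //.
by rewrite setTI.
Qed.

Let alive_system t : preimage_set_system setT zeta measurable (alive_at zeta t).
Proof.
exists `]t%:E, +oo[%classic; first exact: emeasurable_itv.
by rewrite setTI; apply/seteqP; split=> w; rewrite /= in_itv/= andbT.
Qed.

Let sigma_incr t h (A B : set R) : 0 <= t -> 0 <= h -> measurable A -> measurable B ->
  sigma_process `[0, +oo[ Y (Y t @^-1` A `&` (fun w => Y (t + h) w - Y t w) @^-1` B).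
Proof.
move=> t0 h0 mA mB.
pose G := \bigcup_(t in `[0, +oo[) preimage_set_system setT (Y t) (measurable : set (set R)).
pose T' := g_sigma_algebraType G.
have mYt u : 0 <= u -> measurable_fun [set: T'] (Y u : T' -> R).
  move=> u0 _ C mC; rewrite setTI; apply: sigma_at => //=.
  by rewrite in_itv/= u0.
have m1 : measurable_fun [set: T'] (fun w : T' => Y (t + h) w - Y t w).
  by apply: measurable_funB; apply: mYt => //; exact: addr_ge0.
have : measurable ((Y t : T' -> R) @^-1` A `&` (fun w : T' => Y (t + h) w - Y t w) @^-1` B).
  by apply: measurableI; apply: measurable_preimage => //; exact: mYt.
exact.
Qed.

Lemma killed_product t A : 0 <= t -> measurable A ->
  P (alive_at zeta t `&` Y t @^-1` A) = (P (Y t @^-1` A) * (expR (- (q * t)))%:E)%E.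
Proof.
move=> t0 mA; rewrite setIC indepz.
- by rewrite zetalaw.
- by apply: sigma_at => //=; rewrite in_itv/= t0.
- exact: alive_system.
Qed.

(** The Markov property at a fixed time, killing included. *)
Lemma killed_joint t h A B : 0 <= t -> 0 <= h -> measurable A -> measurable B ->
  P ((Y t @^-1` A `&` (fun w => Y (t + h) w - Y t w) @^-1` B) `&` alive_at zeta (t + h)) =
  (P (alive_at zeta t `&` Y t @^-1` A) * P (alive_at zeta h `&` Y h @^-1` B))%E.
Proof.
move=> t0 h0 mA mB; rewrite indepz; last 2 first.
- exact: sigma_incr.
- exact: alive_system.
rewrite zetalaw ?addr_ge0// !killed_product// (indepY t0 h0); last 2 first.
- by apply: sigma_at => //=; rewrite in_itv/= t0 lexx.
- by exists B => //; rewrite setTI.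
rewrite stationaryY// (_ : (fun w => Y h w - Y 0 w) = Y h); last by apply/funext => w; rewrite Y0 subr0.
by rewrite mulrDr opprD expRD EFinM muleACA.
Qed.

Definition cell (h : R) (A B : set R) (k : nat) : set T :=
  (Y (k%:R * h) @^-1` A `&` (fun w => Y (k%:R * h + h) w - Y (k%:R * h) w) @^-1` B) `&`
    alive_at zeta (k%:R * h + h).

(** The expected number of visits to $A$ along the grid of step $h$ before the killing. *)
Definition visits (h : R) (A : set R) : \bar R :=
  (\sum_(0 <= k <oo) P (alive_at zeta (k%:R * h)%R `&` Y (k%:R * h)%R @^-1` A))%E.

Let kh_ge0 (k : nat) (h : R) : 0 < h -> 0 <= k%:R * h.
Proof. by move=> h0; rewrite mulr_ge0// ltW. Qed.

Lemma measurable_cell h A B k : 0 < h -> measurable A -> measurable B -> measurable (cell h A B k).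
Proof.
move=> h0 mA mB; apply: measurableI; last exact: measurable_alive_at.
apply: measurableI; apply: measurable_preimage => //; first exact/mY/kh_ge0.
by apply: measurable_funB; apply: mY; rewrite ?addr_ge0 ?kh_ge0// ltW.
Qed.

Let sum_cell h A B : 0 < h -> measurable A -> measurable B ->
  (\sum_(0 <= k <oo) P (cell h A B k) = visits h A * P (alive_at zeta h `&` Y h @^-1` B))%E.
Proof.
move=> h0 mA mB; have mh : measurable (alive_at zeta h `&` Y h @^-1` B).
  apply: measurableI; first exact: measurable_alive_at.
  by apply: measurable_preimage => //; exact/mY/ltW.
have fh := fin_num_measure P _ mh.
rewrite muleC -(fineK fh) -nneseriesZl; last by move=> k _; exact: measure_ge0.
apply: eq_eseriesr => k _; rewrite fineK// muleC.
by apply: killed_joint => //; [exact: kh_ge0|exact: ltW].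
Qed.

Lemma cells_le h A B : 0 < h -> measurable A -> measurable B ->
  (P (\bigcup_k cell h A B k) <= visits h A * P (alive_at zeta h `&` Y h @^-1` B))%E.
Proof.
move=> h0 mA mB; rewrite -sum_cell//; apply: measure_sigma_subadditive => //.
- by move=> k; exact: measurable_cell.
- by apply: bigcupT_measurable => k; exact: measurable_cell.
Qed.

(** A step that starts in $(\alpha,\beta]$ and gains more than $s-\alpha$ ends above $s>\beta$, and the path
   never returns: the cells are disjoint. *)
Lemma cells_eq h al be s : 0 < h -> 0 <= al -> al <= be -> be < s ->
  P (\bigcup_k cell h `]al, be] `]s - al, +oo[ k) =
  (visits h `]al, be] * P (alive_at zeta h `&` Y h @^-1` `](s - al)%R, +oo[%classic))%E.
Proof.
move=> h0 al0 albe bes; rewrite -sum_cell//.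
apply: measure_semi_bigcup.
- by move=> k; apply: measurable_cell => //; exact: measurable_itv.
- apply: ltn_trivIset => n m nm; apply/seteqP; split=> // w.
  rewrite /cell/= !in_itv/= !andbT => -[[[/andP[ma _] inc] _] [[/andP[_ nb] _] _]].
  have : Y (m%:R * h + h) w <= Y (n%:R * h) w.
    apply: ndY; first by rewrite addr_ge0 ?kh_ge0// ltW.
    by rewrite -[X in _ + X]mul1r -mulrDl natr1 ler_pM2r// ler_nat.
  by move: nb ma inc bes; lra.
- by apply: bigcupT_measurable => k; apply: measurable_cell => //; exact: measurable_itv.
Qed.

Hypothesis rcY : forall w t, 0 <= t -> Y u w @[u --> t^'+] --> Y t w.
Local Notation U := (occupation P mY rcY ndY mzeta).

Let slab (c t : R) : R :=
  fine (P (alive_at zeta (Num.max t 0) `&` Y (Num.max t 0) @^-1` `]-oo, c]%classic)).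

Let mslab c t : 0 <= t -> measurable (alive_at zeta t `&` Y t @^-1` `]-oo, c]%classic).
Proof.
move=> t0; apply: measurableI; first exact: measurable_alive_at.
by apply: measurable_preimage; [exact: mY|exact: measurable_itv].
Qed.

Let max0 t : 0 <= Num.max t 0 :> R. Proof. by rewrite le_max lexx orbT. Qed.

Let slab_ni c : {homo slab c : m n /~ n <= m}.
Proof.
move=> t u tu; apply: fine_le; rewrite ?fin_num_measure//; try exact: mslab.
apply: le_measure; rewrite ?inE; try exact: mslab.
have tum : Num.max t 0 <= Num.max u 0 by rewrite ge_max !le_max tu lexx orbT.
move=> w [/= al]; rewrite /= !in_itv/= => Yc; split.
  by apply: le_lt_trans al; rewrite lee_fin.
by apply: le_trans Yc; exact: ndY.
Qed.

Let slab01 c t : 0 <= slab c t <= 1.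
Proof.
apply/andP; split; first exact: fine_ge0.
rewrite -[leRHS]/(fine 1%E); apply: fine_le => //; first by rewrite fin_num_measure//; exact: mslab.
by apply: probability_le1; exact: mslab.
Qed.

Let slab_occ c : U `]-oo, c]%classic = (\int[mu]_(t in `[0%R, +oo[) (slab c t)%:E)%E.
Proof.
have mC : measurable (`]-oo, c]%classic : set (measurableTypeR R)) by exact: measurable_itv.
rewrite -[X in U X]setIT -integral_indic// ge0_integral_occupation//; last first.
  by apply/measurable_EFinP; exact: measurable_indic.
apply: eq_integral => t; rewrite inE/= in_itv/= andbT => t0.
have -> : (fun w => (\1_(`]-oo, c]%classic) (Y t w))%:E) =
  (fun w => (\1_(Y t @^-1` `]-oo, c]%classic) w)%:E :> \bar R) by [].
rewrite integral_indic//; first by rewrite setIC /slab max_l// fineK// fin_num_measure//; exact: mslab.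
  exact: measurable_alive_at.
by apply: measurable_preimage; [exact: mY|exact: measurable_itv].
Qed.

Let slab_visits h c : 0 < h ->
  visits h `]-oo, c] = (\sum_(0 <= k <oo) (slab c (k%:R * h)%R)%:E)%E.
Proof.
move=> h0; apply: eq_eseriesr => k _; rewrite /slab max_l ?kh_ge0//.
by rewrite fineK// fin_num_measure//; exact/mslab/kh_ge0.
Qed.

Let visits_split h al be : 0 < h -> al <= be ->
  visits h `]-oo, be] = (visits h `]-oo, al] + visits h `]al, be])%E.
Proof.
move=> h0 ab; rewrite /visits -nneseriesD//; apply: eq_eseriesr => k _.
have mk (A : set R) : measurable A -> measurable (alive_at zeta (k%:R * h) `&` Y (k%:R * h) @^-1` A).
  move=> mA; apply: measurableI; first exact: measurable_alive_at.
  by apply: measurable_preimage => //; exact/mY/kh_ge0.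
rewrite -measureU; last 3 first.
- by apply: mk; exact: measurable_itv.
- by apply: mk; exact: measurable_itv.
- apply/seteqP; split=> // w [[_ /=]]; rewrite in_itv/= => h1 [_ /=]; rewrite in_itv/= => /andP[h2 _].
  by move: (le_lt_trans h1 h2); rewrite ltxx.
congr (P _); rewrite -setIUr -preimage_setU; congr (_ `&` (_ @^-1` _)).
apply/seteqP; split=> x; rewrite /= !in_itv/=.
  by move=> xb; rewrite xb andbT; case: (leP x al); [left|right].
by move=> [/le_trans|/andP[]//]; apply.
Qed.

Hypothesis U_fin : forall c, (U `]-oo, c]%classic < +oo)%E.

(** The probability to be alive and at most $c$ is nonincreasing in time, so that a Riemann sum of
   step $h$ exceeds its integral by something between $0$ and $h$. For the difference of two such
   sums the error remains between $-h$ and $h$. *)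
Lemma visits_occupation h al be : 0 < h -> al <= be ->
  (h%:E * visits h `]al, be] <= U `]al, be]%classic + h%:E /\
   U `]al, be]%classic <= h%:E * visits h `]al, be] + h%:E)%E.
Proof.
move=> h0 ab.
have lo c := integral_le_riemann (@slab_ni c) (slab01 c) h0.
have hi c := riemann_le_integral (@slab_ni c) (slab01 c) h0.
have {}lo c : (U `]-oo, c]%classic <= h%:E * visits h `]-oo, c])%E.
  by rewrite slab_occ slab_visits.
have {}hi c : (h%:E * visits h `]-oo, c] <= U `]-oo, c]%classic + h%:E)%E.
  by rewrite slab_occ slab_visits.
have US : U `]-oo, be]%classic = (U `]-oo, al]%classic + U `]al, be]%classic)%E.
  rewrite -measureU; last 3 first.
  - exact: measurable_itv.
  - exact: measurable_itv.
  - apply/seteqP; split=> // x []; rewrite /= !in_itv/= => h1 /andP[h2 _].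
    by move: (le_lt_trans h1 h2); rewrite ltxx.
  congr (U _); apply/seteqP; split=> x; rewrite /= !in_itv/=.
    by move=> xb; rewrite xb andbT; case: (leP x al); [left|right].
  by move=> [/le_trans|/andP[]//]; apply.
have V0 A : (0 <= visits h A)%E by apply: nneseries_ge0.
have fU c : U `]-oo, c]%classic \is a fin_num by rewrite ge0_fin_numE.
have fV : (h%:E * visits h `]-oo, al])%E \is a fin_num.
  rewrite ge0_fin_numE ?mule_ge0// ?lee_fin ?(ltW h0)//; apply: le_lt_trans (hi al) _.
  by rewrite lte_add_pinfty// ltry.
have hS : (h%:E * visits h `]-oo, be] = h%:E * visits h `]-oo, al] + h%:E * visits h `]al, be])%E.
  by rewrite (visits_split h0 ab) ge0_muleDr.
have fUal := fU al; have hi' := hi be; have lo' := lo be; have hia := hi al; have loa := lo al.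
move: US fUal hi' lo' hia loa fV hS.
move: (U `]al, be]%classic) (U `]-oo, al]%classic) (U `]-oo, be]%classic).
move: (visits h `]al, be]) (visits h `]-oo, al]) (visits h `]-oo, be]) => v v1 v2 u u1 u2.
move=> US fUal hi' lo' hia loa fV hS; split.
  rewrite -(leeD2lE _ _ fV) -hS; apply: (le_trans hi'); rewrite US addeA.
  by rewrite leeD2r// leeD2r.
rewrite -(leeD2lE _ _ fUal) -US; apply: (le_trans lo'); rewrite hS.
by rewrite (addeC (h%:E * v)%E h%:E) addeA leeD2r.
Qed.

End skeleton.

(** * First passage and undershoot *)

Section passage.
Context d (T : measurableType d) (R : realType) (P : probability T R).
Variables (Y : R -> T -> R) (zeta : T -> \bar R) (X : R -> T -> option R).
Hypothesis mY : forall t, 0 <= t -> measurable_fun setT (Y t).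
Hypothesis Y0 : forall w, Y 0 w = 0.
Hypothesis ndY : forall w t t', 0 <= t -> t <= t' -> Y t w <= Y t' w.
Hypothesis rcY : forall w t, 0 <= t -> Y u w @[u --> t^'+] --> Y t w.
Hypothesis llY : forall w t, 0 < t -> cvg (Y u w @[u --> t^'-]).
Hypothesis mzeta : measurable_fun setT zeta.
Hypothesis XE : forall t w, 0 <= t ->
  X t w = if (t%:E < zeta w)%E then Some (Y t w) else None.

Definition crosses s : set T := [set w | exists t, [/\ 0 <= t, alive_at zeta t w & s < Y t w]].

Lemma lifetimeE w : (lifetime X w = ereal_inf [set t%:E | t in [set t | (0 <= t)%R /\ (zeta w <= t%:E)%E]])%E.
Proof.
rewrite /lifetime; congr (ereal_inf (_ @` _)); apply/seteqP; split=> t /= [t0].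
  by rewrite XE//; case: ifP => // /negbT; rewrite -leNgt.
by move=> zt; rewrite XE// ltNge zt.
Qed.

Lemma zeta_le_lifetime w : (zeta w <= lifetime X w)%E.
Proof. by rewrite lifetimeE; apply: le_ereal_inf_tmp => _ [t [_ zt] <-]. Qed.

Lemma passage_lt_lifetime s w : (passage_time X s w < lifetime X w)%E <-> crosses s w.
Proof.
split=> [|[t [t0 al sY]]].
  move=> h; apply: contrapT => nc.
  have : passage_time X s w = +oo%E.
    rewrite /passage_time (_ : [set t%:E | t in _] = set0) ?ereal_inf0//.
    apply/seteqP; split=> // e [t [t0 [y XY sy]] _]; move: XY; rewrite XE//; case: ifP => // al [yE].
    by apply: nc; exists t; split=> //; rewrite yE.
  by move=> pE; move: h; rewrite pE ltNge leey.
apply: (@le_lt_trans _ _ t%:E); last exact: lt_le_trans (zeta_le_lifetime w).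
apply: ereal_inf_lbound; exists t => //; split=> //; exists (Y t w) => //.
by rewrite XE// al.
Qed.

Section on_crossing.
Variables (s : R) (w : T).
Hypothesis s0 : 0 < s.
Hypothesis cr : crosses s w.

Let tau := fine (passage_time X s w).

Let tauE : passage_time X s w = tau%:E.
Proof.
rewrite /tau fineK//; have [t [t0 al sY]] := cr.
rewrite ge0_fin_numE.
  by apply: (lt_le_trans _ (leey (lifetime X w))); exact/passage_lt_lifetime.
by apply: le_ereal_inf_tmp => _ [u [u0 _] <-]; rewrite lee_fin.
Qed.

Let before u : 0 <= u -> u < tau -> (u%:E < zeta w)%E /\ Y u w <= s.
Proof.
move=> u0 ut; have [t [t0 al sY]] := cr.
have tt : tau <= t.
  rewrite -lee_fin -tauE; apply: ereal_inf_lbound; exists t => //; split=> //; exists (Y t w) => //.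
  by rewrite XE// al.
have uz : (u%:E < zeta w)%E by apply: le_lt_trans al; rewrite lee_fin ltW// (lt_le_trans ut).
split=> //; rewrite leNgt; apply/negP => sYu.
have : tau <= u.
  rewrite -lee_fin -tauE; apply: ereal_inf_lbound; exists u => //; split=> //; exists (Y u w) => //.
  by rewrite XE// uz.
by rewrite leNgt ut.
Qed.

Let tau_ge0 : 0 <= tau.
Proof.
by rewrite -lee_fin -tauE; apply: le_ereal_inf_tmp => _ [u [u0 _] <-]; rewrite lee_fin.
Qed.

Let after t : tau < t -> s < Y t w.
Proof.
move=> tt; have : (passage_time X s w < t%:E)%E by rewrite tauE lte_fin.
move/ereal_inf_lt => [_ [u [u0 [y XY sy]] <-]]; move: XY; rewrite XE//; case: ifP => // _ [yE].
by rewrite lte_fin => ut; rewrite -yE in sy; apply: (lt_le_trans sy); apply: ndY => //; exact: ltW.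
Qed.

Let at_tau : s <= Y tau w.
Proof.
apply: (cvgr_to_ge (@rcY w tau tau_ge0)); near=> u.
by apply/ltW/after; near: u; exact: nbhs_right_gt.
Unshelve. all: by end_near. Qed.

Let tau_gt0 : 0 < tau.
Proof.
rewrite lt_neqAle tau_ge0 andbT; apply/eqP => E.
by move: at_tau; rewrite -E Y0 leNgt s0.
Qed.

Let tau_alive : (tau%:E < zeta w)%E.
Proof.
have [t [t0 al sY]] := cr; apply: le_lt_trans (al); rewrite -tauE.
apply: ereal_inf_lbound; exists t => //; split=> //; exists (Y t w) => //.
by rewrite XE// al.
Qed.

(** All that is used of the passage time and of the left limit of the path, as inequalities. *)
Lemma undershootP : exists tau : R, [/\ 0 < tau, (tau%:E < zeta w)%E &
  [/\ forall u, 0 <= u -> u < tau -> Y u w <= undershoot X s w,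
      forall x, x < undershoot X s w -> exists u, [/\ 0 <= u, u < tau & x < Y u w],
      forall u, 0 <= u -> u < tau -> Y u w <= s,
      forall t, tau < t -> s < Y t w & s <= Y tau w]].
Proof.
exists tau; split; [exact: tau_gt0|exact: tau_alive|].
have cl : Y u w @[u --> tau^'-] --> undershoot X s w.
  rewrite /undershoot /left_limit -/tau gt_eqF//.
  have near_eq : {near tau^'-, (fun u => Y u w) =1 (fun u => odflt 0 (X u w))}.
    near=> u; have u0 : 0 <= u by apply: ltW; near: u; exact: nbhs_left_gt.
    have ut : u < tau by near: u; exact: nbhs_left_lt.
    by rewrite XE// (before u0 ut).1.
  have c1 := @llY w tau tau_gt0.
  suff -> : lim (odflt 0 (X u w) @[u --> tau^'-]) = lim (Y u w @[u --> tau^'-]) by exact: c1.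
  apply/cvg_lim => //; apply: cvg_trans c1; exact: near_eq_cvg.
split=> //.
- move=> u u0 ut; apply: (cvgr_to_ge cl); near=> v; apply: ndY => //.
  by apply: ltW; near: v; exact: nbhs_left_gt.
- move=> x xD; near (tau^'-) => u; exists u; split.
  + by apply: ltW; near: u; exact: nbhs_left_gt.
  + by near: u; exact: nbhs_left_lt.
  + by near: u; exact: (cvgr_gt _ cl).
- by move=> u u0 ut; have [] := before u0 ut.
Unshelve. all: by end_near. Qed.

End on_crossing.

(** Being alive is an open condition in time and the path is nondecreasing: the witness can be moved
   to a later rational time. *)
Lemma crossesP s w : crosses s w <->
  exists r : rat, [/\ 0 <= ratr r :> R, alive_at zeta (ratr r) w & s < Y (ratr r) w].
Proof.
split=> [[t [t0 al sY]]|[r [r0 al sY]]]; last by exists (ratr r).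
have [u tu uz] : exists2 u, t < u & (u%:E <= zeta w)%E.
  move: al; rewrite /alive_at/=; case: (zeta w) => [z| |]//.
    by rewrite lte_fin => tz; exists z.
  by move=> _; exists (t + 1); [rewrite ltrDl|rewrite leey].
have [r] := rat_in_itvoo tu; rewrite in_itv/= => /andP[tr ru].
exists r; split; first by rewrite (le_trans t0)// ltW.
  by apply: lt_le_trans uz; rewrite lte_fin.
by apply: (lt_le_trans sY); apply: ndY => //; exact: ltW.
Qed.

(** A countable description of the undershoot, from which its measurability follows. *)
Lemma undershoot_gtP s w x : 0 < s -> crosses s w -> x < undershoot X s w <->
  exists r r' : rat, [/\ 0 <= ratr r :> R, ratr r < ratr r' :> R, x < Y (ratr r) w & Y (ratr r') w <= s].
Proof.
move=> s0 cr; have [tau [t0 _ [h1 h2 h3 h4 _]]] := undershootP s0 cr.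
split=> [/h2[u [u0 ut xu]]|[r [r' [r0 rr' xr rs]]]].
  have [r] := rat_in_itvoo ut; rewrite in_itv/= => /andP[ur rt].
  have [r'] := rat_in_itvoo rt; rewrite in_itv/= => /andP[rr' r't].
  have r0 : 0 <= ratr r :> R by rewrite (le_trans u0)// ltW.
  exists r, r'; split=> //; first by apply: (lt_le_trans xu); apply: ndY => //; exact: ltW.
  by apply: h3 => //; rewrite (le_trans r0)// ltW.
apply: (lt_le_trans xr); apply: h1 => //; apply: (lt_le_trans rr').
by rewrite leNgt; apply/negP => /h4; rewrite ltNge rs.
Qed.

Lemma measurable_crosses s : measurable (crosses s).
Proof.
rewrite (_ : crosses s = \bigcup_(r : rat) (if 0 <= ratr r :> R then
   alive_at zeta (ratr r) `&` Y (ratr r) @^-1` `]s, +oo[ else set0)).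
  apply: bigcupT_measurable_rat => r; case: ifP => // r0.
  apply: measurableI; first exact: measurable_alive_at.
  by apply: measurable_preimage; [exact: mY|exact: measurable_itv].
apply/seteqP; split=> w.
  move=> /crossesP[r [r0 al sY]]; exists r => //; rewrite r0; split=> //.
  by rewrite /= in_itv/= andbT.
move=> [r _]; case: ifP => // r0 [al]; rewrite /= in_itv/= andbT => sY.
by apply/crossesP; exists r.
Qed.

(** The undershoot has an arbitrary value where $s$ is not crossed, and need not be measurable there. *)
Definition undershoot0 s w : measurableTypeR R := if w \in crosses s then undershoot X s w else 0.

Lemma measurable_undershoot0 s : 0 < s -> measurable_fun setT (undershoot0 s).
Proof.
move=> s0; have mc := measurable_crosses s.
apply: (measurability (@RGenOInfty.G R)) => [|/= _ [_] [x] -> <-].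
  exact: RGenOInfty.measurableE.
rewrite setTI (_ : _ @^-1` _ = (crosses s `&` \bigcup_(r : rat) \bigcup_(r' : rat)
    (if (0 <= ratr r :> R) && (ratr r < ratr r' :> R) then Y (ratr r) @^-1` `]x, +oo[ `&` Y (ratr r') @^-1` `]-oo, s] else set0))
   `|` (~` crosses s `&` (if x < 0 then setT else set0))).
  apply: measurableU; apply: measurableI => //; last 2 first.
  - exact: measurableC.
  - by case: ifP.
  apply: bigcupT_measurable_rat => r; apply: bigcupT_measurable_rat => r'.
  case: ifP => // /andP[r0 rr]; apply: measurableI; apply: measurable_preimage.
  - exact: mY.
  - exact: measurable_itv.
  - by apply: mY; rewrite (le_trans r0)// ltW.
  - exact: measurable_itv.
apply/seteqP; split=> w /=; rewrite /undershoot0 in_itv/= andbT.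
  case: (boolP (w \in crosses s)) => [/set_mem cr|/negP cr].
    move=> /(undershoot_gtP _ s0 cr)[r [r' [r0 rr xr rs]]]; left; split=> //.
    by exists r => //; exists r' => //; rewrite r0 rr; split; rewrite /= in_itv/= ?andbT.
  by move=> ->; right; split=> // c; apply: cr; exact: mem_set.
case=> [[cr [r _ [r' _]]]|[cr]].
  case: ifP => // /andP[r0 rr] []; rewrite /= !in_itv/= andbT => xr rs.
  by rewrite (mem_set cr); apply/(undershoot_gtP _ s0 cr); exists r, r'.
by rewrite (memNset cr); case: ifP.
Qed.

End passage.

(** * Bounds for the law of the undershoot *)

Section crossing_law.
Context d (T : measurableType d) (R : realType) (P : probability T R).
Variables (Y : R -> T -> R) (zeta : T -> \bar R) (X : R -> T -> option R) (q : R).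
Hypothesis mY : forall t, 0 <= t -> measurable_fun setT (Y t).
Hypothesis Y0 : forall w, Y 0 w = 0.
Hypothesis ndY : forall w t t', 0 <= t -> t <= t' -> Y t w <= Y t' w.
Hypothesis rcY : forall w t, 0 <= t -> Y u w @[u --> t^'+] --> Y t w.
Hypothesis llY : forall w t, 0 < t -> cvg (Y u w @[u --> t^'-]).
Hypothesis mzeta : measurable_fun setT zeta.
Hypothesis XE : forall t w, 0 <= t ->
  X t w = if (t%:E < zeta w)%E then Some (Y t w) else None.
Local Notation time := (@time R).
Local Notation cell := (cell Y zeta).
Local Notation crosses := (crosses Y zeta).
Local Notation D s w := (undershoot X s w).
Let tm0 n : 0 < time n := time_gt0 R n.

Let cvg_time : time n @[n --> \oo] --> (0 : R).
Proof. exact: cvg_harmonic. Qed.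

Lemma ex_grid (h t : R) : 0 < h -> 0 < t -> exists k : nat, k%:R * h < t /\ t <= k%:R * h + h.
Proof.
move=> h0 t0; have x0 : 0 < t / h by rewrite divr_gt0.
have tE : t = t / h * h by rewrite mulfVK// gt_eqF.
have /andP[a1 a2] := truncn_itv (ltW x0).
have [E|E] := eqVneq (Num.truncn (t / h))%:R (t / h).
  case: (Num.truncn _) E a2 => [|k] E a2; first by move: x0; rewrite -E ltxx.
  exists k; rewrite {1 2}tE -E -[X in _ <= _ + X]mul1r -mulrDl natr1 lexx ltr_pM2r// ltr_nat.
  by split.
exists (Num.truncn (t / h)); rewrite -[X in _ <= _ + X]mul1r -mulrDl natr1.
rewrite -ltr_pdivlMr// -ler_pdivrMr//; split; last exact: ltW.
by rewrite lt_neqAle E.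
Qed.

(** The step of a fine grid that contains the passage starts close to the undershoot, from below, and
   ends at or above $s$. *)
Lemma crossing_sub_cells s al be w : 0 < s -> 0 <= al -> be < s ->
  crosses s w -> al < D s w -> D s w < be ->
  \forall n \near \oo, exists k, cell (time n) `]al, be] `[s - be, +oo[ k w.
Proof.
move=> s0 al0 bes cr alD Dbe.
have [tau [t0 tz [h1 h2 h3 h4 h5]]] := undershootP Y0 ndY rcY llY XE s0 cr.
have [u [u0 ut alu]] := h2 _ alD.
have [z tz' zz] : exists2 z, tau < z & (z%:E <= zeta w)%E.
  move: tz; case: (zeta w) => [z| |]//; first by rewrite lte_fin => tz; exists z.
  by move=> _; exists (tau + 1); [rewrite ltrDl|rewrite leey].
near=> n; have hn : time n < Num.min (tau - u) (z - tau).
  by near: n; apply: (cvgr_lt _ cvg_time); rewrite lt_min !subr_gt0 ut.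
move: hn; rewrite lt_min => /andP[hu hz].
have [k [k1 k2]] := ex_grid (tm0 n) t0; exists k.
have kh0 : 0 <= k%:R * time n by rewrite mulr_ge0// ltW.
have uk : u <= k%:R * time n by lra.
split; last first.
  by apply: lt_le_trans zz; rewrite lte_fin; lra.
have Dk : Y (k%:R * time n) w < be by apply: le_lt_trans Dbe; exact: h1.
have sY : s <= Y (k%:R * time n + time n) w.
  by apply: (le_trans h5); apply: ndY => //; exact: ltW.
split; rewrite /= in_itv/= ?andbT.
  by rewrite (ltW Dk) andbT; apply: (lt_le_trans alu); exact: ndY.
by lra.
Unshelve. all: by end_near. Qed.

(** The step lies around the passage time; as this happens on arbitrarily fine grids, the path at the
   start of the step approaches the undershoot. *)
Lemma cells_sub_crossing s al be w : 0 < s -> 0 <= al -> be < s ->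
  (forall N, exists2 n, (N <= n)%N & exists k, cell (time n) `]al, be] `]s - al, +oo[ k w) ->
  [/\ crosses s w, al <= D s w & D s w <= be].
Proof.
move=> s0 al0 bes H.
have H1 n k : cell (time n) `]al, be] `]s - al, +oo[ k w ->
    [/\ crosses s w, al < Y (k%:R * time n) w, Y (k%:R * time n) w <= be & s < Y (k%:R * time n + time n) w].
  move=> [[]]; rewrite /= !in_itv/= andbT => /andP[alY Ybe] inc al_; have h := tm0 n.
  have sY : s < Y (k%:R * time n + time n) w by lra.
  split=> //; exists (k%:R * time n + time n); split=> //.
  by rewrite addr_ge0 ?mulr_ge0// ltW.
have [n0 _ [k0 /H1[cr _ _ _]]] := H 0%N.
have [tau [t0 tz [h1 h2 h3 h4 h5]]] := undershootP Y0 ndY rcY llY XE s0 cr.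
have H2 n k : cell (time n) `]al, be] `]s - al, +oo[ k w ->
    k%:R * time n < tau /\ tau <= k%:R * time n + time n.
  move=> /H1[_ _ Ybe sY]; have h := tm0 n; split.
    rewrite ltNge; apply/negP => tk.
    have : Y tau w <= Y (k%:R * time n) w by apply: ndY => //; exact: ltW.
    lra.
  rewrite leNgt; apply/negP => kt.
  have : Y (k%:R * time n + time n) w <= s.
    by apply: h3 => //; rewrite addr_ge0 ?mulr_ge0// ltW.
  lra.
split=> //.
  have [n _ [k c]] := H 0%N; have [_ alY _ _] := H1 _ _ c; have [kt _] := H2 _ _ c.
  by apply: (le_trans (ltW alY)); apply: h1 => //; rewrite mulr_ge0// ltW.
rewrite leNgt; apply/negP => /h2[u [u0 ut beu]].
have [N _ hN] : \forall n \near \oo, time n < tau - u.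
  by apply: (cvgr_lt _ cvg_time); rewrite subr_gt0.
have [n Nn [k c]] := H N; have [_ _ Ybe _] := H1 _ _ c; have [_ tk] := H2 _ _ c.
have hn := hN n Nn.
have : Y u w <= Y (k%:R * time n) w by apply: ndY => //; rewrite /= in hn; lra.
lra.
Qed.

Hypothesis indepY : forall t h, 0 <= t -> 0 <= h ->
  independent_systems P (sigma_process `[0, t] Y)
    (preimage_set_system setT (fun w => Y (t + h) w - Y t w) measurable).
Hypothesis stationaryY : forall t h, 0 <= t -> 0 <= h -> forall B : set R, measurable B ->
  P ((fun w => Y (t + h) w - Y t w) @^-1` B) = P ((fun w => Y h w - Y 0 w) @^-1` B).
Hypothesis zetalaw : forall t, 0 <= t -> P [set w | (t%:E < zeta w)%E] = (expR (- (q * t)))%:E.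
Hypothesis indepz : independent_systems P (sigma_process `[0, +oo[ Y)
  (preimage_set_system setT zeta measurable).
Local Notation U := (occupation P mY rcY ndY mzeta).
Hypothesis U_fin : forall c, (U `]-oo, c]%classic < +oo)%E.
Variable tl : R -> R.
Hypothesis tl_ge0 : forall r, 0 <= tl r.
Hypothesis tl_le : forall r0 r1 e, 0 < r0 -> r0 < r1 -> 0 < e ->
  \forall n \near \oo, n.+1%:R * killed_law P Y zeta (time n) `[r1, +oo[ <= tl r0 + e.
Hypothesis tl_ge : forall r0 r1 e, 0 < r0 -> r0 < r1 -> 0 < e ->
  \forall n \near \oo, tl r1 - e <= n.+1%:R * killed_law P Y zeta (time n) `]r0, +oo[.

Local Notation u al be := (fine (U `]al, be]%classic)).

Let U_fin_num al be : U `]al, be]%classic \is a fin_num.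
Proof.
rewrite ge0_fin_numE//; apply: le_lt_trans (U_fin be); apply: le_measure; rewrite ?inE.
- exact: measurable_itv.
- exact: measurable_itv.
- by move=> x; rewrite /= !in_itv/= => /andP[].
Qed.

Let visits_fin n al be : al <= be -> visits P Y zeta (time n) `]al, be] \is a fin_num /\
  time n * fine (visits P Y zeta (time n) `]al, be]) <= u al be + time n /\
  u al be - time n <= time n * fine (visits P Y zeta (time n) `]al, be]).
Proof.
move=> ab; have V0 : (0 <= visits P Y zeta (time n) `]al, be])%E by apply: nneseries_ge0.
have [h1 h2] := visits_occupation U_fin (tm0 n) ab.
have fU := U_fin_num al be; move: h1 h2 fU V0.
move: (U `]al, be]%classic) (visits P Y zeta (time n) `]al, be]) => [x| |] [y| |]//=.
  by rewrite -!EFinM -!EFinD !lee_fin => h1 h2 _ _; split=> //; split=> //; rewrite lerBlDr.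
by rewrite gt0_muley ?lte_fin// -EFinD leNgt ltry.
Qed.

Let killed_fin t A : 0 <= t -> measurable A ->
  P (alive_at zeta t `&` Y t @^-1` A) = (killed_law P Y zeta t A)%:E.
Proof.
move=> t0 mA; rewrite /killed_law fineK// fin_num_measure//.
apply: measurableI; first exact: measurable_alive_at.
by apply: measurable_preimage => //; exact: mY.
Qed.

Let prod_time n v k : v * k = (time n * v) * (n.+1%:R * k).
Proof.
have -> : time n * v * (n.+1%:R * k) = (n.+1%:R * time n) * (v * k) by ring.
by rewrite /time mulfV// mul1r.
Qed.

Let upper s al be r0 e N : 0 <= al -> al <= be -> be < s -> 0 < r0 -> r0 < s - be -> 0 < e ->
  (P (\bigcap_(n in [set n | (N <= n)%N]) \bigcup_k cell (time n) `]al, be] `[(s - be)%R, +oo[%classic k)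
   <= ((u al be + e) * (tl r0 + e))%:E)%E.
Proof.
move=> al0 ab bes r00 r0s e0.
near \oo => m.
have Nm : (N <= m)%N by near: m; exact: nbhs_infty_ge.
have hm : time m < e by near: m; exact: (cvgr_lt _ cvg_time).
have km : m.+1%:R * killed_law P Y zeta (time m) `[s - be, +oo[ <= tl r0 + e.
  by near: m; exact: tl_le.
have mc n k : measurable (cell (time n) `]al, be] `[s - be, +oo[ k).
  by apply: measurable_cell => //; exact: measurable_itv.
apply: (@le_trans _ _ (P (\bigcup_k cell (time m) `]al, be] `[s - be, +oo[ k))).
  apply: le_measure; rewrite ?inE.
  - by apply: bigcap_measurable => [|n _]; [exists m|exact: bigcupT_measurable].
  - exact: bigcupT_measurable.
  - by move=> w; apply.
have [vf [v1 v2]] := visits_fin m ab.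
apply: (le_trans (cells_le mY Y0 mzeta indepY stationaryY zetalaw indepz (tm0 m) (measurable_itv _) (measurable_itv _))).
rewrite killed_fin; [|exact: ltW|exact: measurable_itv].
rewrite -(fineK vf) -EFinM lee_fin (prod_time m).
apply: ler_pM => //.
- by rewrite mulr_ge0 ?(ltW (tm0 m))// fine_ge0// nneseries_ge0.
- by rewrite mulr_ge0// /killed_law fine_ge0.
- by lra.
Unshelve. all: by end_near. Qed.

Let prod_lower (V K uu t e : R) : 0 < e -> 0 <= V -> 0 <= K -> 0 <= uu -> 0 <= t ->
  uu - e <= V -> t - e <= K -> uu * t - e * (uu + t) <= V * K.
Proof.
move=> e0 V0 K0 u0 t0 v3 km.
have [ue|eu] := leP e uu; last first.
  by apply: le_trans (mulr_ge0 V0 K0); nra.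
have [te|et] := leP e t; last first.
  by apply: le_trans (mulr_ge0 V0 K0); nra.
have : (uu - e) * (t - e) <= V * K by apply: ler_pM; rewrite ?subr_ge0.
nra.
Qed.

Let lower s al be r1 e N : 0 <= al -> al <= be -> be < s -> s - al < r1 -> 0 < e ->
  ((u al be * tl r1 - e * (u al be + tl r1))%:E <=
   P (\bigcup_(n in [set n | (N <= n)%N]) \bigcup_k cell (time n) `]al, be] `](s - al)%R, +oo[%classic k))%E.
Proof.
move=> al0 ab bes r1s e0.
near \oo => m.
have Nm : (N <= m)%N by near: m; exact: nbhs_infty_ge.
have hm : time m < e by near: m; exact: (cvgr_lt _ cvg_time).
have km : tl r1 - e <= m.+1%:R * killed_law P Y zeta (time m) `]s - al, +oo[.
  by near: m; apply: tl_ge => //; rewrite subr_gt0 (le_lt_trans ab).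
have mc n k : measurable (cell (time n) `]al, be] `]s - al, +oo[ k).
  by apply: measurable_cell => //; exact: measurable_itv.
apply: (@le_trans _ _ (P (\bigcup_k cell (time m) `]al, be] `]s - al, +oo[ k))); last first.
  apply: le_measure; rewrite ?inE.
  - exact: bigcupT_measurable.
  - by apply: bigcup_measurable => n _; exact: bigcupT_measurable.
  - by move=> w cw; exists m.
have [vf [v1 v2]] := visits_fin m ab.
rewrite (cells_eq mY Y0 ndY mzeta indepY stationaryY zetalaw indepz (tm0 m) al0 ab bes).
rewrite killed_fin; [|exact: ltW|exact: measurable_itv].
rewrite -(fineK vf) -EFinM lee_fin [leRHS](prod_time m).
have V0 : 0 <= time m * fine (visits P Y zeta (time m) `]al, be]).
  by rewrite mulr_ge0 ?(ltW (tm0 m))// fine_ge0// nneseries_ge0.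
have K0 : 0 <= m.+1%:R * killed_law P Y zeta (time m) `]s - al, +oo[.
  by rewrite mulr_ge0// /killed_law fine_ge0.
have u0 : 0 <= u al be by rewrite fine_ge0.
have t0 := tl_ge0 r1.
have v3 : u al be - e <= time m * fine (visits P Y zeta (time m) `]al, be]) by lra.
exact: prod_lower.
Unshelve. all: by end_near. Qed.

Variables (s : R).
Hypothesis s0 : 0 < s.

Let g w : R := \1_(crosses s) w.
Let mg : measurable_fun setT g.
Proof. by apply: measurable_indic; exact: measurable_crosses. Qed.
Let g0 w : 0 <= g w. Proof. by rewrite /g indicE. Qed.

(** The law of the undershoot on the event that $s$ is crossed before the killing. *)
Definition crossing_law : {measure set (measurableTypeR R) -> \bar R} :=
  weighted_law P mg g0 (measurable_undershoot0 mY Y0 ndY rcY llY mzeta XE s0).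

Lemma crossing_lawE A : measurable (A : set (measurableTypeR R)) ->
  crossing_law A = P (crosses s `&` [set w | A (D s w)]).
Proof.
move=> mA; rewrite /crossing_law /= /weighted_law integral_indic//.
- congr (P _); apply/seteqP; split=> w /= [cr]; rewrite /undershoot0 mem_set//.
- apply: measurable_preimage mA; exact: (measurable_undershoot0 mY Y0 ndY rcY llY mzeta XE s0).
- exact: measurable_crosses.
Qed.

Let eps_le (x y c : R) : 0 <= c -> (forall e, 0 < e -> e <= 1 -> x <= y + e * c) -> x <= y.
Proof.
move=> c0 H; apply/ler_addgt0Pr => e e0.
have e1 : 0 < Num.min 1 (e / (c + 1)) by rewrite lt_min ltr01 divr_gt0// ltr_wpDl.
apply: (le_trans (H _ e1 _)); first by rewrite ge_min lexx.
rewrite lerD2l; apply: (@le_trans _ _ (e / (c + 1) * c)).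
  by rewrite ler_wpM2r// ge_min lexx orbT.
by rewrite -mulrA ler_piMr ?(ltW e0)// mulrC ler_pdivrMr ?ltr_wpDl// mul1r lerDl.
Qed.

Lemma crossing_law_fin A : measurable (A : set (measurableTypeR R)) -> crossing_law A \is a fin_num.
Proof.
move=> mA; rewrite crossing_lawE// fin_num_measure//.
have -> : crosses s `&` [set w | A (D s w)] = crosses s `&` undershoot0 Y zeta X s @^-1` A.
  by apply/seteqP; split=> w /= [cr]; rewrite /undershoot0 mem_set.
apply: measurableI; first exact: measurable_crosses.
apply: measurable_preimage mA; exact: (measurable_undershoot0 mY Y0 ndY rcY llY mzeta XE s0).
Qed.

Let measurable_cross (A : set (measurableTypeR R)) : measurable A ->
  measurable (crosses s `&` [set w | A (D s w)]).
Proof.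
move=> mA; have -> : crosses s `&` [set w | A (D s w)] = crosses s `&` undershoot0 Y zeta X s @^-1` A.
  by apply/seteqP; split=> w /= [cr]; rewrite /undershoot0 mem_set.
apply: measurableI; first exact: measurable_crosses.
apply: measurable_preimage mA; exact: (measurable_undershoot0 mY Y0 ndY rcY llY mzeta XE s0).
Qed.

(** The crossing is contained in the lower limit of the events that some cell occurs, whose probabilities
   are at most the product of the expected number of visits and of the probability of one large increment. *)
Lemma crossing_law_le al be r0 : 0 <= al -> al <= be -> be < s -> 0 < r0 -> r0 < s - be ->
  fine (crossing_law `]al, be[%classic) <= u al be * tl r0.
Proof.
move=> al0 ab bes r00 r0s.
have u0 : 0 <= u al be by rewrite fine_ge0.
have t0 := tl_ge0 r0.
apply: (@eps_le _ _ (u al be + tl r0 + 1)); first by rewrite !addr_ge0.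
move=> e e0 e1; apply: (@le_trans _ _ ((u al be + e) * (tl r0 + e))); last by nra.
have mI : measurable (`]al, be[%classic : set (measurableTypeR R)) by exact: measurable_itv.
rewrite -lee_fin fineK ?crossing_law_fin// crossing_lawE//.
pose C n := \bigcup_k cell (time n) `]al, be] `[s - be, +oo[ k.
pose G N := \bigcap_(n in [set n | (N <= n)%N]) C n.
have mC n : measurable (C n).
  apply: bigcupT_measurable => k; apply: measurable_cell => //; exact: measurable_itv.
have mG N : measurable (G N).
  by apply: bigcap_measurable => [|n _]; [exists N => /=|exact: mC].
have ndG : {homo G : n m / (n <= m)%N >-> (n <= m)%O}.
  by move=> n m nm; apply/subsetPset => w H k /= mk; apply: H => /=; exact: leq_trans mk.
apply: (@le_trans _ _ (P (\bigcup_N G N))).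
  apply: le_measure; rewrite ?inE.
  - exact: measurable_cross.
  - exact: bigcupT_measurable.
  move=> w [cr]; rewrite /= in_itv/= => /andP[alD Dbe].
  have [N _ hN] := crossing_sub_cells s0 al0 bes cr alD Dbe.
  by exists N => // n /hN[k ck]; exists k.
have c1 := nondecreasing_cvg_mu (mu := P) mG (bigcupT_measurable _ mG) ndG.
rewrite -(cvg_lim _ c1)//; apply: lime_le; first by apply/cvg_ex; exists (P (\bigcup_N G N)).
by apply: nearW => N; exact: upper.
Qed.

(** The crossing contains the upper limit of the events that some cell occurs, whose probabilities
   are such products exactly, since the cells are disjoint. *)
Lemma crossing_law_ge al be r1 : 0 <= al -> al <= be -> be < s -> s - al < r1 ->
  u al be * tl r1 <= fine (crossing_law `[al, be]%classic).
Proof.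
move=> al0 ab bes r1s.
have u0 : 0 <= u al be by rewrite fine_ge0.
have t0 := tl_ge0 r1.
apply: (@eps_le _ _ (u al be + tl r1)); first by rewrite !addr_ge0.
move=> e e0 e1; rewrite -lerBlDr.
have mI : measurable (`[al, be]%classic : set (measurableTypeR R)) by exact: measurable_itv.
rewrite -lee_fin fineK ?crossing_law_fin// crossing_lawE//.
pose C n := \bigcup_k cell (time n) `]al, be] `]s - al, +oo[ k.
pose G N := \bigcup_(n in [set n | (N <= n)%N]) C n.
have mC n : measurable (C n).
  apply: bigcupT_measurable => k; apply: measurable_cell => //; exact: measurable_itv.
have mG N : measurable (G N) by apply: bigcup_measurable => n _; exact: mC.
have niG : {homo G : n m / (n <= m)%N >-> (m <= n)%O}.
  by move=> n m nm; apply/subsetPset => w [k /= mk Ck]; exists k => //=; exact: leq_trans mk.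
apply: (@le_trans _ _ (P (\bigcap_N G N))); last first.
  apply: le_measure; rewrite ?inE.
  - by apply: bigcapT_measurable.
  - exact: measurable_cross.
  move=> w H; have [|cr h1 h2] := @cells_sub_crossing s al be w s0 al0 bes.
    by move=> N; have [n Nn [k _ ck]] := H N I; exists n => //; exists k.
  by split=> //=; rewrite in_itv/= h1.
have G0 : (P (G 0%N) < +oo)%E by rewrite ltey_eq fin_num_measure.
have c1 := nonincreasing_cvg_mu (mu := P) G0 mG (bigcapT_measurable mG) niG.
rewrite -(cvg_lim _ c1)//; apply: lime_ge; first by apply/cvg_ex; exists (P (\bigcap_N G N)).
by apply: nearW => N; exact: lower.
Qed.

End crossing_law.

(** * Measures squeezed between products *)

Section sandwich.
Context {R : realType}.
Variables (s : R) (tl : R -> R) (V : R -> R -> R).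
Hypothesis tl_ge0 : forall r, 0 <= tl r.
Hypothesis tl_ni : forall r r', 0 < r -> r <= r' -> tl r' <= tl r.
Hypothesis V_lip : forall a b, 0 < a -> a <= b -> exists2 B, 0 <= B &
  forall x y, a <= x -> x <= y -> y <= b -> 0 <= V x y <= B * (y - x).

(** Measures that lie, on every interval, between the two products of its $V$-mass with values of the
   nonincreasing function at distance slightly more and slightly less from $s$ than the interval. *)
Definition sandwiched (m : {measure set (measurableTypeR R) -> \bar R}) :=
  forall x y r0 r1, 0 < x -> x <= y -> y < s -> 0 < r0 -> r0 < s - y -> s - x < r1 ->
  m `]x, y]%classic \is a fin_num /\ V x y * tl r1 <= fine (m `]x, y]%classic) <= V x y * tl r0.

Section pair.
Variables m1 m2 : {measure set (measurableTypeR R) -> \bar R}.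
Hypothesis sw1 : sandwiched m1.
Hypothesis sw2 : sandwiched m2.

Let ocU x y z : x <= y -> y <= z ->
  `]x, z]%classic = `]x, y]%classic `|` `]y, z]%classic :> set (measurableTypeR R).
Proof.
move=> xy yz; apply/seteqP; split=> t; rewrite /= !in_itv/=.
  by move=> /andP[-> tz]; rewrite tz andbT; case: (leP t y); [left|right].
by move=> [/andP[-> ty]|/andP[yt ->]]; rewrite ?(le_trans ty)// (le_lt_trans xy).
Qed.

Let ocI x y z : `]x, y]%classic `&` `]y, z]%classic = set0 :> set (measurableTypeR R).
Proof.
apply/seteqP; split=> // t [] /=; rewrite !in_itv/= => /andP[_ ty] /andP[yt _].
by move: (le_lt_trans ty yt); rewrite ltxx.
Qed.

Let fin1 x y : 0 < x -> x <= y -> y < s -> m1 `]x, y]%classic \is a fin_num /\ m2 `]x, y]%classic \is a fin_num.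
Proof.
move=> x0 xy ys; pose r0 := (s - y) / 2; pose r1 := s - x + 1.
have r00 : 0 < r0 by rewrite divr_gt0// subr_gt0.
have r0s : r0 < s - y by rewrite ltr_pdivrMr// ltr_pMr ?subr_gt0// ltr1n.
have r1s : s - x < r1 by rewrite ltrDl.
by have [] := sw1 x0 xy ys r00 r0s r1s; have [] := sw2 x0 xy ys r00 r0s r1s.
Qed.

Let del x y := fine (m1 `]x, y]%classic) - fine (m2 `]x, y]%classic).

Let del_add x y z : 0 < x -> x <= y -> y <= z -> z < s -> del x z = del x y + del y z.
Proof.
move=> x0 xy yz zs; have ys := le_lt_trans yz zs; have y0 := lt_le_trans x0 xy.
have [a1 a2] := fin1 x0 xy ys; have [b1 b2] := fin1 y0 yz zs.
rewrite /del (ocU xy yz) !measureU//; try exact: measurable_itv; try exact: ocI.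
by rewrite !fineD//; ring.
Qed.

Let del_le x y e : 0 < x -> x <= y -> 0 < e -> y + e < s ->
  `|del x y| <= V x y * (tl (s - (y + e)) - tl (s - (x - e))).
Proof.
move=> x0 xy e0 ys; have ys' : y < s by lra.
have h1 : 0 < s - (y + e) by lra.
have h2 : s - (y + e) < s - y by lra.
have h3 : s - x < s - (x - e) by lra.
have [_ /andP[a1 a2]] := sw1 x0 xy ys' h1 h2 h3.
have [_ /andP[b1 b2]] := sw2 x0 xy ys' h1 h2 h3.
by rewrite ler_norml mulrBr /del; apply/andP; split; lra.
Qed.

(** Over a subdivision into $N$ intervals of length $e$, the two measures of a piece differ by at most
   $Be$ times the increment of $tl$ over a slightly longer interval. These increments telescope, and
   the sum is $O(1/N)$. *)
Lemma sandwiched_eq_itv a b : 0 < a -> a <= b -> b < s -> m1 `]a, b]%classic = m2 `]a, b]%classic.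
Proof.
move=> a0 ab bs; have [f1 f2] := fin1 a0 ab bs.
rewrite -(fineK f1) -(fineK f2); congr EFin; apply/eqP; rewrite -subr_eq0 -normr_le0 -/(del a b).
have [B B0 HB] := V_lip a0 ab.
pose c := tl ((s - b) / 2); have c0 : 0 <= c := tl_ge0 _.
have key (N : nat) : (0 < N)%N -> (b - a) / N%:R < (s - b) / 2 ->
    `|del a b| <= 3 * B * c * (b - a) / N%:R.
  move=> N0 Ns; pose e := (b - a) / N%:R.
  have [->|ab'] := eqVneq a b.
    by rewrite /del set_itv_ge ?bnd_simp ?ltxx// !measure0 subrr normr0 subrr mulr0 mul0r.
  have N0' : 0 < N%:R :> R by rewrite ltr0n.
  have e0 : 0 < e by rewrite divr_gt0// subr_gt0 lt_neqAle ab'.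
  pose x (j : nat) := a + j%:R * e.
  have xS j : x j.+1 = x j + e by rewrite /x -natr1; ring.
  have xN : x N = b by rewrite /x /e mulrCA mulfV ?gt_eqF// mulr1; ring.
  have xle i j : (i <= j)%N -> x i <= x j by move=> ij; rewrite lerD2l ler_wpM2r ?(ltW e0)// ler_nat.
  have x0 : x 0%N = a by rewrite /x mul0r addr0.
  pose G (j : nat) := tl (s - (x j - e)).
  have G0 j : 0 <= G j := tl_ge0 _.
  (* The bracketing points are moved by one step on each side, so the increments overlap three
     by three and three boundary terms remain. *)
  have ind j : (j <= N)%N -> `|del a (x j)| <= B * e * (G j + G j.+1 + G j.+2 - (G 0%N + G 1%N + G 2%N)).
    elim: j => [_|j IH jN].
      rewrite x0 subrr mulr0 /del set_itv_ge ?bnd_simp ?ltxx// !measure0 subrr normr0//.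
    have aj : a <= x j by rewrite -x0 xle.
    have jb : x j.+1 <= b by rewrite -xN xle.
    have jj : x j <= x j.+1 by rewrite xle.
    have xj0 : 0 < x j := lt_le_trans a0 aj.
    rewrite (del_add a0 aj jj (le_lt_trans jb bs)).
    apply: (le_trans (ler_normD _ _)).
    have h1 := IH (ltnW jN).
    have es : x j.+1 + e < s by rewrite /e in Ns *; lra.
    have h2 := del_le xj0 jj e0 es.
    have /andP[v0 v1] := HB _ _ aj jj jb.
    have E1 : s - (x j.+1 + e) = s - (x j.+3 - e) by rewrite !xS; ring.
    rewrite E1 -/(G j) -/(G j.+3) in h2.
    have g3 : G j <= G j.+3.
      apply: tl_ni; first by rewrite -E1 subr_gt0.
      by rewrite lerD2l lerN2 lerD2r xle// !leqW.
    have ve : V (x j) (x j.+1) <= B * e by apply: (le_trans v1); rewrite xS; lra.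
    have h3 : V (x j) (x j.+1) * (G j.+3 - G j) <= B * e * (G j.+3 - G j).
      by rewrite ler_wpM2r// subr_ge0.
    by move: h1 h2 h3; lra.
  have := ind N (leqnn _); rewrite xN => /le_trans; apply.
  have Gc j : (j <= N.+2)%N -> G j <= c.
    move=> jN; apply: tl_ni; first by rewrite divr_gt0// subr_gt0.
    have : x j <= x N.+2 by rewrite xle.
    by rewrite !xS xN /e in Ns *; lra.
  rewrite (_ : 3 * B * c * (b - a) / N%:R = B * e * (c + c + c)); last by rewrite /e; ring.
  apply: ler_wpM2l; first by rewrite mulr_ge0// ltW.
  have := Gc N (leqW (leqnSn _)); have := Gc N.+1 (leqnSn _); have := Gc N.+2 (leqnn _).
  by have := G0 0%N; have := G0 1%N; have := G0 2%N; lra.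
rewrite leNgt; apply/negP => d0.
pose K := 3 * B * c * (b - a); have K0 : 0 <= K by rewrite !mulr_ge0// subr_ge0.
have sb : 0 < (s - b) / 2 by rewrite divr_gt0// subr_gt0.
pose y := (b - a) / ((s - b) / 2) + K / `|del a b|.
have y1 : 0 <= (b - a) / ((s - b) / 2) by rewrite divr_ge0 ?(ltW sb)// subr_ge0.
have y2 : 0 <= K / `|del a b| by rewrite divr_ge0.
have hN := truncnS_gt y; set N := (Num.truncn y).+1 in hN.
have N0 : 0 < N%:R :> R by rewrite ltr0n.
have := key N isT; rewrite ltr_pdivrMr// -ltr_pdivrMl//.
have -> : ((s - b) / 2)^-1 * (b - a) < N%:R by rewrite mulrC; apply: le_lt_trans hN; rewrite lerDl.
move=> /(_ isT); rewrite ler_pdivlMr// -ler_pdivlMl// mulrC -/K leNgt.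
by rewrite (le_lt_trans _ hN)// lerDr.
Qed.

Lemma sandwiched_eq A : measurable (A : set (measurableTypeR R)) -> A `<=` `]0, s[ -> m1 A = m2 A.
Proof.
move=> mA sA.
have [s0|s0] := leP s 0.
  suff -> : A = set0 by rewrite !measure0.
  apply/seteqP; split=> // x /sA; rewrite /= in_itv/= => /andP[x0 xs].
  by move: (lt_trans x0 xs); rewrite ltNge s0.
have q0 (n : nat) : 0 < s / n.+2%:R by rewrite divr_gt0.
have q2 (n : nat) : s / n.+2%:R <= s / 2 by rewrite ler_pM2l// lef_pV2 ?posrE// ler_nat.
have qm (m n : nat) : (m <= n)%N -> s / n.+2%:R <= s / m.+2%:R.
  by move=> mn; rewrite ler_pM2l// lef_pV2 ?posrE// ler_nat.
apply: (@measure_eq_exhaust R m1 m2 (fun n => s / n.+2%:R) (fun n => s - s / n.+2%:R)) => //.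
- by move=> m n mn; rewrite lerD2l lerN2 qm.
- move=> n a b na ab bn; apply: sandwiched_eq_itv => //; first exact: lt_le_trans na.
  by apply: (le_lt_trans bn); rewrite ltrBlDr ltrDl.
- move=> n; have [||] := @fin1 (s / n.+2%:R) (s - s / n.+2%:R) (q0 n); last by rewrite ltey_eq => -> .
    have aux (v : R) : v <= s / 2 -> v <= s - v by lra.
    exact: aux (q2 n).
  by rewrite ltrBlDr ltrDl.
- move=> x /sA; rewrite /= in_itv/= => /andP[x0 xs].
  have sx : 0 < s - x by rewrite subr_gt0.
  have h := truncnS_gt (s / x + s / (s - x)).
  exists (Num.truncn (s / x + s / (s - x))) => //=; rewrite in_itv/=.
  have h2 : s / x + s / (s - x) < (Num.truncn (s / x + s / (s - x))).+2%:R.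
    by apply: (lt_trans h); rewrite ltr_nat.
  have a1 : 0 <= s / x by rewrite divr_ge0 ?ltW.
  have a2 : 0 <= s / (s - x) by rewrite divr_ge0 ?ltW.
  move: h2; set N := _.+2%:R => h2; have N0 : 0 < N by apply: le_lt_trans h2; rewrite addr_ge0.
  apply/andP; split.
    by rewrite ltr_pdivrMr// mulrC -ltr_pdivrMr//; apply: le_lt_trans h2; rewrite lerDl.
  rewrite lerBrDr -lerBrDl; apply: ltW.
  by rewrite ltr_pdivrMr// mulrC -ltr_pdivrMr//; apply: le_lt_trans h2; rewrite lerDr.
Qed.

End pair.

End sandwich.

(** * The density of the undershoot *)

Section crossing_density.
Context {R : realType}.
Notation mu := (@lebesgue_measure R).
Variables (s : R) (U F : {measure set (measurableTypeR R) -> \bar R}) (u tl : R -> R).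
Local Notation D0 := (`]0%R, +oo[%classic : set (measurableTypeR R)).
Local Notation V x y := (fine (U `]x, y]%classic)).
Hypothesis u_ge0 : forall x, 0 < x -> 0 <= u x.
Hypothesis cu : forall x, 0 < x -> {for x, continuous u}.
Hypothesis uE : forall A, measurable (A : set (measurableTypeR R)) -> A `<=` D0 ->
  U A = (\int[mu]_(x in A) (u x)%:E)%E.
Hypothesis tl_ge0 : forall r, 0 <= tl r.
Hypothesis tl_ni : forall r r', 0 < r -> r <= r' -> tl r' <= tl r.
Hypothesis F_fin : forall A, measurable (A : set (measurableTypeR R)) -> F A \is a fin_num.
Hypothesis F_le : forall al be r0, 0 <= al -> al <= be -> be < s -> 0 < r0 -> r0 < s - be ->
  fine (F `]al, be[%classic) <= V al be * tl r0.
Hypothesis F_ge : forall al be r1, 0 <= al -> al <= be -> be < s -> s - al < r1 ->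
  V al be * tl r1 <= fine (F `[al, be]%classic).

Let ocD x y : 0 <= x -> `]x, y]%classic `<=` D0.
Proof. by move=> x0 t; rewrite /= !in_itv/= andbT => /andP[xt _]; exact: le_lt_trans xt. Qed.

Let iu x y : 0 < x -> mu.-integrable `]x, y] (EFin \o u).
Proof.
move=> x0; apply: (@integrableS _ _ _ mu `[x, y]); [exact: measurable_itv|exact: measurable_itv| |].
  by move=> t; rewrite /= !in_itv/= => /andP[/ltW -> ->].
exact: continuous_segment_integrable.
Qed.

Let VE x y : 0 < x -> V x y = \int[mu]_(t in `]x, y]) u t.
Proof. by move=> x0; rewrite uE//; exact/ocD/ltW. Qed.

Let U_fin x y : 0 < x -> U `]x, y]%classic \is a fin_num.
Proof.
move=> x0; rewrite uE; [|exact: measurable_itv|exact/ocD/ltW].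
by apply: integrable_fin_num; [exact: measurable_itv|exact: iu].
Qed.

Let V_ge0 x y : 0 <= V x y. Proof. by rewrite fine_ge0. Qed.

Let V_lip a b : 0 < a -> a <= b -> exists2 B, 0 <= B &
  forall x y, a <= x -> x <= y -> y <= b -> 0 <= V x y <= B * (y - x).
Proof.
move=> a0 ab.
have cab : {within `[a, b], continuous u}.
  apply: continuous_in_subspaceT => x; rewrite inE/= in_itv/= => /andP[ax _].
  by apply: cu; exact: lt_le_trans ax.
have [c ci cmax] := EVT_max ab cab.
have c0 : 0 < c by move: ci; rewrite in_itv/= => /andP[ac _]; exact: lt_le_trans ac.
exists (u c); first exact: u_ge0.
move=> x y ax xy yb; rewrite V_ge0/=; have x0 : 0 < x := lt_le_trans a0 ax.
rewrite VE//.
have -> : u c * (y - x) = \int[mu]_(t in `]x, y]) u c.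
  rewrite Rintegral_cst; last exact: measurable_itv.
  congr (_ * _); have h := lebesgue_measure_itv (`]x, y] : interval R).
  have {}h : lebesgue_measure (`]x, y]%classic : set R) = (y - x)%:E.
    rewrite h /= lte_fin; case: ltP => [_|yx]; first by rewrite EFinB.
    by rewrite (le_anti (introT andP (conj xy yx))) subrr.
  by rewrite (_ : fine _ = y - x)//; exact: (congr1 fine h).
apply: le_Rintegral.
- exact: measurable_itv.
- exact: iu.
- apply: (@integrableS _ _ _ mu `[x, y]); [exact: measurable_itv|exact: measurable_itv| |].
    by move=> t; rewrite /= !in_itv/= => /andP[/ltW -> ->].
  by apply: continuous_segment_integrable => // t _; exact: cvg_cst.
- move=> t; rewrite /= in_itv/= => /andP[xt ty]; apply: cmax.
  by rewrite in_itv/= (le_trans ax (ltW xt)) (le_trans ty).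
Qed.

Let V_add x y z : 0 < x -> x <= y -> y <= z -> V x z = V x y + V y z.
Proof.
move=> x0 xy yz; rewrite -fineD ?U_fin//; last exact: lt_le_trans xy.
rewrite -measureU; [|exact: measurable_itv|exact: measurable_itv|].
  congr (fine (U _)); apply/seteqP; split=> t; rewrite /= !in_itv/=.
    by move=> /andP[-> tz]; rewrite tz andbT; case: (leP t y); [left|right].
  by move=> [/andP[-> ty]|/andP[yt ->]]; rewrite ?(le_trans ty)// (le_lt_trans xy).
apply/seteqP; split=> // t [] /=; rewrite !in_itv/= => /andP[_ ty] /andP[yt _].
by move: (le_lt_trans ty yt); rewrite ltxx.
Qed.

Let F_mono A B : measurable (A : set (measurableTypeR R)) -> measurable (B : set (measurableTypeR R)) ->
  A `<=` B -> fine (F A) <= fine (F B).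
Proof. by move=> mA mB AB; apply: fine_le; rewrite ?F_fin//; apply: le_measure; rewrite ?inE. Qed.

Let vanish (x y c d : R) : 0 <= c -> 0 < d -> (forall e, 0 < e -> e < d -> x <= y + e * c) -> x <= y.
Proof.
move=> c0 d0 H; apply/ler_addgt0Pr => e e0.
have c1 : 0 < c + 1 by rewrite ltr_wpDl.
pose e' := Num.min (d / 2) (e / (c + 1)).
have e'0 : 0 < e' by rewrite lt_min !divr_gt0.
apply: (le_trans (H _ e'0 _)); first by rewrite gt_min ltr_pdivrMr// ltr_pMr// ltr1n.
rewrite lerD2l; apply: (@le_trans _ _ (e / (c + 1) * c)).
  by rewrite ler_wpM2r// ge_min lexx orbT.
by rewrite -mulrA ler_piMr ?(ltW e0)// mulrC ler_pdivrMr// mul1r lerDl.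
Qed.

Let F_sandwiched : sandwiched s tl (fun x y => V x y) F.
Proof.
move=> x y r0 r1 x0 xy ys r00 r0s r1s; split; first by apply: F_fin; exact: measurable_itv.
have [B B0 HB] := V_lip x0 (ltW (le_lt_trans xy ys)).
have t0 := tl_ge0 r0; have t1 := tl_ge0 r1.
apply/andP; split.
  have [xy'|xy'] := eqVneq x y.
    have /andP[v0 v1] := HB x x (lexx _) (lexx _) (ltW (le_lt_trans xy ys)).
    have vx : V x x = 0 by apply/eqP; rewrite eq_le v0 andbT (le_trans v1)// subrr mulr0.
    by rewrite -xy' vx mul0r fine_ge0.
  have xy2 : x < y by rewrite lt_neqAle xy'.
  apply: (@vanish _ _ (B * tl r1) (y - x)); rewrite ?mulr_ge0 ?subr_gt0//.
  move=> e e0 ed; have xe : x <= x + e by lra.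
  have ey : x + e <= y by lra.
  have /andP[_ v1] := HB x (x + e) (lexx _) xe (le_trans ey (ltW ys)).
  have h1 : V (x + e) y * tl r1 <= fine (F `[x + e, y]%classic).
    by apply: F_ge => //; lra.
  have h2 : fine (F `[x + e, y]%classic) <= fine (F `]x, y]%classic).
    apply: F_mono; [exact: measurable_itv|exact: measurable_itv|].
    by move=> t; rewrite /= !in_itv/= => /andP[h ->]; rewrite andbT; lra.
  rewrite (V_add x0 xe ey) mulrDl.
  have h3 : V x (x + e) * tl r1 <= e * (B * tl r1).
    by rewrite mulrA ler_wpM2r//; lra.
  lra.
apply: (@vanish _ _ (B * tl r0) (s - y - r0)); rewrite ?mulr_ge0//; first by lra.
move=> e e0 ed; have ye : y <= y + e by lra.
have yes : y + e <= s by lra.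
have /andP[_ v1] := HB y (y + e) xy ye yes.
have h1 : fine (F `]x, (y + e)[%classic) <= V x (y + e) * tl r0.
  by apply: F_le; lra.
have h2 : fine (F `]x, y]%classic) <= fine (F `]x, (y + e)[%classic).
  apply: F_mono; [exact: measurable_itv|exact: measurable_itv|].
  by move=> t; rewrite /= !in_itv/= => /andP[-> h] /=; lra.
rewrite (V_add x0 xy ye) mulrDl in h1.
have h3 : V y (y + e) * tl r0 <= e * (B * tl r0).
  by rewrite mulrA ler_wpM2r//; lra.
lra.
Qed.

(** A monotone function of $y$ from which $tl(s-y)$ is recovered; it gives the measurability of the latter. *)
Let damp (y : R) : R := if y < s then (1 + tl (s - y))^-1 else 0.

Let damp_ni : {homo damp : m n /~ n <= m}.
Proof.
move=> y x yx; rewrite /damp.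
have t1 r : 0 < 1 + tl r by rewrite ltr_pwDl.
case: (ltP x s) => xs; last by case: ifP => // _; rewrite invr_ge0 ltW.
rewrite (le_lt_trans yx)// lef_pV2 ?posrE// lerD2l tl_ni ?subr_gt0//.
by rewrite lerD2l lerN2.
Qed.

Let mdamp : measurable_fun [set: measurableTypeR R] damp.
Proof. by apply: nonincreasing_measurable. Qed.

Let g (y : R) : R := (u \_ (`]0, s[%classic : set R)) y * (damp y `^ (- 1) - 1).

Let gE y : 0 < y -> y < s -> g y = u y * tl (s - y).
Proof.
move=> y0 ys; rewrite /g patchE mem_set; last by rewrite /= in_itv/= y0.
rewrite /damp ys powR_inv1 ?invr_ge0 ?addr_ge0// invrK.
by congr (_ * _); ring.
Qed.

Let mg : measurable_fun [set: measurableTypeR R] g.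
Proof.
apply: measurable_funM.
  apply/(measurable_restrictT _ _).1; first exact: measurable_itv.
  apply: open_continuous_measurable_fun => //.
  by move=> x; rewrite inE/= in_itv/= => /andP[x0 _]; exact: cu.
apply: measurable_funB => //.
exact: (measurableT_comp (measurable_powR _) mdamp).
Qed.

Lemma measurable_crossing_density :
  measurable_fun (`]0, s[%classic : set (measurableTypeR R)) (fun y => u y * tl (s - y)).
Proof.
apply: (@eq_measurable_fun _ _ _ _ _ g); last exact: measurable_funTS.
by move=> y; rewrite inE/= in_itv/= => /andP[? ?]; exact: gE.
Qed.

Let g_ge0 y : 0 <= g y.
Proof.
rewrite {1}/g patchE; case: ifPn => [|_]; last by rewrite mul0r.
rewrite inE/= in_itv/= => /andP[y0 ys].
have := gE y0 ys; rewrite /g patchE mem_set; last by rewrite /= in_itv/= y0.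
by move=> ->; rewrite mulr_ge0// u_ge0.
Qed.

Let F2 : {measure set (measurableTypeR R) -> \bar R} :=
  weighted_law mu mg g_ge0 (@measurable_id _ (measurableTypeR R) setT).

Let F2_sandwiched : sandwiched s tl (fun x y => V x y) F2.
Proof.
move=> x y r0 r1 x0 xy ys r00 r0s r1s.
have m1 : measurable (`]x, y]%classic : set (measurableTypeR R)) by exact: measurable_itv.
have F2E : F2 `]x, y]%classic = (\int[mu]_(t in `]x, y]) (g t)%:E)%E.
  by rewrite /F2 /= /weighted_law preimage_id.
have inD t : `]x, y]%classic t -> [/\ 0 < t, t < s & u t * tl r1 <= g t <= u t * tl r0].
  rewrite /= in_itv/= => /andP[xt ty]; have t0 : 0 < t := lt_trans x0 xt.
  have ts : t < s := le_lt_trans ty ys; split=> //; rewrite gE//.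
  rewrite !ler_wpM2l ?u_ge0//= ?andbT.
    by apply: tl_ni => //; lra.
  by apply: tl_ni => //; lra.
have iu0 r : mu.-integrable `]x, y] (EFin \o (fun t => tl r * u t)).
  by apply: integrable_scale => //; exact: iu.
have iV r : (\int[mu]_(t in `]x, y]) (u t * tl r)%:E)%E = (V x y * tl r)%:E.
  rewrite VE// mulrC -RintegralZl//; last exact: iu.
  rewrite /Rintegral fineK; last by apply: integrable_fin_num => //; exact: iu0.
  by apply: eq_integral => t _; rewrite mulrC.
have mgE : measurable_fun `]x, y] (EFin \o g) by apply/measurable_EFinP; exact: measurable_funTS.
have mu' r : measurable_fun `]x, y] (fun t => (u t * tl r)%:E).
  by have := measurable_int _ (iu0 r); apply: eq_measurable_fun => t _; rewrite /= mulrC.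
have hi : (F2 `]x, y]%classic <= (V x y * tl r0)%:E)%E.
  rewrite F2E -iV; apply: ge0_le_integral => //.
  - by move=> t _; rewrite lee_fin.
  - exact: mu'.
  - by move=> t /inD[t0 _ /andP[_ h]]; rewrite lee_fin.
have lo : ((V x y * tl r1)%:E <= F2 `]x, y]%classic)%E.
  rewrite F2E -iV; apply: ge0_le_integral => //.
  - by move=> t /inD[t0 _ _]; rewrite lee_fin mulr_ge0// u_ge0.
  - exact: mu'.
  - by move=> t /inD[t0 _ /andP[h _]]; rewrite lee_fin.
have ff : F2 `]x, y]%classic \is a fin_num.
  by rewrite ge0_fin_numE//; apply: le_lt_trans hi _; rewrite ltry.
split=> //; rewrite -(fineK ff) in hi lo.
by rewrite -!lee_fin lo hi.
Qed.

(** The measure on the right is squeezed between the same products as $F$. *)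
Theorem crossing_density A : measurable (A : set (measurableTypeR R)) -> A `<=` `]0, s[ ->
  F A = (\int[mu]_(y in A) (u y * tl (s - y))%:E)%E.
Proof.
move=> mA sA; rewrite (sandwiched_eq tl_ge0 tl_ni V_lip F_sandwiched F2_sandwiched mA sA).
rewrite /F2 /= /weighted_law preimage_id; apply: eq_integral => y; rewrite inE => /sA.
by rewrite /= in_itv/= => /andP[y0 ys]; rewrite gE.
Qed.

End crossing_density.

(** * The expansion and its integral *)

Section expansion.
Context {R : realType}.
Notation mu := (@lebesgue_measure R).

(** At $b=1$ both sides vanish, as $1/\Gamma(0)=0$; this is the case excluded from the integral proof. *)
Lemma rgamma_reflection (b : R) : 0 < b <= 1 -> rgamma b * rgamma (1 - b) = sin (pi * b) / pi.
Proof.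
move=> /andP[b0]; rewrite le_eqVlt => /orP[/eqP ->|b1].
  by rewrite subrr rgamma0 mulr0 mulr1 sinpi mul0r.
have p0 : pi != 0 :> R by rewrite gt_eqF ?pi_gt0.
have b'0 : 0 < 1 - b by rewrite subr_gt0.
have aux (g h S : R) : g * h * S = pi -> g^-1 / h = S / pi.
  move=> E; have /and3P[g0 h0 S0] : [&& g != 0, h != 0 & S != 0].
    by move: p0; rewrite -E !mulf_eq0 !negb_or -andbA.
  by rewrite -E invfM mulrCA mulfV// mulr1 invfM.
by rewrite !rgammaE//; apply: aux; apply: gamma_reflection; rewrite b0.
Qed.

Lemma Rintegral_lincomb (D : set (measurableTypeR R)) (r : seq nat) (a : nat -> R) (g : nat -> R -> R) :
  measurable D -> (forall k, mu.-integrable D (EFin \o g k)) ->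
  mu.-integrable D (EFin \o (fun x => \sum_(k <- r) a k * g k x)) /\
  \int[mu]_(x in D) (\sum_(k <- r) a k * g k x) = \sum_(k <- r) a k * \int[mu]_(x in D) g k x.
Proof.
move=> mD ig; elim: r => [|k r [IH1 IH2]].
  split.
    rewrite (_ : _ \o _ = fun=> 0%E); first exact: integrable0.
    by apply/funext => x; rewrite /= big_nil.
  rewrite big_nil; under eq_Rintegral do rewrite big_nil.
  by rewrite Rintegral_cst// mul0r.
have ik := integrable_scale (a k) mD (ig k).
have E : (fun x => \sum_(j <- k :: r) a j * g j x) = (fun x => a k * g k x + \sum_(j <- r) a j * g j x).
  by apply/funext => x; rewrite big_cons.
rewrite E; split.
  by have := integrableD mD ik IH1; apply: eq_integrable.
by rewrite RintegralD// RintegralZl// IH2 big_cons.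
Qed.

Variables (n : nat) (c beta : nat -> R) (Pi : {measure set R -> \bar R}).
Hypothesis hc0 : 0 < c 0%N.
Hypothesis hbeta0 : 0 < beta 0%N <= 1.
Hypothesis Pi_fin : forall x, 0 < x -> (Pi `]x, +oo[%classic < +oo)%E.

Local Notation W := (power_density c beta n.+1).

Lemma levy_tail_ge0 x : 0 <= levy_tail Pi x.
Proof. exact: fine_ge0. Qed.

Lemma levy_tail_ni r r' : 0 < r -> r <= r' -> levy_tail Pi r' <= levy_tail Pi r.
Proof.
move=> r0 rr; have r'0 := lt_le_trans r0 rr.
apply: fine_le; rewrite ?ge0_fin_numE ?Pi_fin//.
apply: le_measure; rewrite ?inE; [exact: measurable_itv|exact: measurable_itv|].
by move=> x; rewrite /= !in_itv/= !andbT; exact: le_lt_trans.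
Qed.

Definition expansion (s x : R) : R :=
  sin (pi * beta 0%N) / pi * x `^ (- 1 + beta 0%N) * (1 - x) `^ (- beta 0%N) +
  \sum_(1 <= k < n.+1)
    (c 0%N * s `^ (beta k - beta 0%N) / c k * rgamma (beta k) * rgamma (1 - beta 0%N)
      * x `^ (- 1 + beta k) * (1 - x) `^ (- beta 0%N)) +
  \sum_(0 <= k < n.+1)
    (s `^ (beta k) / c k * rgamma (beta k) * x `^ (- 1 + beta k)
      * eps2 Pi (c 0%N) (beta 0%N) (s - s * x)).

Let rearrange (C S B K G X Y L : R) :
  S / K * G * X * (C * (B * Y) * L) = C * (S * B) / K * G * L * X * Y.
Proof. ring. Qed.

(** By definition of $\varepsilon_2$ the terms with $(1-x)^{-\beta}$ complete those with $\varepsilon_2$ to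
   the Levy tail. The term of index $0$ is written with a sine instead of two gamma factors, which is
   the reflection formula. *)
Lemma expansionE s x : 0 < s -> 0 < x < 1 ->
  expansion s x = s * levy_tail Pi (s - s * x) * W (s * x).
Proof.
move=> s0 /andP[x0 x1]; rewrite /expansion.
have x10 : 0 < 1 - x by rewrite subr_gt0.
pose B := beta 0%N; pose L := levy_tail Pi (s - s * x).
pose e := c 0%N * (s - s * x) `^ (- B) * rgamma (1 - B).
have eE : eps2 Pi (c 0%N) B (s - s * x) = L - e by [].
have -> : s * L * W (s * x) = \sum_(0 <= k < n.+1) (s `^ (beta k) / c k * rgamma (beta k) * x `^ (- 1 + beta k) * L).
  rewrite /power_density mulr_sumr; apply: eq_bigr => k _.
  rewrite powRM ?(ltW s0) ?(ltW x0)//.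
  have -> : s `^ (beta k) = s * s `^ (beta k - 1).
    by rewrite -[X in _ = X * _](powRr1 (ltW s0)) -powRD ?(gt_eqF s0) ?implybT// addrC subrK.
  by rewrite (addrC (-1)); ring.
have -> : \sum_(0 <= k < n.+1) (s `^ (beta k) / c k * rgamma (beta k) * x `^ (- 1 + beta k) * eps2 Pi (c 0%N) B (s - s * x)) =
  \sum_(0 <= k < n.+1) (s `^ (beta k) / c k * rgamma (beta k) * x `^ (- 1 + beta k) * L) -
  \sum_(0 <= k < n.+1) (s `^ (beta k) / c k * rgamma (beta k) * x `^ (- 1 + beta k) * e).
  by rewrite -sumrB; apply: eq_bigr => k _; rewrite eE mulrBr.
have -> : \sum_(0 <= k < n.+1) (s `^ (beta k) / c k * rgamma (beta k) * x `^ (- 1 + beta k) * e) =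
   sin (pi * B) / pi * x `^ (- 1 + B) * (1 - x) `^ (- B) +
   \sum_(1 <= k < n.+1) (c 0%N * s `^ (beta k - B) / c k * rgamma (beta k) * rgamma (1 - B) * x `^ (- 1 + beta k) * (1 - x) `^ (- B)).
  have eS k : s `^ (beta k) / c k * rgamma (beta k) * x `^ (- 1 + beta k) * e =
     c 0%N * s `^ (beta k - B) / c k * rgamma (beta k) * rgamma (1 - B) * x `^ (- 1 + beta k) * (1 - x) `^ (- B).
    rewrite /e (_ : s - s * x = s * (1 - x)); last by ring.
    have E1 : (s * (1 - x)) `^ (- B) = s `^ (- B) * (1 - x) `^ (- B) by apply: powRM; exact: ltW.
    have hs : (beta k + - B == 0) ==> (s != 0) by rewrite gt_eqF// implybT.
    have E2 : s `^ (beta k - B) = s `^ (beta k) * s `^ (- B) := powRD hs.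
    by rewrite E1 E2; exact: rearrange.
  rewrite big_ltn// eS subrr powRr0 mulr1 mulfV ?gt_eqF// mul1r rgamma_reflection//.
  by congr (_ + _); apply: eq_bigr => k _; exact: eS.
ring.
Qed.

Section integrated.
Variables (p q s : R).
Hypothesis p0 : 0 < p.
Hypothesis q1 : q < 1.
Hypothesis s0 : 0 < s.
Notation I := (`[p, q]%classic : set (measurableTypeR R)).

Let mI : measurable I. Proof. exact: measurable_itv. Qed.
Let I01 x : p <= x <= q -> 0 < x < 1.
Proof. by move=> /andP[px xq]; rewrite (lt_le_trans p0 px) (le_lt_trans xq q1). Qed.

(** The tail is monotone, and bounded for $x\le q<1$. *)
Lemma integrable_tail_mul (f : R -> R) : (forall x, p <= x <= q -> {for x, continuous f}) ->
  mu.-integrable I (EFin \o (fun x => f x * levy_tail Pi (s - s * x))).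
Proof.
move=> cf; have m0 : 0 < s * (1 - q) by rewrite mulr_gt0// subr_gt0.
(* A version that is monotone on the whole line and agrees with the tail on the segment. *)
pose t x := levy_tail Pi (Num.max (s - s * x) (s * (1 - q))).
have max0 x : 0 < Num.max (s - s * x) (s * (1 - q)) by rewrite lt_max m0 orbT.
have mt : measurable_fun I t.
  apply: nondecreasing_measurable => //= x y xy; apply: levy_tail_ni => //.
  by rewrite ge_max !le_max lexx orbT andbT lerB// ler_wpM2l// ltW.
have bt : [bounded t x | x in I].
  exists (levy_tail Pi (s * (1 - q))); split; first exact: num_real.
  move=> M hM x _; rewrite /= ger0_norm ?levy_tail_ge0//; apply: le_trans (ltW hM).
  by apply: levy_tail_ni => //; rewrite le_max lexx orbT.
have := integrableMl mI (continuous_itv_integrable cf) mt bt; apply: eq_integrable => // x.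
rewrite inE/= in_itv/= => /andP[px xq]; rewrite /t max_l//.
by rewrite mulrBr mulr1 lerB// ler_wpM2l// ltW.
Qed.

Let cpow_lin k x : 0 < x -> {for x, continuous (fun x : R => x `^ (- 1 + beta k))}.
Proof. exact: continuous_powR. Qed.

Let csub (r : R) x : x < 1 -> {for x, continuous (fun x : R => (s - s * x) `^ r)}.
Proof.
move=> x1; apply: (@continuous_comp _ _ _ (fun x : R => s - s * x) (fun y : R => y `^ r)).
  by apply: cvgB; [exact: cvg_cst|apply: cvgMr; exact: cvg_id].
by apply: continuous_powR; rewrite subr_gt0 gtr_pMr.
Qed.

Let csub1 (r : R) x : x < 1 -> {for x, continuous (fun x : R => (1 - x) `^ r)}.
Proof.
move=> x1; apply: (@continuous_comp _ _ _ (fun x : R => 1 - x) (fun y : R => y `^ r)).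
  by apply: cvgB; [exact: cvg_cst|exact: cvg_id].
by apply: continuous_powR; rewrite subr_gt0.
Qed.

Let g k (x : R) := x `^ (- 1 + beta k) * (1 - x) `^ (- beta 0%N).
Let e k (x : R) := x `^ (- 1 + beta k) * eps2 Pi (c 0%N) (beta 0%N) (s - s * x).

Let ig k : mu.-integrable I (EFin \o g k).
Proof.
apply: continuous_itv_integrable => x /I01/andP[x0 x1].
by apply: cvgM; [exact: cpow_lin|exact: csub1].
Qed.

Let ie k : mu.-integrable I (EFin \o e k).
Proof.
have i1 := integrable_tail_mul (f := fun x => x `^ (- 1 + beta k))
  (fun x xI => cpow_lin (k := k) (proj1 (andP (I01 xI)))).
have i2 : mu.-integrable I (EFin \o (fun x => x `^ (- 1 + beta k) *
    (c 0%N * (s - s * x) `^ (- beta 0%N) * rgamma (1 - beta 0%N)))).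
  apply: continuous_itv_integrable => x /I01/andP[x0 x1].
  apply: cvgM; first exact: cpow_lin.
  by apply: cvgMl; apply: cvgMr; exact: csub.
have := integrableB mI i1 i2; apply: eq_integrable => // x _.
by rewrite /= /e /eps2 [in RHS]mulrBr.
Qed.

Lemma integral_expansion :
  mu.-integrable I (EFin \o expansion s) /\
  \int[mu]_(x in I) expansion s x =
    sin (pi * beta 0%N) / pi *
      \int[mu]_(x in I) (x `^ (- 1 + beta 0%N) * (1 - x) `^ (- beta 0%N)) +
    \sum_(1 <= k < n.+1)
      (c 0%N * s `^ (beta k - beta 0%N) / c k * rgamma (beta k) * rgamma (1 - beta 0%N)
        * \int[mu]_(x in I) (x `^ (- 1 + beta k) * (1 - x) `^ (- beta 0%N))) +
    \sum_(0 <= k < n.+1)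
      (s `^ (beta k) / c k * rgamma (beta k)
        * \int[mu]_(x in I) (x `^ (- 1 + beta k) * eps2 Pi (c 0%N) (beta 0%N) (s - s * x))).
Proof.
pose A := sin (pi * beta 0%N) / pi.
pose a k := c 0%N * s `^ (beta k - beta 0%N) / c k * rgamma (beta k) * rgamma (1 - beta 0%N).
pose b k := s `^ (beta k) / c k * rgamma (beta k).
have [i1 E1] := Rintegral_lincomb (index_iota 1 n.+1) a mI ig.
have [i2 E2] := Rintegral_lincomb (index_iota 0 n.+1) b mI ie.
have i0 := integrable_scale A mI (ig 0%N).
have E : expansion s = fun x => A * g 0%N x + \sum_(1 <= k < n.+1) a k * g k x +
    \sum_(0 <= k < n.+1) b k * e k x.
  apply/funext => x; rewrite /expansion.
  have F1 : \sum_(1 <= k < n.+1) a k * g k x = \sum_(1 <= k < n.+1)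
      (c 0%N * s `^ (beta k - beta 0%N) / c k * rgamma (beta k) * rgamma (1 - beta 0%N)
        * x `^ (- 1 + beta k) * (1 - x) `^ (- beta 0%N)).
    by apply: eq_bigr => k _; exact: mulrA.
  have F2 : \sum_(0 <= k < n.+1) b k * e k x = \sum_(0 <= k < n.+1)
      (s `^ (beta k) / c k * rgamma (beta k) * x `^ (- 1 + beta k)
        * eps2 Pi (c 0%N) (beta 0%N) (s - s * x)).
    by apply: eq_bigr => k _; exact: mulrA.
  by rewrite F1 F2 /g mulrA.
have i01 : mu.-integrable I (EFin \o (fun x => A * g 0%N x + \sum_(1 <= k < n.+1) a k * g k x)).
  by have := integrableD mI i0 i1; apply: eq_integrable.
rewrite E; split.
  by have := integrableD mI i01 i2; apply: eq_integrable.
rewrite (RintegralD mI i01 i2) (RintegralD mI i0 i1) (RintegralZl A mI (ig 0%N)).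
by congr (_ + _ + _); [exact: E1|exact: E2].
Qed.

(** The length $q-p$ is at most $1$, so the constant is that of the pointwise bound; the supremum may be
   infinite. *)
Lemma integrated_bound (h v : R -> R) (C : R) : p <= q -> 0 < C ->
  mu.-integrable I (EFin \o h) ->
  (forall x, p <= x <= q -> `|h x - expansion s x| <= C * v x) ->
  (`|\int[mu]_(x in I) (h x)%:E - (\int[mu]_(x in I) expansion s x)%:E| <=
    C%:E * ereal_sup [set (v x)%:E | x in I])%E.
Proof.
move=> pq C0 ih hb; have [iE _] := integral_expansion.
have ub x : p <= x <= q -> ((v x)%:E <= ereal_sup [set (v x)%:E | x in I])%E.
  by move=> xI; apply: ereal_sup_ubound; exists x => //=; rewrite in_itv.
have pI : p <= p <= q by rewrite lexx.
case: (ereal_sup _) ub => [M ub|_|/(_ _ pI) ub]; last by move: ub; rewrite leNgt ltNyr.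
  have {}ub x : p <= x <= q -> v x <= M by move=> /ub; rewrite lee_fin.
  have -> : (\int[mu]_(x in I) (h x)%:E = (\int[mu]_(x in I) h x)%:E)%E.
    by rewrite /Rintegral fineK//; exact: integrable_fin_num.
  rewrite -EFinB -EFinM lee_fin -(RintegralB mI ih iE).
  have id : mu.-integrable I (EFin \o (fun x => h x - expansion s x)).
    by have := integrableB mI ih iE; apply: eq_integrable.
  apply: le_trans (le_normr_Rintegral mI id) _.
  have CM x : p <= x <= q -> `|h x - expansion s x| <= C * M.
    by move=> xI; apply: le_trans (hb _ xI) _; rewrite ler_pM2l// ub.
  have CM0 : 0 <= C * M := le_trans (normr_ge0 _) (CM _ pI).
  apply: (@le_trans _ _ (\int[mu]_(x in I) (C * M))).
    apply: le_Rintegral => //.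
    - exact: (integrable_norm id).
    - by apply: continuous_itv_integrable => x _; exact: cvg_cst.
  rewrite Rintegral_cst// (_ : fine _ = q - p).
    by rewrite ler_piMr//; rewrite lerBlDr (le_trans (ltW q1))// lerDl ltW.
  have H := lebesgue_measure_itv (`[p, q] : interval R).
  have {}H : lebesgue_measure (`[p, q]%classic : set R) = (q - p)%:E.
    rewrite H /= lte_fin; case: ltP => [_|qp]; first by rewrite EFinB.
    by rewrite (le_anti (introT andP (conj pq qp))) subrr.
  exact: (congr1 fine H).
by rewrite gt0_muley ?lte_fin// leey.
Qed.

End integrated.

End expansion.

(** * Undershoot of a killed subordinator *)

Section subordinator.
Context d (T : measurableType d) (R : realType) (P : probability T R).
Notation mu := (@lebesgue_measure R).
Variables (Y : R -> T -> R) (zeta : T -> \bar R) (X : R -> T -> option R) (q : R).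
Hypothesis mY : forall t, 0 <= t -> measurable_fun setT (Y t).
Hypothesis Y0 : forall w, Y 0 w = 0.
Hypothesis ndY : forall w t t', 0 <= t -> t <= t' -> Y t w <= Y t' w.
Hypothesis rcY : forall w t, 0 <= t -> Y u w @[u --> t^'+] --> Y t w.
Hypothesis llY : forall w t, 0 < t -> cvg (Y u w @[u --> t^'-]).
Hypothesis mzeta : measurable_fun setT zeta.
Hypothesis XE : forall t w, 0 <= t ->
  X t w = if (t%:E < zeta w)%E then Some (Y t w) else None.
Hypothesis indepY : forall t h, 0 <= t -> 0 <= h ->
  independent_systems P (sigma_process `[0, t] Y)
    (preimage_set_system setT (fun w => Y (t + h) w - Y t w) measurable).
Hypothesis stationaryY : forall t h, 0 <= t -> 0 <= h -> forall B : set R, measurable B ->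
  P ((fun w => Y (t + h) w - Y t w) @^-1` B) = P ((fun w => Y h w - Y 0 w) @^-1` B).
Hypothesis zetalaw : forall t, 0 <= t -> P [set w | (t%:E < zeta w)%E] = (expR (- (q * t)))%:E.
Hypothesis indepz : independent_systems P (sigma_process `[0, +oo[ Y)
  (preimage_set_system setT zeta measurable).
Variables (Phi : R[i] -> R[i]) (a b : R) (Pi : {measure set R -> \bar R}).
Hypothesis hPhi : is_laplace_exponent P X Phi.
Hypothesis hPi : has_levy_triplet Phi a b Pi.
Hypothesis hX0 : [\/ 0 < a, 0 < b | (0 < Pi `]0%R, +oo[%classic)%E].
Local Notation U := (occupation P mY rcY ndY mzeta).

Let Phi_gt0 z : 0 < complex.Re z -> 0 < complex.Re (Phi z) := @Re_levy_exponent_gt0 _ _ _ _ _ hPi hX0 z.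
Let Pi_fin x : 0 < x -> (Pi `]x, +oo[%classic < +oo)%E := @levy_tail_lty _ _ _ _ _ hPi x.

Lemma Im_levy_exponent0 p : 0 <= p -> complex.Im (Phi (p +i* 0)) = 0.
Proof.
move=> p0; have [_ _ _ _ /(_ (p +i* 0) p0) ->] := hPi.
rewrite /= mulr0 mul0r !add0r.
under eq_Rintegral => x _ do rewrite !mulr0 !mul0r !addr0 oppr0 sin0 mulr0 subr0.
by rewrite Rintegral_cst ?mul0r//; exact: measurable_itv.
Qed.

Let phi p := complex.Re (Phi (p +i* 0)).

Let killed_exp p t : 0 <= p -> 0 <= t ->
  \int[P]_(w in alive_at zeta t) expR (- (p * Y t w)) = expR (- (phi p * t)).
Proof.
move=> p0 t0; have [h _] := alive_laplace mY Y0 ndY mzeta XE hPhi 0 p0 t0.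
rewrite Im_levy_exponent0// mul0r cos0 mulr1 in h.
by rewrite /phi -h; apply: eq_Rintegral => w _; rewrite mul0r cos0 mulr1.
Qed.

Let ie p : 0 <= p -> Pi.-integrable `]0, +oo[ (EFin \o (fun x => 1 - expR (- (p * x)))).
Proof.
move=> p0; have := integrable_expRcos hPi 0 p0; apply: eq_integrable.
  exact: measurable_itv.
by move=> x _; rewrite /= mul0r cos0 mulr1.
Qed.

Let phiE p : 0 <= p -> phi p = a + b * p + \int[Pi]_(x in `]0, +oo[) (1 - expR (- (p * x))).
Proof.
move=> p0; rewrite /phi (Re_levy_exponent hPi 0 p0); congr (_ + _).
by apply: eq_Rintegral => x _; rewrite mul0r cos0 mulr1.
Qed.

(** $1_{x\le c}\le e^{c}e^{-x}$, and the Laplace transform at $1$ is finite. *)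
Lemma occupation_fin c : (U `]-oo, c]%classic < +oo)%E.
Proof.
have /integrableP[m1 lty] := laplaceable_occupation mY rcY Y0 ndY mzeta XE hPhi Phi_gt0 (s := 1) ltr01.
pose f (x : measurableTypeR R) := (expR (- (1 * x)))%:E.
have mf : measurable_fun [set: measurableTypeR R] f.
  by apply/measurable_EFinP; exact: measurable_expRM.
have f0 x : (0 <= f x)%E by rewrite lee_fin expR_ge0.
have {}lty : (\int[U]_x f x < +oo)%E.
  rewrite -occupation_nneg//; apply: le_lt_trans lty; rewrite le_eqVlt; apply/orP; left; apply/eqP.
  by apply: eq_integral => x _; rewrite /= mul1r ger0_norm ?expR_ge0.
have mC : measurable (`]-oo, c]%classic : set (measurableTypeR R)) by exact: measurable_itv.
have h : ((expR (- c))%:E * U `]-oo, c]%classic <= \int[U]_x f x)%E.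
  rewrite -integral_cst//; apply: (@le_trans _ _ (\int[U]_(x in `]-oo, c]%classic) f x)%E).
    apply: ge0_le_integral => //; first by move=> x _; rewrite lee_fin expR_ge0.
    exact: measurable_funTS.
    by move=> x; rewrite /= in_itv/= => xc; rewrite lee_fin ler_expR mul1r lerN2.
  exact: ge0_subset_integral.
move: h; case: (U _) => [r|h|_] //; first by rewrite ltry.
by move: lty; rewrite ltNge => /negP[]; apply: le_trans h; rewrite gt0_muley// lte_fin expR_gt0.
Qed.

Lemma occupation_sigma_finite : sigma_finite setT U.
Proof.
exists (fun n => `]-oo, n%:R]%classic : set (measurableTypeR R)).
  apply/seteqP; split=> // x _; exists (Num.truncn `|x|).+1 => //.
  by rewrite /= in_itv/= (le_trans (ler_norm x))// ltW// truncnS_gt.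
by move=> n; split; [exact: measurable_itv|exact: occupation_fin].
Qed.

Section density.
Variable u : R -> R.
Hypothesis u_ge0 : forall x, 0 < x -> 0 <= u x.
Hypothesis cu : forall x, 0 < x -> {for x, continuous u}.
Hypothesis uE : forall A, measurable (A : set (measurableTypeR R)) -> A `<=` `]0, +oo[ ->
  U A = (\int[mu]_(x in A) (u x)%:E)%E.

Let tl := levy_tail Pi.
Let tl_ge0 r : 0 <= tl r. Proof. exact: levy_tail_ge0. Qed.
Let tl_ni r r' : 0 < r -> r <= r' -> tl r' <= tl r. Proof. exact: levy_tail_ni. Qed.
Let tl_le r0 r1 e : 0 < r0 -> r0 < r1 -> 0 < e ->
  \forall n \near \oo, n.+1%:R * killed_law P Y zeta (time R n) `[r1, +oo[ <= tl r0 + e.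
Proof. exact: (killed_tail_le mY Y0 ndY mzeta killed_exp ie phiE Pi_fin). Qed.
Let tl_ge r0 r1 e : 0 < r0 -> r0 < r1 -> 0 < e ->
  \forall n \near \oo, tl r1 - e <= n.+1%:R * killed_law P Y zeta (time R n) `]r0, +oo[.
Proof. exact: (killed_tail_ge mY Y0 ndY mzeta killed_exp ie phiE Pi_fin). Qed.

Let law_density s (s0 : 0 < s) A : measurable (A : set (measurableTypeR R)) -> A `<=` `]0, s[ ->
  crossing_law P mY Y0 ndY rcY llY mzeta XE s0 A =
  (\int[mu]_(y in A) (u y * tl (s - y))%:E)%E.
Proof.
apply: (crossing_density u_ge0 cu uE tl_ge0 tl_ni).
- by move=> B mB; exact: crossing_law_fin.
- exact: (crossing_law_le Y0 llY XE indepY stationaryY zetalaw indepz occupation_fin tl_ge0 tl_le).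
- exact: (crossing_law_ge Y0 llY XE indepY stationaryY zetalaw indepz occupation_fin tl_ge0 tl_ge).
Qed.

(** The scaling $y=sx$ of the density of the undershoot. *)
Theorem undershoot_density s (A : set R) : 0 < s -> measurable A -> A `<=` `]0, 1[ ->
  undershoot_law P X s A =
  (\int[mu]_(x in A) (s * levy_tail Pi (s - s * x) * u (s * x))%:E)%E.
Proof.
move=> s0 mA A01.
pose B : set (measurableTypeR R) := [set y | A (y / s)].
have mB : measurable B.
  rewrite -[B]setTI; have : measurable_fun [set: measurableTypeR R] (fun y : R => y / s).
    exact: mulrr_measurable.
  by apply.
have B0s : B `<=` `]0, s[.
  move=> y /A01; rewrite /= !in_itv/= => /andP[h1 h2].
  by move: h1 h2; rewrite ltr_pdivrMr// mul1r => h1 ->; rewrite -(pmulr_lgt0 _ (_ : 0 < s^-1)) ?invr_gt0// h1.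
have -> : undershoot_law P X s A = crossing_law P mY Y0 ndY rcY llY mzeta XE s0 B.
  rewrite crossing_lawE//; congr (P _); apply/seteqP; split=> w [h1 h2]; split=> //.
    exact/(passage_lt_lifetime XE).
  exact/(passage_lt_lifetime XE).
rewrite law_density//.
pose f (y : R) := u y * tl (s - y).
have mf : measurable_fun B f.
  apply: (measurable_funS _ B0s); first exact: measurable_itv.
  exact: measurable_crossing_density.
have f0 y : B y -> 0 <= f y.
  by move=> /B0s; rewrite /= in_itv/= => /andP[y0 _]; rewrite mulr_ge0// u_ge0.
have mf' : measurable_fun B (EFin \o f) by exact/measurable_EFinP.
have := @ge0_integral_dilation R s B (fun y => (s * f y)%:E) s0 mB.
have AE : [eta *%R s] @^-1` B = A.
  by apply/seteqP; split=> x; rewrite /B/= mulrAC mulfV ?mul1r// gt_eqF.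
rewrite AE => E.
have -> : (\int[mu]_(x in A) (s * levy_tail Pi (s - s * x) * u (s * x))%:E =
    \int[mu]_(x in A) (s * f (s * x))%:E)%E.
  by apply: eq_integral => x _; rewrite /f /tl (mulrC (u _)) mulrA.
rewrite E.
- have -> : (\int[mu]_(y in B) (s * f y)%:E = s%:E * \int[mu]_(y in B) (f y)%:E)%E.
    rewrite -ge0_integralZl_EFin ?(ltW s0)//.
  by rewrite muleA -EFinM mulVf ?mul1e// gt_eqF.
- by apply/measurable_EFinP; exact: measurable_funM.
- by move=> y /f0 fy; rewrite lee_fin mulr_ge0// ltW.
Qed.

End density.

End subordinator.

Theorem theorem3p9 (d : measure_display) (T : measurableType d) (R : realType)
    (P : probability T R) (X : R -> T -> option R) (Phi : R[i] -> R[i])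
    (a b : R) (Pi : {measure set R -> \bar R})
    (n : nat) (c beta : nat -> R) (rho : R -> R)
    (hX : is_killed_subordinator P X)
    (hPhi : is_laplace_exponent P X Phi)
    (hPi : has_levy_triplet Phi a b Pi)
    (hX0 : [\/ 0 < a, 0 < b | (0 < Pi `]0%R, +oo[%classic)%E])
    (hc0 : 0 < c 0%N)
    (hc : forall k : nat, (1 <= k <= n)%N -> c k != 0)
    (hbeta0 : 0 < beta 0%N <= 1)
    (hbeta : forall k : nat, (k < n)%N -> beta k < beta k.+1)
    (hrho_gt0 : forall t, 0 < t -> 0 < rho t)
    (hrho_loc : locally_integrable `]0, +oo[ rho)
    (hrho_mono : exists2 r, 0 < r &
       forall t t', r < t -> t <= t' -> rho t' <= rho t)
    (hrho_o : rho t / t `^ (- 1 - beta n) @[t --> +oo] --> (0 : R))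
    (hPhi_O : exists C M : R, [/\ 0 < C, 0 < M & forall z : R[i],
       0 < complex.Re z -> M < ComplexField.Normc.normc z ->
       ComplexField.Normc.normc (cderiv (fun z => (Phi z)^-1 -
           \sum_(0 <= k < n.+1) ((c k)%:C * cpow z (beta k)%:C)^-1) z)
         <= C * rho (ComplexField.Normc.normc z)]) :
  (exists u : R -> R, is_continuous_potential_density P X u) /\
  forall u : R -> R, is_continuous_potential_density P X u ->
  [/\ (forall s : R, 0 < s -> forall A : set R,
         measurable A -> A `<=` `]0, 1[ ->
         undershoot_law P X s A =
         (\int[lebesgue_measure]_(x in A)
            (s * levy_tail Pi (s - s * x) * u (s * x))%:E)%E),
      (forall p q : R, 0 < p -> p <= q -> q < 1 ->
         exists C delta : R, [/\ 0 < C, 0 < delta & forall s x : R,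
           0 < s < delta -> p <= x <= q ->
           `| s * levy_tail Pi (s - s * x) * u (s * x) -
              (sin (pi * beta 0%N) / pi * x `^ (- 1 + beta 0%N)
                 * (1 - x) `^ (- beta 0%N) +
               \sum_(1 <= k < n.+1)
                 (c 0%N * s `^ (beta k - beta 0%N) / c k
                  * rgamma (beta k) * rgamma (1 - beta 0%N)
                  * x `^ (- 1 + beta k) * (1 - x) `^ (- beta 0%N)) +
               \sum_(0 <= k < n.+1)
                 (s `^ (beta k) / c k * rgamma (beta k)
                  * x `^ (- 1 + beta k)
                  * eps2 Pi (c 0%N) (beta 0%N) (s - s * x))) |
           <= C * eps3 Pi rho s x]) &
      (forall p q : R, 0 < p -> p <= q -> q < 1 ->
         exists C delta : R, [/\ 0 < C, 0 < delta & forall s : R,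
           0 < s < delta ->
           (`| undershoot_law P X s `[p, q] -
              (sin (pi * beta 0%N) / pi *
                 \int[lebesgue_measure]_(x in `[p, q])
                   (x `^ (- 1 + beta 0%N) * (1 - x) `^ (- beta 0%N)) +
               \sum_(1 <= k < n.+1)
                 (c 0%N * s `^ (beta k - beta 0%N) / c k
                  * rgamma (beta k) * rgamma (1 - beta 0%N)
                  * \int[lebesgue_measure]_(x in `[p, q])
                      (x `^ (- 1 + beta k) * (1 - x) `^ (- beta 0%N))) +
               \sum_(0 <= k < n.+1)
                 (s `^ (beta k) / c k * rgamma (beta k)
                  * \int[lebesgue_measure]_(x in `[p, q])
                      (x `^ (- 1 + beta k)
                       * eps2 Pi (c 0%N) (beta 0%N) (s - s * x))))%R%:E |
           <= C%:E * ereal_sup [set (eps3 Pi rho s x)%:E | x in `[p, q]])%E])].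
Proof.
have [Y [zeta [q [[mY rcY llY indepY stationaryY] [Y0 ndY] [mzeta _ _ zetalaw] indepz XE]]]] := hX.
have [r r0 rho_ni] := hrho_mono; have [C0 [M [C0_gt0 _ derO]]] := hPhi_O.
have Phi_gt0 z : 0 < complex.Re z -> 0 < complex.Re (Phi z) := @Re_levy_exponent_gt0 _ _ _ _ _ hPi hX0 z.
pose U := occupation P mY rcY ndY mzeta.
have sU : sigma_finite setT U := occupation_sigma_finite mY Y0 ndY rcY mzeta XE hPhi hPi hX0.
have lU := laplaceable_occupation mY rcY Y0 ndY mzeta XE hPhi Phi_gt0.
have lapU z : 0 < complex.Re z -> lap U `[0, +oo[%classic idfun (fun=> 1) z = (Phi z)^-1.
  exact: (lap_occupation mY rcY Y0 ndY mzeta XE hPhi Phi_gt0).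
pose U' : {sigma_finite_measure set (measurableTypeR R) -> \bar R} := sigma_finite_measure_of sU.
have PU A : measurable (A : set (measurableTypeR R)) -> potential_measure P X A = U A.
  exact: (potential_measureE P mY rcY ndY mzeta XE).
split.
  have [u [u0 cu uE]] := potential_density_exists hbeta0 hbeta hrho_gt0 hrho_loc r0 rho_ni hrho_o
    (U := U') lU lapU C0_gt0 derO.
  by exists u; split=> // A mA AD; rewrite PU//; exact: uE.
move=> u [u0 cu uP].
have uE A : measurable (A : set (measurableTypeR R)) -> A `<=` `]0, +oo[ ->
    U A = (\int[lebesgue_measure]_(x in A) (u x)%:E)%E.
  by move=> mA AD; rewrite -PU//; exact: uP.
have dens s (A : set R) : 0 < s -> measurable A -> A `<=` `]0, 1[ -> undershoot_law P X s A =
    (\int[lebesgue_measure]_(x in A) (s * levy_tail Pi (s - s * x) * u (s * x))%:E)%E.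
  move=> s0 mA A01; have H := undershoot_density Y0 llY XE indepY stationaryY zetalaw indepz hPhi hPi hX0 u0 cu uE s0 mA A01.
  exact: H.
have [K [x0 [K0 x00 asym]]] := potential_density_asymptotics hbeta0 hbeta hrho_gt0 hrho_loc r0 rho_ni hrho_o
    (U := U') lU lapU C0_gt0 derO u0 cu uE.
have Pi_fin x : 0 < x -> (Pi `]x, +oo[%classic < +oo)%E := @levy_tail_lty _ _ _ _ _ hPi x.
have bound p q' s x : 0 < p -> q' < 1 -> 0 < s < x0 -> p <= x <= q' ->
    `|s * levy_tail Pi (s - s * x) * u (s * x) - expansion n c beta Pi s x| <= K * eps3 Pi rho s x.
  move=> p0 q1 /andP[s0 sx0] /andP[px xq].
  have xp : 0 < x := lt_le_trans p0 px; have x1 : x < 1 := le_lt_trans xq q1.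
  rewrite expansionE ?xp// -mulrBr normrM ger0_norm; last by rewrite mulr_ge0 ?levy_tail_ge0// ltW.
  rewrite /eps3 mulrCA ler_wpM2l//; first by rewrite mulr_ge0 ?levy_tail_ge0// ltW.
  apply: asym; rewrite mulr_gt0//=; apply: le_lt_trans sx0.
  by rewrite ler_piMr// ltW.
split.
- by move=> s s0 A mA A01; exact: dens.
- move=> p q' p0 pq q1; exists K, x0; split=> // s x sx xpq.
  exact: (bound p q').
- move=> p q' p0 pq q1; exists K, x0; split=> // s sx.
  have s0 : 0 < s by case/andP: sx.
  have [_ <-] := integral_expansion n c beta Pi_fin p0 q1 s0.
  have I01 : (`[p, q']%classic : set R) `<=` `]0, 1[.
    by move=> x; rewrite /= !in_itv/= => /andP[px xq]; rewrite (lt_le_trans p0 px) (le_lt_trans xq q1).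
  rewrite (dens s _ s0 (measurable_itv `[p, q']) I01).
  apply: integrated_bound => //.
    have cf x : p <= x <= q' -> {for x, continuous (fun x => s * u (s * x))}.
      move=> /andP[px _]; apply: cvgMr.
      apply: (@continuous_comp _ _ _ (fun x : R => s * x) u); first by apply: cvgMr; exact: cvg_id.
      by apply: cu; rewrite mulr_gt0// (lt_le_trans p0).
    have := integrable_tail_mul Pi_fin q1 s0 cf; apply: eq_integrable; first exact: measurable_itv.
    by move=> x _; rewrite /= mulrAC.
  by move=> x xpq; exact: (bound p q').
Qed.
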